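(* Let $m$ be a Radon measure with full support on a locally compact metric space $(\mathcal X,d)$ and let $X$ be a Hunt process on $\mathcal X$ with infinitesimal generator $\mathcal L$. Suppose that $(\mathcal X,d,m)$ satisfies VD and RVD, and that the increasing function $\phi$ is reverse doubling. Suppose $\mathbf J_\phi$ and $(\mathbf{EP})_{\phi,r_0,\le}$ hold for some $r_0\in(0,\infty]$. Then the uniform boundary Harnack principle holds for $\mathcal L$ (equivalently, for $X$) with radius $R:=\frac{\operatorname{diam}(\mathcal X)}{2\lambda_0}\wedge r_0$, where $\lambda_0\ge2$ is the constant in RVD. That is, for every $\kappa\in(0,2)$ there is a constant $C\in(1,\infty)$, depending only on $\kappa$ and the parameters in VD, RVD, the doubling bound and the reverse doubling bound of $\phi$, $\mathbf J_\phi$ and $(\mathbf{EP})_{\phi,r_0,\le}$, such that for any proper open set $D\subset\mathcal X$, any $r\in(0,R)$, any $\xi\in\partial D$ and any two non-negative functions $h_1,h_2$ that are regular harmonic with respect to $X$ in $D\cap B(\xi,2r)$ and vanish on $B(\xi,2r)\setminus D$, we have $$h_1(x)h_2(y)\le C\,h_1(y)h_2(x)\qquad\text{for all }x,y\in D\cap B(\xi,\kappa r).$$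
   Context: Setting. $B(x,r)=\{y\in\mathcal X:d(x,y)<r\}$, $V(x,r)=m(B(x,r))$. $X=(X_t,\zeta,\mathcal G_t,\mathbb P_x)$ is a Hunt process on $\mathcal X$ with lifetime $\zeta\in(0,\infty]$, minimal admissible augmented filtration $\{\mathcal G_t\}$, and $X_t=\partial$ for $t\ge\zeta$, where $\partial$ is the cemetery point (functions on $\mathcal X$ are taken to be $0$ at $\partial$). For Borel $D\subset\mathcal X$, $\tau_D=\inf\{t\ge0:X_t\notin D\}$. Lévy system. For a kernel $J(x,dy)$ (for each $x$ a $\sigma$-finite measure on $\mathcal X\setminus\{x\}$), $(J(x,dy),t)$ is a Lévy system of $X$ if for every nonnegative $f$ on $[0,\infty)\times\mathcal X\times\mathcal X$ vanishing on the diagonal of $\mathcal X\times\mathcal X$, every $\{\mathcal G_t\}$-stopping time $T$ and every $x\in\mathcal X$, $\mathbb E_x\sum_{s\le T}f(s,X_{s-},X_s)=\mathbb E_x\int_0^T\int_{\mathcal X}f(s,X_s,y)J(X_s,dy)ds$. The function $\phi:[0,\infty)\to[0,\infty)$ is strictly increasing with $\phi(0)=0$, $\phi(1)=1$, and doubling: there are $c\ge1,\beta>0$ with $\phi(R)/\phi(r)\le c(R/r)^\beta$ for all $0<r\le R<\infty$. It is reverse doubling if there are constants $a,b>1$ with $\phi(ar)\ge b\,\phi(r)$ for every $r>0$. VD: there is $C_1\in(1,\infty)$ with $V(x,2r)\le C_1V(x,r)$ for all $x\in\mathcal X$, $r\in(0,\infty)$. RVD: there are $\lambda_0\ge2$ and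 $C_2>1$ with $V(x,\lambda_0r)\ge C_2V(x,r)$ for all $x\in\mathcal X$, $0<r\le\operatorname{diam}(\mathcal X)/\lambda_0$. $\mathbf J_\phi$: there are a kernel $J(x,y)$ and positive constants $C_1,C_2$ such that $(J(x,y)m(dy),t)$ is a Lévy system of $X$ and $\frac{C_1}{V(x,d(x,y))\phi(d(x,y))}\le J(x,y)\le\frac{C_2}{V(x,d(x,y))\phi(d(x,y))}$ for all $x\ne y$ in $\mathcal X$. $(\mathbf{EP})_{\phi,r_0,\le}$: there is $C>0$ such that $\mathbb P_x(\tau_{B(x,r)}<t)\le C\,t/\phi(r)$ for every $t>0$, $x\in\mathcal X$, $r\in(0,r_0)$. Regular harmonic: a function $h$ on $\mathcal X$ is regular harmonic with respect to $X$ in an open set $U$ if $\mathbb E_x[|h(X_{\tau_U})|;\tau_U<\infty]<\infty$ and $h(x)=\mathbb E_x[h(X_{\tau_U});\tau_U<\infty]$ for every $x\in U$. *)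

(* Defs.v *)
From HB Require Import structures.
From mathcomp Require Import all_boot all_order all_algebra.
From mathcomp Require Import all_classical all_reals all_analysis.
From mathcomp Require Import measurable_realfun.

Set Implicit Arguments.
Unset Strict Implicit.
Unset Printing Implicit Defensive.
Import Order.TTheory GRing.Theory Num.Theory.
Import numFieldNormedType.Exports.

Local Open Scope classical_set_scope.
Local Open Scope ring_scope.
Local Open Scope ereal_scope.

(* Pointed, because [measurableType] is; the theorem is vacuous on an empty
   space. *)
#[short(type="pmetricType")]
HB.structure Definition PointedMetric (K : numDomainType) :=
  { T of Metric K T & isPointed T }.

Notation borel T := (g_sigma_algebraType (@open T)).

(* The state space with its cemetery point [None]: it is isolated if T is
   compact. *)
Notation "T ^∂" := (one_point_compactification T) (at level 2, format "T ^∂").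
Notation "∂" := (None : one_point_compactification _).

Section metric_measure_space.
Context {R : realType} {T : pmetricType R}.
Implicit Type m : {measure set (borel T) -> \bar R}.

Definition radon m : Prop :=
  [/\ forall K : set T, compact K -> m K < +oo,
      forall A : set (borel T), measurable A ->
        m A = ereal_inf [set m U | U in [set U : set T | open U /\ A `<=` U]]
    & forall U : set T, open U ->
        m U = ereal_sup [set m K | K in [set K : set T | compact K /\ K `<=` U]]].

Definition full_support m : Prop :=
  forall U : set T, open U -> U !=set0 -> 0 < m U.

Definition diam (S : set T) : \bar R :=
  ereal_sup [set d | exists x y, [/\ S x, S y & d = (mdist x y)%:E]].

Definition VD m (C1 : R) : Prop :=
  forall (x : T) (r : R), (0 < r)%R ->
    m (ball x (2 * r)%R) <= C1%:E * m (ball x r).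

Definition RVD m (lambda0 C2 : R) : Prop :=
  forall (x : T) (r : R), (0 < r)%R -> r%:E <= diam [set: T] * lambda0^-1%:E ->
    C2%:E * m (ball x r) <= m (ball x (lambda0 * r)%R).

(* Borel functions are not enough: x |-> E_x[h(X_tau)] is in general only
   universally measurable. *)
Definition universally_measurable (h : T -> R) : Prop :=
  forall mu : probability (borel T) R,
    exists2 g : borel T -> R, measurable_fun [set: borel T] g &
      {ae mu, forall x, h x = g x}.

End metric_measure_space.

Section scale_function.
Context {R : realType}.
Implicit Type phi : R -> R.
Local Open Scope ring_scope.

Definition scale_function phi : Prop :=
  [/\ phi 0 = 0, phi 1 = 1 & forall r s, 0 <= r -> r < s -> phi r < phi s].

Definition doubling phi (c beta : R) : Prop :=
  forall r s, 0 < r -> r <= s -> phi s / phi r <= c * (s / r) `^ beta.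

Definition reverse_doubling phi (a b : R) : Prop :=
  forall r, 0 < r -> b * phi r <= phi (a * r).

End scale_function.

(* [path X t w] is X_t(w) and is only meaningful for 0 <= t. *)
Record process (R : realType) (T : pmetricType R) := Process {
  sample_display : measure_display ;
  sample : measurableType sample_display ;
  path :> R -> sample -> T^∂ ;
  law : T^∂ -> probability sample R }.

Section process_theory.
Context {R : realType} {T : pmetricType R} (X : process T).
Implicit Types (t : \bar R) (w : sample X) (A : set (sample X)).

(* The completion of P_x; [Pc x A] and [\int[Pc x]] are used for all events and
   functions that are measurable for the augmented filtration only. *)
Definition Pc (x : T^∂) := @completed_measure_extension _ _ _ (law X x).
Arguments Pc : clear implicits.
HB.instance Definition _ x := Measure.on (Pc x).

Definition at_time t w : T^∂ := if t is s%:E then X s w else ∂.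

Definition left_limit (s : R) w : T^∂ := lim (X u w @[u --> s^'-]).

Definition lifetime w : \bar R :=
  ereal_inf [set s%:E | s in [set s : R | (0 <= s)%R /\ X s w = ∂]].

Definition raw_filtration t : set (set (sample X)) :=
  <<s [set A | exists (s : R) (B : set (borel T^∂)),
    [/\ (0 <= s)%R, s%:E <= t, measurable B & A = X s @^-1` B]] >>.

(* Completion of the raw filtration with the null sets of
   P_mu := \int P_x(.) mu(dx). *)
Definition mu_filtration (mu : probability (borel T^∂) R) t
    : set (set (sample X)) :=
  [set A | exists B N, [/\ raw_filtration t B, raw_filtration +oo N,
     \int[mu]_x law X x N = 0 & (A `\` B) `|` (B `\` A) `<=` N]].

(* The minimal admissible augmented filtration. *)
Definition filtration t : set (set (sample X)) :=
  \bigcap_(mu in [set: probability (borel T^∂) R]) mu_filtration mu t.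

Definition stopping_time (S : sample X -> \bar R) : Prop :=
  (forall w, 0 <= S w) /\
  forall s : R, (0 <= s)%R -> filtration s%:E [set w | S w <= s%:E].

Definition stopped_filtration (S : sample X -> \bar R)
    : set (set (sample X)) :=
  [set A | filtration +oo A /\
     forall s : R, (0 <= s)%R -> filtration s%:E (A `&` [set w | S w <= s%:E])].

(* Integrating over the starting point gives the strong Markov property and
   quasi-left-continuity under every initial law P_mu. Both are required for
   all times in [0, +oo], with X_oo = ∂. *)
Record is_hunt : Prop := {
  hunt_measurable : forall s : R, (0 <= s)%R ->
    measurable_fun [set: sample X] (X s : sample X -> borel T^∂) ;
  hunt_law_measurable : forall (s : R) (B : set (borel T^∂)),
    (0 <= s)%R -> measurable B ->
    measurable_fun [set: borel T^∂]
      ((fun x => law X x (X s @^-1` B)) : borel T^∂ -> \bar R) ;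
  hunt_normal : forall x, law X x [set w | X 0%R w = x] = 1 ;
  hunt_lifetime : forall (s : R) w, (0 <= s)%R -> lifetime w <= s%:E -> X s w = ∂ ;
  hunt_shift : forall s : R, (0 <= s)%R ->
    exists theta : sample X -> sample X,
      forall (u : R) w, (0 <= u)%R -> X u (theta w) = X (u + s)%R w ;
  hunt_right_continuous : forall (s : R) w, (0 <= s)%R ->
    X u w @[u --> s^'+] --> X s w ;
  hunt_left_limits : forall (s : R) w, (0 < s)%R -> cvg (X u w @[u --> s^'-]) ;
  hunt_filtration_right_continuous : forall (s : R) A, (0 <= s)%R ->
    (forall u : R, (s < u)%R -> filtration u%:E A) -> filtration s%:E A ;
  hunt_strong_markov : forall S x (s : R) (B : set (borel T^∂)) A,
    stopping_time S -> (0 <= s)%R -> measurable B -> stopped_filtration S A ->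
    Pc x (A `&` [set w | B (at_time (S w + s%:E) w)]) =
    \int[Pc x]_(w in A) law X (at_time (S w) w) (X s @^-1` B) ;
  hunt_quasi_left_continuous : forall (S_ : nat -> sample X -> \bar R) S x,
    (forall n, stopping_time (S_ n)) -> stopping_time S ->
    (forall w, {homo S_ ^~ w : i j / (i <= j)%N >-> i <= j}) ->
    (forall w, S_ n w @[n --> \oo] --> S w) ->
    Pc x [set w | S w < +oo /\
      ~ (at_time (S_ n w) w @[n --> \oo] --> at_time (S w) w)] = 0 }.

Definition exit_time (D : set T) w : \bar R :=
  ereal_inf [set s%:E | s in
    [set s : R | (0 <= s)%R /\ ~ (Some @` D : set T^∂) (X s w)]].

Definition regular_harmonic (h : T -> R) (U : set T) : Prop :=
  let h_exit w := oapp h 0%R (at_time (exit_time U w) w) in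
  let exits := [set w | exit_time U w < +oo] in
  forall x, U x ->
    (\int[Pc (Some x)]_(w in exits) `|h_exit w|%:E) < +oo /\
    (h x)%:E = \int[Pc (Some x)]_(w in exits) (h_exit w)%:E.

(* (N(x,dy), t) is a Lévy system of X; N x is a measure on T \ {x}, extended
   by 0 to T. *)
Definition levy_system (N : R.-ker borel T ~> borel T) : Prop :=
  (forall x, N x [set x] = 0 /\ sigma_finite [set: borel T] (N x)) /\
  forall (f : (measurableTypeR R * borel T * borel T)%type -> R)
         (S : sample X -> \bar R) (x : T),
    measurable_fun setT f -> (forall p, 0 <= f p)%R ->
    (forall s y, f (s, y, y) = 0%R) ->
    stopping_time S ->
    \int[Pc (Some x)]_w
      (\esum_(s in [set s : R | (0 < s)%R /\ s%:E <= S w])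
        (if (left_limit s w, X s w) is (Some y, Some z)
         then (f (s, y, z))%:E else 0)) =
    \int[Pc (Some x)]_w
      (\int[@lebesgue_measure R]_(s in [set s : R | (0 <= s)%R /\ s%:E <= S w])
        (if X s w is Some y then \int[N y]_z (f (s, y, z))%:E else 0)).

(* Balls have finite positive measure under [radon], [full_support] and [VD] on
   a locally compact space, so that [fine] loses nothing. *)
Definition J_cond (m : {measure set (borel T) -> \bar R}) (phi : R -> R)
    (C1 C2 : R) : Prop :=
  let V (x : T) (r : R) := fine (m (ball x r)) in
  exists (J : T -> T -> R) (N : R.-ker borel T ~> borel T),
    [/\ measurable_fun setT
          ((fun p => J p.1 p.2) : (borel T * borel T)%type -> R),
        forall x y : T, x != y ->
          (C1 / (V x (mdist x y) * phi (mdist x y)) <= J x y /\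
           J x y <= C2 / (V x (mdist x y) * phi (mdist x y)))%R,
        forall (x : T) (A : set (borel T)), measurable A ->
          N x A = \int[m]_(y in A `\ x) (J x y)%:E
      & levy_system N].

Definition EP_le (phi : R -> R) (r0 : \bar R) (C : R) : Prop :=
  forall (t : R) (x : T) (r : R), (0 < t)%R -> (0 < r)%R -> r%:E < r0 ->
    Pc (Some x) [set w | exit_time (ball x r) w < t%:E] <= (C * t / phi r)%:E.

End process_theory.

(* Main.v *)
(* Let [U = D `&` ball xi (2 r)] and let [om U x] be the exit distribution of [U]
   from [x]. It suffices to find one function [u], independent of the set
   [A `<=` ~` ball xi (2 r)], such that [f x = om U x A] satisfies
   [f x * u y <= C * (f y * u x)] for x, y in [D `&` ball xi (kappa r)]: this
   extends to every regular harmonic function vanishing on [ball xi (2 r) `\`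
   D], and multiplying the bound for h1 by the one for h2 with x and y exchanged
   eliminates [u].
   For [u] we take the probability that the process leaves
   [W = D `&` ball xi (rho r)], kappa < rho < 2, by a jump into the annulus
   [ball xi (2 lambda0 r) `\` ball xi (2 r)]. With
   [La = phi r * \int_(z far from xi) f z N(xi, dz)], the Lévy system bounds [f]
   from below and [u] from above by [E_x tau_W / phi r] times [La] and a constant.
   For the upper bound on [f], one first shows f <= K La on a smaller ball
   (Carleson): from a small ball the process jumps far away with probability
   bounded below. Next, f <= K La (u + a_n) holds on balls of radius decreasing to
   kappa r, with a_n -> 0 geometrically: exit from [D `&` ball x s], where [u] is
   superharmonic with a deficit proportional to the mean exit time, which absorbs
   all the error terms.
   Exit times are measurable for the augmented filtration only. They are
   almost surely equal, by quasi-left-continuity, to the limits of the exit times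
   of an exhausting sequence of compact sets, for which the Markov property can be
   iterated. *)

(* The probabilistic and the analytic halves meet only in [harmonic_setting]. Once exit
   distributions exist as Borel measures, the estimates no longer mention paths, and every constant
   is a function of [kap], [Q], [lam], [g], fixed before the space. Before that, measurability is
   the obstacle: the integrands in the Lévy system are never shown to be jointly measurable, so both
   Lévy bounds rest on the monotonicity of the integral for arbitrary functions. The jump
   probability bounded below comes from a dichotomy for the mean exit time from a piece of
   [ball x s]. If it is small compared with [phi s], the exit estimate makes leaving the ball
   unlikely; if not, the Lévy system gives a definite chance of landing in the target. In both cases
   the exit mass that misses the target is at most some q < 1. Both iterations work at shrinking
   scales and lose a power of the scale, with exponent [g], at each step. Their ratios are tuned to
   this loss: [th] is so close to 1 that q th^-g < 1, and [eta] decays faster than the loss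
   grows. *)
Require Import Defs.
From HB Require Import structures.
From mathcomp Require Import all_boot all_order all_algebra.
From mathcomp Require Import all_classical all_reals all_analysis.
From mathcomp Require Import measurable_realfun.
From mathcomp Require Import ring lra.
Set Implicit Arguments.
Unset Strict Implicit.
Unset Printing Implicit Defensive.
Import Order.TTheory GRing.Theory Num.Theory.
Import numFieldNormedType.Exports.
Local Open Scope classical_set_scope.
Local Open Scope ring_scope.
Local Open Scope ereal_scope.

(** * Integration without measurability *)

Section integral_complements.
Context d (T : measurableType d) (R : realType).
Implicit Types (f g : T -> \bar R) (D : set T).

Import HBNNSimple.

(* Not a duplicate of [ge0_le_integral]: no measurability is required, because
   the integral is defined as a supremum over simple functions. *)
Lemma ge0_le_integral_nomeas (mu : {measure set T -> \bar R}) D f g :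
  (forall x, D x -> 0 <= f x) -> (forall x, D x -> f x <= g x) ->
  \int[mu]_(x in D) f x <= \int[mu]_(x in D) g x.
Proof.
move=> f0 fg.
rewrite ge0_integralE// ge0_integralE; last first.
  by move=> x Dx; rewrite (le_trans (f0 _ Dx))// fg.
apply: le_ereal_sup => _ [h /= hf <-]; exists h => //= x.
apply: (le_trans (hf x)); rewrite !patchE.
by case: ifPn => // /set_mem Dx; exact: fg.
Qed.

Lemma ge0_measurable_fun_ind (P : (T -> \bar R) -> Prop) :
  (forall A, measurable A -> P (fun x => (\1_A x)%:E)) ->
  (forall (k : R) f, (0 <= k)%R -> measurable_fun setT f ->
    (forall x, 0 <= f x) -> P f -> P (fun x => k%:E * f x)) ->
  (forall f g, measurable_fun setT f -> measurable_fun setT g ->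
    (forall x, 0 <= f x) -> (forall x, 0 <= g x) -> P f -> P g ->
    P (fun x => f x + g x)) ->
  (forall (f_ : nat -> T -> \bar R) f, (forall n, measurable_fun setT (f_ n)) ->
    (forall n x, 0 <= f_ n x) ->
    (forall x, {homo f_ ^~ x : m n / (m <= n)%N >-> m <= n}) ->
    (forall x, f_ n x @[n --> \oo] --> f x) -> (forall n, P (f_ n)) -> P f) ->
  forall f, measurable_fun setT f -> (forall x, 0 <= f x) -> P f.
Proof.
move=> P1 PZ PD Plim f mf f0.
have [g [ndg gf]] := approximation measurableT mf (fun x _ => f0 x).
apply: (Plim (fun n x => (g n x)%:E)).
- by move=> n; apply/measurable_EFinP.
- by move=> n x; rewrite lee_fin.
- by move=> x m n mn; rewrite lee_fin; exact/lefP/ndg.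
- by move=> x; exact: gf.
move=> n; move: (g n) => h.
(* Truncating at 0 makes every summand nonnegative, as the scaling hypothesis requires; it changes
   nothing, since all values of [h] are nonnegative. *)
pose F (y : R) x : \bar R :=
  (Num.max y 0)%:E * (\1_(h @^-1` [set y]) x)%:E.
have -> : (fun x => (h x)%:E) =
    (fun x => \sum_(y <- finmap.enum_fset (fset_set (range h))) F y x).
  apply/funext => x; rewrite sumEFin; congr EFin.
  rewrite [LHS]fimfunE fsbig_finite/=; last exact: fimfunP.
  rewrite big_seq [RHS]big_seq; apply: eq_bigr => y.
  rewrite in_fset_set; last exact: fimfunP.
  by move=> /set_mem[v _ <-]; rewrite max_l.
have m1 (y : R) : measurable_fun setT
    (fun x => (\1_(h @^-1` [set y]) x)%:E : \bar R).
  by apply/measurable_EFinP; exact: measurable_indic.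
have y0 y : (0 <= Num.max y 0 :> R)%R by rewrite le_max lexx orbT.
have F0 y x : 0 <= F y x by rewrite mule_ge0// lee_fin.
have mF y : measurable_fun setT (F y) by exact: measurable_funeM.
have PF y : P (F y) by apply: PZ => //; exact: P1.
elim: (finmap.enum_fset _) => [|i l IH].
  under eq_fun do rewrite big_nil.
  have -> : (fun=> 0) = (fun x : T => (\1_(set0 : set T) x)%:E : \bar R).
    by apply/funext => x; rewrite indicE in_set0.
  exact: P1.
under eq_fun do rewrite big_cons.
apply: PD => //; first exact: emeasurable_sum.
by move=> x; exact: sume_ge0.
Qed.
End integral_complements.

(** * Laws and their completions *)

Section completed_law.
Context {R : realType} {T : pmetricType R} (X : process T).
Local Notation PX x := (@Pc _ _ X x).
Local Notation Om := (sample X).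

Lemma Pc_le x (A B : set Om) : A `<=` B -> (PX x) A <= (PX x) B.
Proof. exact: le_mu_ext. Qed.

Lemma PcE x (A : set Om) : measurable A -> (PX x) A = law X x A.
Proof. exact: measurable_mu_extE. Qed.

Lemma measurable_Pc x (A : set Om) : measurable A ->
  measurable (A : set (caratheodory_type (law X x)^*%mu)).
Proof. exact: caratheodory_measurable_mu_ext. Qed.

Lemma measurable_fun_Pc x d' (U : measurableType d') (f : Om -> U) :
  measurable_fun setT f ->
  measurable_fun setT (f : caratheodory_type (law X x)^*%mu -> U).
Proof.
by move=> mf _ B mB; apply: measurable_Pc; exact: (mf measurableT B mB).
Qed.

(** The identity map from the completed σ-algebra to the original one is measurable and pushes
    [Pc x] forward to [law X x]. *)
Lemma integral_Pc x (f : Om -> \bar R) : measurable_fun setT f ->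
  (forall w, 0 <= f w) -> \int[PX x]_w f w = \int[law X x]_w f w.
Proof.
move=> mf f0.
have mid : measurable_fun setT (id : caratheodory_type (law X x)^*%mu -> Om).
  by apply: measurable_fun_Pc; exact: measurable_id.
transitivity (\int[pushforward (PX x) (id : _ -> Om)]_w f w).
  by rewrite ge0_integral_pushforward// preimage_setT.
by apply: eq_measure_integral => A mA _; exact: PcE.
Qed.

Lemma PcT x : (PX x) setT = 1.
Proof. by rewrite PcE// probability_setT. Qed.

End completed_law.

(** * Paths in the one-point compactification *)

Section shrink.
Context {R : realType} {T : pmetricType R}.
Implicit Types O : set T.

(** The strict inequality makes the set open. Points within 1 / (n + 1) of it lie in [O], so a limit
    of values in [shrink O n] is still in [O]. *)
Definition shrink O n : set T :=
  [set y | exists2 t : R, (n.+1%:R^-1 < t)%R & ball y t `<=` O].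

Lemma shrink_open O n : open (shrink O n).
Proof.
rewrite openE => y [t nt tO]; rewrite /interior; apply/nbhs_ballP.
pose t' := ((n.+1%:R^-1 + t) / 2)%R.
exists (t - t')%R => [|z yz] /=.
  by rewrite subr_gt0 /t' midf_lt.
exists t'; first by rewrite /t' midf_lt.
move=> v zv; apply: tO.
by have := ball_triangle yz zv; rewrite subrK.
Qed.

Lemma shrink_bigcup O : open O -> \bigcup_n shrink O n = O.
Proof.
move=> oO; apply/seteqP; split => [y [n _ [t nt]]|y Oy].
  apply; apply: ballxx; apply: lt_trans nt; by rewrite invr_gt0.
have /nbhs_ballP[e /= e0 eO] : nbhs y O by exact: open_nbhs_nbhs.
have /ltr_add_invr : (0 < e)%R by [].
by case=> n; rewrite add0r => ne; exists n => //; exists e.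
Qed.

Lemma shrink_near O n y z : shrink O n z -> ball y n.+1%:R^-1 z -> O y.
Proof.
move=> [t nt tO] yz; apply: tO; apply: ball_sym.
by apply: le_ball yz; exact: ltW.
Qed.

End shrink.

Section measurable_opc.
Context {R : realType} {T : pmetricType R}.

Lemma open_some_preimage (B : set T^∂) : open B -> open (Some @^-1` B : set T).
Proof.
move=> oB; rewrite openE => y By; rewrite /interior.
have : nbhs (Some y : T^∂) B by exact: open_nbhs_nbhs.
by [].
Qed.

Lemma measurable_some_open (O : set T) : open O ->
  measurable (Some @` O : set (borel T^∂)).
Proof.
by move=> oO; apply: sub_sigma_algebra; exact: one_point_compactification_open_some.
Qed.

Lemma measurable_some (A : set (borel T)) : measurable A ->
  measurable (Some @` A : set (borel T^∂)).
Proof.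
move=> mA.
suff : <<s @open T >> `<=` [set A | measurable (Some @` A : set (borel T^∂))].
  by move=> /(_ A mA).
apply: smallest_sub => [|O oO]; last exact: measurable_some_open.
split=> [|B mB|F mF] /=.
- by rewrite image_set0; exact: measurable0.
- have -> : Some @` ([set: T] `\` B) = (Some @` [set: T]) `\` (Some @` B).
    apply/seteqP; split => [_ [y [_ nB] <-]|_ [[y _ <-] nB]].
      by split; [exists y|case=> z Bz [zy]; apply: nB; rewrite -zy].
    by exists y => //; split=> // By; apply: nB; exists y.
  by apply: measurableD => //; apply: measurable_some_open; exact: openT.
- have -> : Some @` (\bigcup_k F k) = \bigcup_k (Some @` F k).
    apply/seteqP; split => [_ [y [k _ Fy] <-]|_ [k _ [y Fy <-]]].
      by exists k => //; exists y.
    by exists y => //; exists k.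
  by apply: bigcupT_measurable => k; exact: mF.
Qed.

(** An open set containing ∂ is the complement of the part of [T] that it misses, a difference of
    two images of open subsets of [T], so neighbourhoods of ∂ need no separate treatment. *)
Lemma measurable_fun_opc d (Om : measurableType d) (D : set Om)
    (Y : Om -> borel T^∂) :
  measurable D ->
  (forall O : set T, open O -> measurable (D `&` Y @^-1` (Some @` O))) ->
  measurable_fun D Y.
Proof.
move=> mD mY; apply: (@measurability _ _ _ _ D Y (@open T^∂)) => //.
move=> _ [B oB <-].
have oO := open_some_preimage oB.
have [Bc|Bc] := pselect (B (None : T^∂)).
- have -> : D `&` Y @^-1` B = D `\` ((D `&` Y @^-1` (Some @` [set: T])) `\`
     (D `&` Y @^-1` (Some @` (Some @^-1` B)))).
    apply/seteqP; split => [w /= [Dw BY]|w /= [Dw nBY]].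
      split => // -[[_ [y _ yY]]]; apply; split => //; exists y => //.
      by rewrite /preimage /= yY.
    split => //; case E : (Y w) => [y|] //.
    apply: contrapT => nB; apply: nBY; split; first by split => //; exists y.
    by move=> [_ [z Bz]]; rewrite E => -[zy]; apply: nB; rewrite -zy.
  by apply: measurableD => //; apply: measurableD; apply: mY => //; exact: openT.
- have -> : D `&` Y @^-1` B = D `&` Y @^-1` (Some @` (Some @^-1` B)).
    apply/seteqP; split => [w /= [Dw BY]|w /= [Dw [y By yY]]]; split => //.
      by case E : (Y w) BY => [y|] // By; exists y.
    by rewrite -yY.
  exact: mY.
Qed.

End measurable_opc.

Section paths.
Context {R : realType} {T : pmetricType R} (X : process T) (hX : is_hunt X).
Local Notation Om := (sample X).

Lemma lifetime_le s w : (0 <= s)%R -> X s w = ∂ -> lifetime w <= s%:E.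
Proof. by move=> s0 Xs; apply: ereal_inf_lbound; exists s. Qed.

Lemma dead_le s u w : (0 <= s)%R -> (s <= u)%R -> X s w = ∂ -> X u w = ∂.
Proof.
move=> s0 su Xs; apply: (hunt_lifetime hX); first exact: le_trans su.
by apply: (le_trans (lifetime_le s0 Xs)); rewrite lee_fin.
Qed.

Lemma right_near s w (O : set T^∂) : (0 <= s)%R -> nbhs (X s w) O ->
  exists2 e : R, (0 < e)%R & forall u, (s <= u < s + e)%R -> O (X u w).
Proof.
move=> s0 nO.
have : nbhs s [set u | (s < u)%R -> O (X u w)].
  exact: (hunt_right_continuous hX (w := w) s0 nO).
move=> /nbhs_ballP[e /= e0 eO].
exists e => // u /andP[]; rewrite le_eqVlt => /predU1P[<- _|su ue].
  exact: nbhs_singleton nO.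
apply: eO => //=; rewrite /ball /= ltr_distlC; apply/andP; split => //.
by rewrite ltrBlDr (lt_le_trans su)// lerDl ltW.
Qed.

Lemma right_near_open s w y (O : set T) : (0 <= s)%R -> open O ->
  X s w = Some y -> O y ->
  exists2 e : R, (0 < e)%R & forall u, (s <= u < s + e)%R ->
    (Some @` O : set T^∂) (X u w).
Proof.
move=> s0 oO Xs Oy; apply: right_near => //; rewrite Xs.
by apply: one_point_compactification_some_nbhs; exact: open_nbhs_nbhs.
Qed.

Section at_time_measurability.
Variables (G : set (set Om)) (S : Om -> \bar R) (u : \bar R).
Let OG : measurableType _ := g_sigma_algebraType G.
Hypothesis S0 : forall w, 0 <= S w.
Hypothesis GS : forall q : R, (0 <= q)%R -> q%:E < u ->
  measurable ([set w | S w < q%:E] : set OG).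
Hypothesis GX : forall (q : R) (O : set T), (0 <= q)%R -> q%:E < u -> open O ->
  measurable (X q @^-1` (Some @` O) : set OG).

Let rat_between s (v : \bar R) : (0 <= s)%R -> s%:E < v ->
  exists q : rat, (s < ratr q)%R /\ (ratr q)%:E < v.
Proof.
move=> s0; case: v => [v| |] //; rewrite ?lte_fin.
  by move=> /rat_in_itvoo[q]; rewrite in_itv /= => /andP[sq qv]; exists q.
move=> _; have /rat_in_itvoo[q] : (s < s + 1)%R by rewrite ltrDl.
by rewrite in_itv /= => /andP[sq qv]; exists q; rewrite ltry.
Qed.

Lemma measurable_lt_time : measurable ([set w | S w < u] : set OG).
Proof.
pose F (q : rat) : set OG :=
  if (0 <= ratr q :> R)%R && ((ratr q)%:E < u) then [set w | S w < (ratr q)%:E]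
  else set0.
have -> : [set w | S w < u] = \bigcup_q F q.
  apply/seteqP; split => [w /= Su|w [q _]]; last first.
    rewrite /F; case: ifPn => // /andP[q0 qu] /= Sq; exact: lt_trans qu.
  have : exists s, S w = s%:E /\ (0 <= s)%R.
    move: (S0 w) Su; case: (S w) => [s s0 _| |] //; first by exists s.
    by move=> _; rewrite ltNge leey.
  move=> [s [Ss s0]]; rewrite Ss in Su.
  have [q [sq qu]] := rat_between s0 Su; exists q => //.
  by rewrite /F qu (le_trans s0 (ltW sq)) /= Ss lte_fin.
apply: bigcupT_measurable_rat => q; rewrite /F.
by case: ifPn => // /andP[q0 qu]; exact: GS.
Qed.

(** By right continuity, X_S lies in [O] and S < u exactly when, for some [n] and some rational [q0]
    with S < q0 < u, all rational times in ]S, q0[ have values in [shrink O n]. Only times before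
    [u] occur, so the argument serves both the filtration at time [u] and the unaugmented one at
    infinity. *)
Lemma measurable_at_time :
  measurable_fun ([set w | S w < u] : set OG)
    ((fun w => at_time (S w) w) : OG -> borel T^∂).
Proof.
apply: measurable_fun_opc; first exact: measurable_lt_time.
move=> O oO.
pose H n (q q0 : rat) : set OG :=
  if (0 <= ratr q :> R)%R && (ratr q < ratr q0 :> R)%R then
    [set w | (ratr q)%:E <= S w] `|` X (ratr q) @^-1` (Some @` shrink O n)
  else setT.
pose F n (q0 : rat) : set OG :=
  if (0 <= ratr q0 :> R)%R && ((ratr q0)%:E < u) then
    [set w | S w < (ratr q0)%:E] `&` \bigcap_q H n q q0
  else set0.
have mF n q0 : measurable (F n q0).
  rewrite /F; case: ifPn => // /andP[q00 q0u].
  apply: measurableI; first exact: GS.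
  rewrite -[X in measurable X]setCK setC_bigcap; apply: measurableC.
  apply: bigcupT_measurable_rat => q; apply: measurableC; rewrite /H.
  case: ifPn => // /andP[q0' qq0].
  have qu : (ratr q)%:E < u by apply: lt_trans q0u; rewrite lte_fin.
  apply: measurableU; last by apply: GX => //; exact: shrink_open.
  have -> : [set w | (ratr q)%:E <= S w] = ~` [set w | S w < (ratr q)%:E].
    by apply/seteqP; split => w /=; rewrite leNgt => /negP.
  by apply: measurableC; exact: GS.
have -> : [set w | S w < u] `&` (fun w => at_time (S w) w : borel T^∂)
    @^-1` (Some @` O) = \bigcup_n \bigcup_q0 F n q0; last first.
  by apply: bigcupT_measurable => n; exact: bigcupT_measurable_rat.
apply/seteqP; split => [w /= [Su [y Oy Xy]]|w [n _ [q0 _]]].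
  have [s [Ss s0]] : exists s, S w = s%:E /\ (0 <= s)%R.
    move: (S0 w) Su; case: (S w) => [s s0 _| |] //; first by exists s.
    by move=> _; rewrite ltNge leey.
  rewrite Ss /= in Xy Su.
  have [n _ On] : (\bigcup_n shrink O n) y by rewrite shrink_bigcup.
  have [e e0 eO] := right_near_open s0 (@shrink_open _ _ O n) (esym Xy) On.
  have se : s%:E < Order.min (s + e)%:E u.
    by rewrite lt_min Su andbT lte_fin ltrDl.
  have [q0 [sq0]] := rat_between s0 se; rewrite lt_min => /andP[q0e q0u].
  exists n => //; exists q0 => //; rewrite /F q0u (le_trans s0 (ltW sq0)) /=.
  split; first by rewrite /= Ss lte_fin.
  move=> q _; rewrite /H; case: ifPn => // /andP[q00 qq0].
  have [qS|Sq] := leP (ratr q)%:E (S w); [by left|right].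
  rewrite Ss lte_fin in Sq.
  by apply: eO; rewrite (ltW Sq) (lt_trans qq0).
rewrite /F; case: ifPn => // /andP[q00 q0u] [/= Sq0 Hw].
have [s [Ss s0]] : exists s, S w = s%:E /\ (0 <= s)%R.
  move: (S0 w) Sq0; case: (S w) => [s s0 _| |] //; by exists s.
rewrite Ss lte_fin in Sq0.
have HX q : (s < ratr q :> R)%R -> (ratr q < ratr q0 :> R)%R ->
    (Some @` shrink O n : set T^∂) (X (ratr q) w).
  move=> sq qq0; have := Hw q I; rewrite /H qq0 (le_trans s0 (ltW sq)) /=.
  by case=> //=; rewrite Ss lee_fin leNgt sq.
split; first by rewrite /= Ss; apply: lt_trans q0u; rewrite lte_fin.
rewrite /preimage /= Ss /=.
case E : (X s w) => [y|]; last first.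
  have [q] := rat_in_itvoo Sq0; rewrite in_itv /= => /andP[sq qq0].
  have [z _] := HX q sq qq0; by rewrite (dead_le s0 (ltW sq) E).
exists y => //.
(* Shortly after S the path is within 1 / (n + 1) of X_S and, at a rational time, also in
   [shrink O n]; hence X_S is in [O]. *)
have [||e e0 eO] := @right_near s w (Some @` ball y n.+1%:R^-1).
- exact: s0.
- rewrite E; apply: one_point_compactification_some_nbhs.
  by apply: nbhsx_ballx; rewrite invr_gt0.
have : (s < Num.min (s + e) (ratr q0))%R by rewrite lt_min Sq0 ltrDl e0.
move=> /rat_in_itvoo[q]; rewrite in_itv /= lt_min => /and3P[sq qe qq0].
have [z zO Xz] := HX q sq qq0.
have [|z' yz' Xz'] := eO (ratr q); first by rewrite (ltW sq).
by move: Xz'; rewrite -Xz => -[z'z]; apply: shrink_near zO _; rewrite -z'z.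
Qed.

End at_time_measurability.
End paths.

(** * The strong Markov property on path space *)

Section shift.
Context {R : realType} {T : pmetricType R} (X : process T) (hX : is_hunt X).
Local Notation Om := (sample X).
Implicit Types S : Om -> \bar R.

(** Only the coordinates of the shifted sample point are prescribed: the sample space is arbitrary,
    and [th] carries no measurability assumption. *)
Definition shift_by S (th : Om -> Om) : Prop :=
  forall (u : R) w, (0 <= u)%R -> X u (th w) = at_time (S w + u%:E) w.

Lemma exists_shift S : (forall w, 0 <= S w) -> exists th, shift_by S th.
Proof.
move=> S0.
have : forall w, exists w', forall u : R, (0 <= u)%R ->
    X u w' = at_time (S w + u%:E) w.
  move=> w; move: (S0 w); case: (S w) => [s| |] //.
    rewrite lee_fin => s0; have [th thE] := hunt_shift hX s0.
    by exists (th w) => u u0; rewrite /= thE// addrC.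
  (* At infinite time every coordinate must be ∂. A sample point that starts at ∂ has this property,
     and one exists because that starting event has probability 1. *)
  move=> _; have := hunt_normal hX (None : T^∂).
  have [-> /=|/set0P[w' /= X0] _] := eqVneq [set w | X 0%R w = None] set0.
    by rewrite measure0 => /eqP; rewrite eq_sym onee_eq0.
  by exists w' => u u0 /=; exact: (dead_le hX (lexx 0%R) u0 X0).
by move=> /choice[th thE]; exists th => u w u0; exact: thE.
Qed.

End shift.

Section integral_transition.
Context d d1 d2 (O : measurableType d) (O1 : measurableType d1)
  (U : measurableType d2) (R : realType).
Variables (mu : {measure set O -> \bar R}) (D : set O).
Variables (Y Z : O -> U) (W : O1 -> U) (k : U -> {measure set O1 -> \bar R}).
Hypotheses (mD : measurable D) (mY : measurable_fun setT Y).
Hypotheses (mZ : measurable_fun setT Z) (mW : measurable_fun setT W).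
Hypothesis mk : forall B, measurable B -> measurable_fun setT (fun z => k z (W @^-1` B)).
Hypothesis YZ : forall B, measurable B ->
  mu (D `&` Y @^-1` B) = \int[mu]_(w in D) k (Z w) (W @^-1` B).

Let t (q : U -> \bar R) z := \int[k z]_w q (W w).

(** Measurability and the identity are proved by one induction: the linear and limit steps on the
    right-hand side integrate the inner integral, which must already be measurable. *)
Lemma integral_transition (q : U -> \bar R) :
  measurable_fun setT q -> (forall z, 0 <= q z) ->
  measurable_fun setT (fun z => \int[k z]_w q (W w)) /\
  \int[mu]_(w in D) q (Y w) = \int[mu]_(w in D) \int[k (Z w)]_v q (W v).
Proof.
rewrite -/(t q).
have t0 (f : U -> \bar R) z : (forall z, 0 <= f z) -> 0 <= t f z.
  by move=> f0; apply: integral_ge0.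
suff : forall q, measurable_fun setT q -> (forall z, 0 <= q z) ->
  measurable_fun setT (t q) /\
  \int[mu]_(w in D) q (Y w) = \int[mu]_(w in D) t q (Z w) by exact.
move=> {q}.
apply: ge0_measurable_fun_ind => [B mB|c f c0 mf f0|f g mf mg f0 g0|].
- have tE : t (fun z => (\1_B z)%:E) = fun z => k z (W @^-1` B).
    apply/funext => z; rewrite /t.
    rewrite (_ : (fun w => _) = (fun w => (\1_(W @^-1` B) w)%:E))//.
    rewrite integral_indic ?setIT//.
    by rewrite -[X in measurable X]setTI; exact: mW.
  rewrite tE; split; first exact: mk.
  rewrite -YZ// setIC -integral_indic//.
  by rewrite -[X in measurable X]setTI; exact: mY.
- move=> [mP PE].
  have tE : t (fun z => c%:E * f z) = fun z => c%:E * t f z.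
    apply/funext => z; rewrite /t ge0_integralZl_EFin//.
    exact: (measurableT_comp mf).
  rewrite tE; split; first exact: measurable_funeM.
  rewrite ge0_integralZl_EFin//; last first.
    by apply: measurable_funTS; exact: (measurableT_comp mf).
  rewrite PE ge0_integralZl_EFin//.
  + by move=> *; exact: t0.
  + by apply: measurable_funTS; exact: (measurableT_comp mP).
- move=> [mPf PEf] [mPg PEg].
  have tE : t (fun z => f z + g z) = fun z => t f z + t g z.
    by apply/funext => z; rewrite /t ge0_integralD//; exact: measurableT_comp.
  rewrite tE; split; first exact: emeasurable_funD.
  rewrite ge0_integralD//; last 2 first.
  + by apply: measurable_funTS; exact: (measurableT_comp mf).
  + by apply: measurable_funTS; exact: (measurableT_comp mg).
  rewrite PEf PEg -ge0_integralD//.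
  + by move=> *; exact: t0.
  + by apply: measurable_funTS; exact: (measurableT_comp mPf).
  + by move=> *; exact: t0.
  + by apply: measurable_funTS; exact: (measurableT_comp mPg).
- move=> f_ f mf f0 ndf cf Pf.
  have f0' z : 0 <= f z by apply: (cvge_ge _ (cf z)); exact: nearW.
  have tcvg z : t (f_ n) z @[n --> \oo] --> t f z.
    have := @cvg_monotone_convergence _ _ _ (k z) setT measurableT
      (fun n w => f_ n (W w)).
    rewrite (_ : (fun w => limn _) = fun w => f (W w)); last first.
      by apply/funext => w; apply/cvg_lim => //; exact: cf.
    by apply => // n; exact: measurableT_comp.
  have mt n : measurable_fun setT (t (f_ n)) by have [] := Pf n.
  split.
    apply: (emeasurable_fun_cvg (fun n => t (f_ n)) _ mt).
    by move=> z _; exact: tcvg.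
  have cL : \int[mu]_(w in D) f_ n (Y w) @[n --> \oo] --> \int[mu]_(w in D) f (Y w).
    have := @cvg_monotone_convergence _ _ _ mu D mD (fun n w => f_ n (Y w)).
    rewrite (_ : (fun w => limn _) = fun w => f (Y w)); last first.
      by apply/funext => w; apply/cvg_lim => //; exact: cf.
    by apply => // n; apply: measurable_funTS; exact: measurableT_comp.
  have cR : \int[mu]_(w in D) t (f_ n) (Z w) @[n --> \oo] -->
      \int[mu]_(w in D) t f (Z w).
    have := @cvg_monotone_convergence _ _ _ mu D mD (fun n w => t (f_ n) (Z w)).
    rewrite (_ : (fun w => limn _) = fun w => t f (Z w)); last first.
      by apply/funext => w; apply/cvg_lim => //; exact: tcvg.
    apply => // [n|n w _|w _ m n mn].
    + by apply: measurable_funTS; exact: (measurableT_comp (mt n)).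
    + exact: t0.
    + by apply: ge0_le_integral_nomeas => // v _; exact: ndf.
  have E : (fun n => \int[mu]_(w in D) f_ n (Y w)) =
      fun n => \int[mu]_(w in D) t (f_ n) (Z w).
    by apply/funext => n; exact: (Pf n).2.
  by rewrite E in cL; exact: (cvg_unique _ cL cR).
Qed.

End integral_transition.

Section dynkin_kernel.
Context d1 d2 (U : measurableType d1) (O1 : measurableType d2) (R : realType).

Lemma dynkin_kernel (k : U -> probability O1 R) :
  dynkin [set G | measurable G /\ measurable_fun setT (fun z => k z G)].
Proof.
split.
- split; first exact: measurableT.
  rewrite (_ : (fun z => _) = cst 1); first exact: measurable_cst.
  by apply/funext => z; rewrite probability_setT.
- move=> G [mG kG]; split; first exact: measurableC.
  rewrite (_ : (fun z => _) = fun z => 1 - k z G); first exact: emeasurable_funB.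
  by apply/funext => z; rewrite probability_setC.
- move=> F tF HF; have mF n : measurable (F n) by case: (HF n).
  split; first exact: bigcupT_measurable.
  rewrite (_ : (fun z => _) = fun z => \sum_(n <oo) k z (F n)); last first.
    apply/funext => z; apply/esym/cvg_lim => //.
    by apply: measure_sigma_additive => //; exact: bigcupT_measurable.
  by apply: ge0_emeasurable_sum => // n _; case: (HF n).
Qed.

(** The shift is not known to be measurable, so measurability of the preimage of [G] is part of the
    class. Finiteness of [mu] allows subtraction in the complement step. *)
Lemma dynkin_transition (mu : {measure set U -> \bar R}) (D : set U)
    (th : U -> O1) (k : U -> probability O1 R) :
  mu setT < +oo -> measurable D ->
  dynkin [set G | [/\ measurable G, measurable_fun setT (fun z => k z G),
    measurable (th @^-1` G) & mu (D `&` th @^-1` G) = \int[mu]_(z in D) k z G]].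
Proof.
move=> muoo mD.
have [HT HC HU] := dynkin_kernel k.
have fin A : measurable A -> mu A \is a fin_num.
  move=> mA; rewrite ge0_fin_numE//; apply: le_lt_trans muoo.
  by apply: le_measure; rewrite ?inE.
have i1 : \int[mu]_(z in D) k z setT = mu D.
  under eq_integral do rewrite probability_setT.
  by rewrite integral_cst// mul1e.
split.
- have [mT kT] := HT; split => //; rewrite preimage_setT//.
  by rewrite setIT i1.
- move=> G [mG kG mth E].
  have [mC kC] := HC _ (conj mG kG).
  have mthC : measurable (th @^-1` ~` G).
    by rewrite -(preimage_setC th); exact: measurableC.
  split => //.
  have : mu (D `&` th @^-1` G) + mu (D `&` th @^-1` (~` G)) =
      \int[mu]_(z in D) k z G + \int[mu]_(z in D) k z (~` G).
    rewrite -ge0_integralD//; last 2 first.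
    + exact: measurable_funTS.
    + exact: measurable_funTS.
    rewrite -measureU//; last 3 first.
    + exact: measurableI.
    + exact: measurableI.
    + by rewrite setIACA -(preimage_setC th) setICr setI0.
    rewrite -setIUr -(preimage_setC th) setUv setIT.
    transitivity (\int[mu]_(z in D) k z setT); first by rewrite i1.
    by apply: eq_integral => z _; rewrite -measureU ?setUv ?setICr.
  have finI : \int[mu]_(z in D) k z G \is a fin_num.
    by rewrite -E fin//; exact: measurableI.
  rewrite E => /(congr1 (fun y => y - \int[mu]_(z in D) k z G)).
  rewrite (addeC _ (mu _)) (addeC _ (\int[mu]_(z in D) k z (~` G))).
  by rewrite !addeK.
- move=> F tF HF.
  have mF n : measurable (F n) by case: (HF n).
  have kF n : measurable_fun setT (fun z => k z (F n)) by case: (HF n).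
  have mthF n : measurable (th @^-1` F n) by case: (HF n).
  have EF n : mu (D `&` th @^-1` F n) = \int[mu]_(z in D) k z (F n) by case: (HF n).
  have [|mU kU] := HU F tF; first by move=> n; split.
  have mthU : measurable (th @^-1` \bigcup_n F n).
    by rewrite preimage_bigcup; exact: bigcupT_measurable.
  split => //.
  have kE z : k z (\bigcup_n F n) = \sum_(n <oo) k z (F n).
    apply/esym/cvg_lim => //.
    by apply: measure_sigma_additive.
  under eq_integral do rewrite kE.
  rewrite integral_nneseries//; last by move=> n; exact: measurable_funTS.
  rewrite preimage_bigcup setI_bigcupr.
  transitivity (\sum_(n <oo) mu (D `&` th @^-1` F n)).
    apply/esym/cvg_lim => //; apply: measure_sigma_additive => //.
    + by move=> n; exact: measurableI.
    + apply/trivIsetP => i j _ _ ij; have /trivIsetP/(_ i j I I ij) Fij := tF.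
      by rewrite setIACA -(preimage_setI th) Fij preimage_set0 setI0.
  by apply: eq_eseriesr => n _; rewrite EF.
Qed.

End dynkin_kernel.

Section markov_on_class.
Context {R : realType} {T : pmetricType R} (X : process T) (hX : is_hunt X).
Local Notation Om := (sample X).
Local Notation PX x := (@Pc _ _ X x).
Local Notation OmP x := (caratheodory_type (law X x)^*%mu).
Implicit Types (S : Om -> \bar R) (A : set Om).
(** The Markov property on path space is proved relative to a class of pairs (time, event) because
    it is used twice. For deterministic times and raw events measurability is immediate, and the
    outcome is that z ↦ [law X z G] is measurable for raw [G]. This makes the augmented filtration a
    σ-algebra of [Pc x]-measurable sets, which is what general stopping times need. *)
Variable adm : (Om -> \bar R) -> set Om -> Prop.
Hypothesis adm_stopping : forall S A, adm S A -> stopping_time S.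
Hypothesis adm_stopped : forall S A, adm S A -> stopped_filtration S A.
Hypothesis adm_meas : forall S A x, adm S A -> measurable (A : set (OmP x)).
Hypothesis adm_at_time : forall S A x, adm S A ->
  measurable_fun [set: OmP x] ((fun w => at_time (S w) w) : OmP x -> borel T^∂).
(** Closure under conditioning on a later value, so that the Markov property can be applied again at
    the later time. *)
Hypothesis adm_add : forall S A (s : R) (B : set (borel T^∂)), adm S A ->
  (0 <= s)%R -> measurable B ->
  adm (fun w => S w + s%:E) (A `&` [set w | B (at_time (S w + s%:E) w)]).
Hypothesis adm0 : adm (cst 0) setT.

Let adm_at_timeD S A (s : R) x : adm S A -> (0 <= s)%R ->
  measurable_fun [set: OmP x]
    ((fun w => at_time (S w + s%:E) w) : OmP x -> borel T^∂).
Proof.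
move=> aSA s0.
by have /adm_at_time := adm_add aSA s0 (@measurableT _ (borel T^∂)); exact.
Qed.

Lemma markov_fun S A x (s : R) (q : borel T^∂ -> \bar R) : adm S A ->
  (0 <= s)%R -> measurable_fun setT q -> (forall z, 0 <= q z) ->
  measurable_fun setT ((fun z => \int[law X z]_w q (X s w)) : borel T^∂ -> \bar R) /\
  \int[PX x]_(w in A) q (at_time (S w + s%:E) w) =
  \int[PX x]_(w in A) \int[law X (at_time (S w) w)]_v q (X s v).
Proof.
move=> aSA s0 mq q0.
have mA := adm_meas x aSA.
have mY := @adm_at_timeD S A s x aSA s0.
have mZ := @adm_at_time S A x aSA.
apply: (@integral_transition _ _ _ (OmP x) _ (borel T^∂) _ (PX x) A _ _ _
  (law X : borel T^∂ -> _) mA mY mZ (hunt_measurable hX s0)) => // B mB.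
  exact: hunt_law_measurable.
exact: (hunt_strong_markov hX x (adm_stopping aSA) s0 mB (adm_stopped aSA)).
Qed.

(** Times are stored as increments: the tail is again a cylinder, started at the later time, and the
    Markov property there applies to it as it stands. *)
Fixpoint cylinder (l : seq (R * set (borel T^∂))) (s : \bar R) (w : Om) : Prop :=
  if l is (t, B) :: l' then
    B (at_time (s + t%:E) w) /\ cylinder l' (s + t%:E) w
  else True.

Fixpoint cylinder_wf (l : seq (R * set (borel T^∂))) : Prop :=
  if l is (t, B) :: l' then [/\ (0 <= t)%R, measurable B & cylinder_wf l']
  else True.

Lemma cylinder_measurable l (s : R) : cylinder_wf l -> (0 <= s)%R ->
  measurable [set w | cylinder l s%:E w].
Proof.
elim: l s => [|[t B] l IH] s /=.
  by move=> _ _; rewrite [Y in measurable Y](_ : _ = setT)//; exact/seteqP.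
move=> [t0 mB wfl] s0.
apply: measurableI; last by apply: IH => //; exact: addr_ge0.
have := hunt_measurable hX (addr_ge0 s0 t0) measurableT mB.
by rewrite setTI.
Qed.

Lemma cylinder_markov l : cylinder_wf l ->
  measurable_fun setT
    ((fun z => law X z [set w | cylinder l 0 w]) : borel T^∂ -> \bar R) /\
  forall S A x, adm S A ->
    (PX x) (A `&` [set w | cylinder l (S w) w]) =
    \int[PX x]_(w in A) law X (at_time (S w) w) [set v | cylinder l 0 v].
Proof.
elim: l => [_|[t B] l IH [t0 mB wfl]].
  have c1 z : law X z [set w | cylinder [::] 0 w] = 1.
    by rewrite [Y in law X z Y](_ : _ = setT) ?probability_setT//; exact/seteqP.
  split.
    by rewrite (_ : (fun z => _) = cst 1)//; apply/funext => z; rewrite c1.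
  move=> S A x aSA.
  under eq_integral do rewrite c1.
  rewrite integral_cst ?mul1e; last exact: (adm_meas x aSA).
  by congr (PX x _); apply/seteqP; split => w // [].
have {IH}[mq qE] := IH wfl.
set q := (fun z => _) in mq.
pose q1 := (q \_ B) : borel T^∂ -> \bar R.
have mq1 : measurable_fun setT q1.
  by apply/(measurable_restrictT _ mB); exact: measurable_funTS.
have q10 z : 0 <= q1 z by apply: erestrict_ge0 => y _; exact: measure_ge0.
(* The induction hypothesis at time S + t, on the event intersected with the head condition, leaves
   a function of X at S + t alone. Taking S = 0 computes the probability of the whole cylinder from
   any starting point. *)
have step S A x : adm S A ->
    (PX x) (A `&` [set w | cylinder ((t, B) :: l) (S w) w]) =
    \int[PX x]_(w in A) q1 (at_time (S w + t%:E) w).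
  move=> aSA.
  have -> : A `&` [set w | cylinder ((t, B) :: l) (S w) w] =
      (A `&` [set w | B (at_time (S w + t%:E) w)]) `&`
      [set w | cylinder l (S w + t%:E) w].
    by apply/seteqP; split => w /= [] => [Aw []|[]].
  rewrite (qE _ _ x (adm_add aSA t0 mB)).
  rewrite integral_mkcondr; apply: eq_integral => w _.
  rewrite /q1 !patchE.
  have [wB|wB] := pselect (B (at_time (S w + t%:E) w)).
    by rewrite !mem_set.
  by rewrite !memNset.
have lawE z : law X z [set w | cylinder ((t, B) :: l) 0 w] =
    \int[law X z]_w q1 (X t w).
  rewrite -PcE; last by apply: (@cylinder_measurable _ 0%R).
  have := step _ _ z adm0; rewrite setTI => ->.
  rewrite -integral_Pc//; last exact: measurableT_comp (hunt_measurable hX t0).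
  by apply: eq_integral => w _; rewrite /= add0r.
split.
  rewrite (_ : (fun z => _) = fun z => \int[law X z]_w q1 (X t w)); last first.
    by apply/funext => z; rewrite lawE.
  by have [] := markov_fun None adm0 t0 mq1 q10.
move=> S A x aSA; rewrite step//.
have [_ ->] := markov_fun x aSA t0 mq1 q10.
by apply: eq_integral => w _; rewrite lawE.
Qed.

(** The two lists are merged in order of time; the list that waits keeps its length and has its
    first increment shortened, hence the induction on the total length. This makes the cylinders a
    π-system. *)
Lemma cylinder_merge l1 l2 : cylinder_wf l1 -> cylinder_wf l2 ->
  exists l, cylinder_wf l /\
    forall s w, cylinder l s w <-> cylinder l1 s w /\ cylinder l2 s w.
Proof.
have [n] := ubnP (size l1 + size l2)%N.
elim: n l1 l2 => // n IH [|[t1 B1] l1] [|[t2 B2] l2] /=.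
- by move=> _ _ _; exists [::]; split => // s w; split.
- move=> _ _ w2; exists ((t2, B2) :: l2); split => // s w /=; tauto.
- move=> _ w1 _; exists ((t1, B1) :: l1); split => // s w /=; tauto.
rewrite addSn addnS !ltnS => ln [t10 mB1 w1] [t20 mB2 w2].
have cat (t t' : R) B l s w : cylinder ((t' - t, B)%R :: l) (s + t%:E) w <->
    cylinder ((t', B) :: l) s w.
  by rewrite /= -addeA -EFinD subrKC.
have [t12|t21] := leP t1 t2.
- have [|||l [wl lE]] := IH l1 ((t2 - t1, B2) :: l2)%R => //=.
  + by rewrite addnS.
  + by split => //; rewrite subr_ge0.
  exists ((t1, B1) :: l); split => // s w.
  have := cat t1 t2 B2 l2 s w; have /= := lE (s + t1%:E) w; tauto.
- have [|||l [wl lE]] := IH ((t1 - t2, B1) :: l1)%R l2 => //=.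
  + by split => //; rewrite subr_ge0 ltW.
  exists ((t2, B2) :: l); split => // s w.
  have := cat t2 t1 B1 l1 s w; have /= := lE (s + t2%:E) w; tauto.
Qed.

Lemma cylinder_shift S th l (s : R) w : shift_by S th -> cylinder_wf l ->
  (0 <= s)%R -> cylinder l s%:E (th w) <-> cylinder l (S w + s%:E) w.
Proof.
move=> Sth; elim: l s => [//|[t B] l IH] s /= [t0 mB wl] s0.
rewrite Sth; last exact: addr_ge0.
have := IH (s + t)%R wl (addr_ge0 s0 t0).
by rewrite EFinD addeA => -[? ?]; split => -[? ?]; split; auto.
Qed.

Lemma cylinder_time_measurable S A x l : adm S A -> cylinder_wf l ->
  measurable ([set w | cylinder l (S w) w] : set (OmP x)).
Proof.
move=> aSA; elim: l S A aSA => [|[t B] l IH] S A aSA /=.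
  by move=> _; rewrite [Y in measurable Y](_ : _ = setT)//; exact/seteqP.
move=> [t0 mB wl]; apply: measurableI; last exact: IH (adm_add aSA t0 mB) wl.
by have := @adm_at_timeD S A t x aSA t0 measurableT _ mB; rewrite setTI.
Qed.

Let C := [set [set w | cylinder l 0 w] | l in [set l | cylinder_wf l]].

Let CI : setI_closed C.
Proof.
move=> _ _ [l1 w1 <-] [l2 w2 <-]; have [l [wl lE]] := cylinder_merge w1 w2.
by exists l => //; apply/seteqP; split => w /lE.
Qed.

Let raw_cylinders : raw_filtration (X:=X) +oo `<=` <<s C >>.
Proof.
apply: smallest_sub; first exact: smallest_sigma_algebra.
move=> _ [s [B [s0 _ mB ->]]]; apply: sub_sigma_algebra.
exists [:: (s, B)] => //.
by apply/seteqP; split => w /=; rewrite add0r; tauto.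
Qed.

Lemma law_raw_measurable_class (G : set Om) : raw_filtration (X:=X) +oo G ->
  measurable_fun setT ((fun z => law X z G) : borel T^∂ -> \bar R).
Proof.
move=> /raw_cylinders CG.
have H := (dynkin_lambda_system _).1 (dynkin_kernel (law X : borel T^∂ -> _)).
have CH : C `<=` [set G | measurable G /\
    measurable_fun setT ((fun z => law X z G) : borel T^∂ -> \bar R)].
  move=> _ [l wl <-]; split; first exact: (@cylinder_measurable _ 0%R).
  by have [] := cylinder_markov wl.
by have [] := lambda_system_subset CI H CH (fun _ _ => @subsetT _ _) CG.
Qed.

Lemma markov_raw S A x th (G : set Om) : adm S A -> shift_by S th ->
  raw_filtration (X:=X) +oo G ->
  measurable (th @^-1` G : set (OmP x)) /\
  (PX x) (A `&` th @^-1` G) = \int[PX x]_(w in A) law X (at_time (S w) w) G.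
Proof.
move=> aSA Sth /raw_cylinders CG.
have PXoo : PX x setT < +oo by rewrite PcT ltry.
pose k : OmP x -> probability Om R := fun w => law X (at_time (S w) w).
have H := (dynkin_lambda_system _).1
  (dynkin_transition (th : OmP x -> Om) k PXoo (adm_meas x aSA)).
set K := (K in lambda_system setT K) in H.
have CK : C `<=` K.
  move=> _ [l wl <-].
  have [ml lE] := cylinder_markov wl.
  have thE : th @^-1` [set w | cylinder l 0 w] = [set w | cylinder l (S w) w].
    apply/seteqP; split => w /=;
    have := cylinder_shift (s := 0%R) w Sth wl (lexx _); rewrite adde0; tauto.
  split.
  - exact: (@cylinder_measurable _ 0%R).
  - apply: (@measurableT_comp _ _ _ (OmP x) (borel T^∂) (\bar R)
      (fun z => law X z [set w | cylinder l 0 w]) setT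
      (fun w => at_time (S w) w) ml).
    exact: (@adm_at_time S A x aSA).
  - by rewrite thE; exact: cylinder_time_measurable aSA wl.
  - by rewrite thE; exact: lE.
by have [_ _ mG GE] := lambda_system_subset CI H CK (fun _ _ => @subsetT _ _) CG.
Qed.

End markov_on_class.

Lemma sigma_algebraT (T : pointedType) (G : set (set T)) : <<s G >> setT.
Proof. exact: (@measurableT _ (g_sigma_algebraType G)). Qed.

Lemma sigma_algebraI (T : pointedType) (G : set (set T)) A B :
  <<s G >> A -> <<s G >> B -> <<s G >> (A `&` B).
Proof. exact: (@measurableI _ (g_sigma_algebraType G)). Qed.

(** * Augmented filtrations and stopping times *)

Section filtrations.
Context {R : realType} {T : pmetricType R} (X : process T) (hX : is_hunt X).
Local Notation Om := (sample X).
Local Notation PX x := (@Pc _ _ X x).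
Local Notation OmP x := (caratheodory_type (law X x)^*%mu).
Local Notation raw := (raw_filtration (X:=X)).
Local Notation filt := (filtration (X:=X)).
Implicit Types (S : Om -> \bar R) (A : set Om).

Lemma raw_filtration_le (s t : \bar R) : s <= t -> raw s `<=` raw t.
Proof.
move=> st; apply: sub_sigma_algebra2 => _ [u [B [u0 us mB ->]]].
by exists u, B; split => //; exact: le_trans st.
Qed.

Lemma raw_filtration_measurable (t : \bar R) : raw t `<=` measurable.
Proof.
apply: smallest_sub => [|_ [u [B [u0 _ mB ->]]]].
  split; first exact: measurable0.
    by move=> A mA; apply: measurableD.
  by move=> F mF; exact: bigcupT_measurable.
by have := hunt_measurable hX u0 measurableT mB; rewrite setTI.
Qed.

Lemma raw_filtration_gen (s : R) (t : \bar R) (B : set (borel T^∂)) :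
  (0 <= s)%R -> s%:E <= t -> measurable B -> raw t (X s @^-1` B).
Proof. by move=> s0 st mB; apply: sub_sigma_algebra; exists s, B. Qed.

Lemma raw_filtration_augmented (t : \bar R) : raw t `<=` filt t.
Proof.
move=> A rA mu _; exists A, set0; split => //.
- exact: sigma_algebra0.
- by apply: integral0_eq => x _; rewrite measure0.
- by rewrite !setDv setU0.
Qed.

Lemma mu_filtration_le mu (s t : \bar R) : s <= t ->
  mu_filtration (X:=X) mu s `<=` mu_filtration (X:=X) mu t.
Proof.
by move=> st A [B [N [/(raw_filtration_le st) rB rN N0 AB]]]; exists B, N.
Qed.

Lemma filtration_le (s t : \bar R) : s <= t -> filt s `<=` filt t.
Proof. by move=> st A fA mu I; exact: mu_filtration_le (fA mu I). Qed.

Let adm1 S A := exists s : R, [/\ (0 <= s)%R, S = cst s%:E & raw s%:E A].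

Let adm1_stopping S A : adm1 S A -> stopping_time S.
Proof.
move=> [s [s0 -> _]]; split; first by move=> w /=; rewrite lee_fin.
move=> u u0; apply: raw_filtration_augmented.
have [su|su] := leP s%:E u%:E.
  rewrite (_ : [set w | _] = setT); first exact: sigma_algebraT.
  by apply/seteqP; split.
rewrite (_ : [set w | _] = set0); first exact: sigma_algebra0.
by apply/seteqP; split => w //=; rewrite leNgt su.
Qed.

Let adm1_stopped S A : adm1 S A -> stopped_filtration S A.
Proof.
move=> [s [s0 -> rA]]; split.
  by apply: raw_filtration_augmented; apply: raw_filtration_le rA; exact: leey.
move=> u u0; apply: raw_filtration_augmented.
have [su|su] := leP s%:E u%:E.
  rewrite (_ : A `&` _ = A); first exact: raw_filtration_le rA.
  by apply/seteqP; split => [w []|w Aw].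
rewrite (_ : A `&` _ = set0); first exact: sigma_algebra0.
by apply/seteqP; split => w // -[].
Qed.

Let adm1_meas S A x : adm1 S A -> measurable (A : set (OmP x)).
Proof.
by move=> [s [_ _ /raw_filtration_measurable mA]]; exact: measurable_Pc.
Qed.

Let adm1_at_time S A x : adm1 S A ->
  measurable_fun [set: OmP x] ((fun w => at_time (S w) w) : OmP x -> borel T^∂).
Proof.
by move=> [s [s0 -> _]]; apply: measurable_fun_Pc; exact: (hunt_measurable hX s0).
Qed.

Let adm1_add S A (s : R) (B : set (borel T^∂)) : adm1 S A ->
  (0 <= s)%R -> measurable B ->
  adm1 (fun w => S w + s%:E) (A `&` [set w | B (at_time (S w + s%:E) w)]).
Proof.
move=> [t [t0 -> rA]] s0 mB; exists (t + s)%R; split => //.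
  by rewrite addr_ge0.
apply: sigma_algebraI.
  by apply: raw_filtration_le rA; rewrite lee_fin lerDl.
by apply: raw_filtration_gen => //; exact: addr_ge0.
Qed.

Let adm1_0 : adm1 (cst 0) setT.
Proof. by exists 0%R; split => //; exact: sigma_algebraT. Qed.

Lemma law_raw_measurable (G : set Om) : raw +oo G ->
  measurable_fun setT ((fun z => law X z G) : borel T^∂ -> \bar R).
Proof.
exact: (law_raw_measurable_class hX adm1_stopping adm1_stopped adm1_meas
  adm1_at_time adm1_add adm1_0).
Qed.

(** For countable unions, the probabilities of the exceptional sets are summed under the integral
    over the starting point, which requires [law_raw_measurable]. *)
Lemma mu_filtration_sigma_algebra mu (t : \bar R) :
  sigma_algebra setT (mu_filtration (X:=X) mu t).
Proof.
split.
- exists set0, set0; split; try exact: sigma_algebra0.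
    by apply: integral0_eq => x _; rewrite measure0.
  by rewrite !setDv setU0.
- move=> A [B [N [rB rN N0 AB]]]; exists (~` B), N; split => //.
    by rewrite -setTD; exact: sigma_algebraCD.
  move=> w [[[_ nA] /contrapT Bw]|[nB nA]]; apply: AB; [right|left]; split => //.
  by apply: contrapT => nAw; apply: nA.
- move=> A_ HA.
  have HA' n : exists B, exists N, [/\ raw t B, raw +oo N,
      \int[mu]_x law X x N = 0 & (A_ n `\` B) `|` (B `\` A_ n) `<=` N].
    exact: HA.
  have [B_ HB] := choice HA'.
  have [N_ HN] := choice HB.
  exists (\bigcup_n B_ n), (\bigcup_n N_ n); split.
  + by apply: sigma_algebra_bigcup => n; case: (HN n).
  + by apply: sigma_algebra_bigcup => n; case: (HN n).
  + apply/eqP; rewrite eq_le integral_ge0 ?andbT//.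
    apply: (@le_trans _ _ (\int[mu]_x \sum_(n <oo) law X x (N_ n))).
      apply: ge0_le_integral_nomeas => // x _.
      apply: measure_sigma_subadditive => //.
      * by move=> n; apply: (@raw_filtration_measurable +oo); case: (HN n).
      * apply: (@raw_filtration_measurable +oo); apply: sigma_algebra_bigcup => n.
        by case: (HN n).
    rewrite integral_nneseries//.
      by rewrite eseries0// => n _ _; case: (HN n).
    by move=> n; apply: law_raw_measurable; case: (HN n).
  + move=> w [[[n _ An] nB]|[[n _ Bn] nA]]; exists n => //;
    have [_ _ _ sub] := HN n; apply: sub; [left|right]; split => // ?.
      by apply: nB; exists n.
    by apply: nA; exists n.
Qed.

Lemma filtration_sigma_algebra (t : \bar R) : sigma_algebra setT (filt t).
Proof.
split.
- by move=> mu _; case: (mu_filtration_sigma_algebra mu t).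
- move=> A fA mu I; have [_ + _] := mu_filtration_sigma_algebra mu t.
  by apply; exact: fA.
- move=> F fF mu I; have [_ _] := mu_filtration_sigma_algebra mu t.
  by apply => n; exact: fF.
Qed.

Lemma filtrationE (t : \bar R) : <<s filt t >> = filt t.
Proof. exact: sigma_algebra_id (filtration_sigma_algebra t). Qed.

(** For the Dirac initial law at [x] the exceptional set is null under [law X x], and the
    Carathéodory σ-algebra is complete. *)
Lemma filtration_measurable x (t : \bar R) A : filt t A ->
  measurable (A : set (OmP x)).
Proof.
move=> /(_ (\d_(x : borel T^∂) : probability _ _) I) [B [N [rB rN N0 AB]]].
have mB : measurable (B : set (OmP x)).
  by apply: measurable_Pc; exact: raw_filtration_measurable rB.
have PN : (PX x) N = 0.
  rewrite PcE; last exact: raw_filtration_measurable rN.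
  rewrite -[RHS]N0 integral_dirac//; last exact: law_raw_measurable.
  by rewrite diracT mul1e.
have neg D : D `<=` N -> measurable (D : set (OmP x)).
  move=> DN; apply: measure_is_complete_caratheodory.
  exists N; split => //.
  by apply: measurable_Pc; exact: raw_filtration_measurable rN.
have -> : A = (B `|` (A `\` B)) `\` (B `\` A).
  apply/seteqP; split => w; rewrite /setD /setU /=;
  by have [?|?] := pselect (A w); have [?|?] := pselect (B w); tauto.
by apply: measurableD; [apply: measurableU => //|]; apply: neg => w Dw;
  apply: AB; [left|right].
Qed.

Lemma filtrationI (t : \bar R) A B : filt t A -> filt t B -> filt t (A `&` B).
Proof. by rewrite -filtrationE; exact: sigma_algebraI. Qed.

Lemma filtrationC (t : \bar R) A : filt t A -> filt t (~` A).
Proof. by rewrite -filtrationE -setTD; exact: sigma_algebraCD. Qed.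

Lemma filtration_bigcup (t : \bar R) (F : nat -> set Om) :
  (forall n, filt t (F n)) -> filt t (\bigcup_n F n).
Proof. by rewrite -filtrationE; exact: sigma_algebra_bigcup. Qed.

Lemma filtrationU (t : \bar R) A B : filt t A -> filt t B -> filt t (A `|` B).
Proof.
move=> fA fB; rewrite -[A `|` B]setCK setCU.
by apply/filtrationC/filtrationI; exact: filtrationC.
Qed.

Lemma filtration0 (t : \bar R) : filt t set0.
Proof. by rewrite -filtrationE; exact: sigma_algebra0. Qed.

Lemma filtrationT (t : \bar R) : filt t setT.
Proof. by rewrite -filtrationE; exact: sigma_algebraT. Qed.

Lemma filtration_gen (s : R) (t : \bar R) (B : set (borel T^∂)) :
  (0 <= s)%R -> s%:E <= t -> measurable B -> filt t (X s @^-1` B).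
Proof.
by move=> s0 st mB; apply: raw_filtration_augmented; exact: raw_filtration_gen.
Qed.

Section stopping.
Variable S : Om -> \bar R.
Hypothesis stS : stopping_time S.

Lemma stopping_time_lt (q : R) : (0 <= q)%R -> filt q%:E [set w | S w < q%:E].
Proof.
move=> q0.
pose F n : set Om :=
  if (0 <= q - n.+1%:R^-1)%R then [set w | S w <= (q - n.+1%:R^-1)%:E] else set0.
have -> : [set w | S w < q%:E] = \bigcup_n F n.
  apply/seteqP; split => [w /=|w [n _]]; last first.
    rewrite /F; case: ifPn => // _ /= Sq; apply: le_lt_trans Sq _.
    by rewrite lte_fin gtrBl invr_gt0.
  have := stS.1 w; case ES : (S w) => [s| |] //; rewrite lee_fin lte_fin => s0 sq.
  have /ltr_add_invr[n nq] := sq.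
  exists n => //; have sqn : (s <= q - n.+1%:R^-1)%R by rewrite lerBrDr ltW.
  by rewrite /F (le_trans s0 sqn) /= ES lee_fin.
apply: filtration_bigcup => n; rewrite /F; case: ifPn => [n0|_].
  apply: (@filtration_le (q - n.+1%:R^-1)%:E).
    by rewrite lee_fin gerBl invr_ge0.
  exact: stS.2.
exact: filtration0.
Qed.

Lemma stopping_at_time (u : \bar R) (B : set (borel T^∂)) : measurable B ->
  filt u [set w | S w < u] /\
  filt u ([set w | S w < u] `&` [set w | B (at_time (S w) w)]).
Proof.
move=> mB.
have GS q : (0 <= q)%R -> q%:E < u ->
    measurable ([set w | S w < q%:E] : set (g_sigma_algebraType (filt u))).
  move=> q0 qu; apply: sub_sigma_algebra.
  by apply: (filtration_le (ltW qu)); exact: stopping_time_lt.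
have GX q (O : set T) : (0 <= q)%R -> q%:E < u -> open O ->
    measurable (X q @^-1` (Some @` O) : set (g_sigma_algebraType (filt u))).
  move=> q0 qu oO; apply: sub_sigma_algebra; apply: filtration_gen => //.
    exact: ltW.
  exact: measurable_some_open.
have m1 := measurable_lt_time stS.1 GS.
split; first by rewrite -filtrationE.
rewrite -filtrationE.
exact: (measurable_at_time hX stS.1 GS GX m1 mB).
Qed.

Lemma stopping_at_time_filtration (B : set (borel T^∂)) : measurable B ->
  filt +oo [set w | B (at_time (S w) w)].
Proof.
move=> mB.
have [foo fB] := stopping_at_time +oo mB.
have -> : [set w | B (at_time (S w) w)] =
    ([set w | S w < +oo] `&` [set w | B (at_time (S w) w)]) `|`
    ((~` [set w | S w < +oo]) `&` (if pselect (B ∂) then setT else set0)).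
  apply/seteqP; split => [w /= Bw|w /= [[//]|[]]].
    have := stS.1 w; case ES : (S w) Bw => [s| |] //= Bw _.
      by left; split => //; rewrite ltry.
    by right; split => //; case: pselect.
  have := stS.1 w; case ES : (S w) => [s| |] //= _; first by rewrite ltry.
  by move=> _; case: pselect.
apply: filtrationU => //; apply: filtrationI; first exact: filtrationC.
by case: pselect => ?; [exact: filtrationT|exact: filtration0].
Qed.

(** The rational description of X_S looks slightly past S, so it yields only events with S < u.
    Right continuity of the filtration lets u decrease to s. *)
Lemma stopping_at_time_le (s : R) (B : set (borel T^∂)) :
  (0 <= s)%R -> measurable B ->
  filt s%:E ([set w | B (at_time (S w) w)] `&` [set w | S w <= s%:E]).
Proof.
move=> s0 mB; apply: (hunt_filtration_right_continuous hX) => // u su.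
have [_ fB] := stopping_at_time u%:E mB.
have -> : [set w | B (at_time (S w) w)] `&` [set w | S w <= s%:E] =
  ([set w | S w < u%:E] `&` [set w | B (at_time (S w) w)]) `&` [set w | S w <= s%:E].
  apply/seteqP; split => w /= [] => [Bw Sw|[]] //; split => //; split => //.
  by apply: le_lt_trans Sw _; rewrite lte_fin.
apply: filtrationI => //; apply: (@filtration_le s%:E).
  by rewrite lee_fin ltW.
exact: stS.2.
Qed.

Lemma addS_le (s u : R) : [set w | S w + s%:E <= u%:E] = [set w | S w <= (u - s)%:E].
Proof.
by apply/seteqP; split => w /=; rewrite EFinB leeBrDr.
Qed.

Lemma stopping_timeD (s : R) : (0 <= s)%R -> stopping_time (fun w => S w + s%:E).
Proof.
move=> s0; split => [w|u u0].
  by apply: adde_ge0; [exact: stS.1|rewrite lee_fin].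
rewrite addS_le.
have [su|us] := leP s u.
  apply: (@filtration_le (u - s)%:E); first by rewrite lee_fin gerBl.
  by apply: stS.2; rewrite subr_ge0.
rewrite (_ : [set w | _] = set0); first exact: filtration0.
apply/seteqP; split => w //= /(le_trans (stS.1 w)).
by rewrite lee_fin subr_ge0 leNgt us.
Qed.

End stopping.

Let adm2 S A := stopping_time S /\ stopped_filtration S A.

Let adm2_stopping S A : adm2 S A -> stopping_time S. Proof. by case. Qed.
Let adm2_stopped S A : adm2 S A -> stopped_filtration S A. Proof. by case. Qed.

Let adm2_meas S A x : adm2 S A -> measurable (A : set (OmP x)).
Proof. by move=> [_ [/filtration_measurable]]. Qed.

Lemma measurable_stopping_at_time S x : stopping_time S ->
  measurable_fun [set: OmP x] ((fun w => at_time (S w) w) : OmP x -> borel T^∂).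
Proof.
move=> stS _ B mB; rewrite setTI; apply: (@filtration_measurable x +oo).
exact: stopping_at_time_filtration.
Qed.

Let adm2_at_time S A x : adm2 S A ->
  measurable_fun [set: OmP x] ((fun w => at_time (S w) w) : OmP x -> borel T^∂).
Proof. by move=> [stS _]; exact: measurable_stopping_at_time. Qed.

Let adm2_add S A (s : R) (B : set (borel T^∂)) : adm2 S A ->
  (0 <= s)%R -> measurable B ->
  adm2 (fun w => S w + s%:E) (A `&` [set w | B (at_time (S w + s%:E) w)]).
Proof.
move=> [stS [fA fAS]] s0 mB.
have stSs := stopping_timeD stS s0.
split => //; split => [|u u0].
  by apply: filtrationI => //; exact: (stopping_at_time_filtration stSs).
rewrite -setIA; have := stopping_at_time_le stSs u0 mB => fB.
have -> : A `&` ([set w | B (at_time (S w + s%:E) w)] `&` [set w | S w + s%:E <= u%:E])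
  = (A `&` [set w | S w + s%:E <= u%:E]) `&`
    ([set w | B (at_time (S w + s%:E) w)] `&` [set w | S w + s%:E <= u%:E]).
  by apply/seteqP; split => w /=; tauto.
apply: filtrationI => //; rewrite addS_le.
have [su|us] := leP s u.
  apply: (@filtration_le (u - s)%:E); first by rewrite lee_fin gerBl.
  by apply: fAS; rewrite subr_ge0.
rewrite (_ : _ `&` _ = set0); first exact: filtration0.
apply/seteqP; split => w //= [_] /(le_trans (stS.1 w)).
by rewrite lee_fin subr_ge0 leNgt us.
Qed.

Let adm2_T S : stopping_time S -> adm2 S setT.
Proof.
move=> stS; split => //; split; first exact: filtrationT.
by move=> u u0; rewrite setTI; exact: stS.2.
Qed.

Lemma strong_markov S x th (G : set Om) : stopping_time S -> shift_by S th ->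
  raw +oo G ->
  measurable (th @^-1` G : set (OmP x)) /\
  (PX x) (th @^-1` G) = \int[PX x]_w law X (at_time (S w) w) G.
Proof.
move=> stS Sth rG.
have adm20 : adm2 (cst 0) setT.
  apply: adm2_T; split => // u u0.
  rewrite (_ : [set w | _] = setT); first exact: filtrationT.
  by apply/seteqP; split => // w _ /=; rewrite lee_fin.
have := markov_raw hX adm2_stopping adm2_stopped adm2_meas adm2_at_time adm2_add
  adm20 x (adm2_T stS) Sth rG.
by rewrite setTI.
Qed.

End filtrations.

(** * Exit times and exit distributions *)

Section inner_sets.
Context {R : realType} {T : pmetricType R}.
Implicit Types V : set T.

(* The margin makes [closure (inner V n)] compact: it is covered by the closed
   balls of radius [2 / n.+1] around a finite [1 / n.+1]-net of [inner V n]. *)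
Definition inner V n : set T :=
  [set y | exists2 t : R, (2 / n.+1%:R < t)%R &
    compact [set z | (mdist y z <= t)%R] /\ [set z | (mdist y z <= t)%R] `<=` V].

Definition exhausted V : Prop :=
  [/\ open V, (forall n, open (inner V n)), V `<=` \bigcup_n inner V n,
    (forall n, compact (closure (inner V n))) &
    (forall n, closure (inner V n) `<=` V)].

Lemma inner_le V m n : (m <= n)%N -> inner V m `<=` inner V n.
Proof.
move=> mn y [t mt ct]; exists t => //; apply: le_lt_trans mt.
by rewrite ler_pM2l// lef_pV2 ?posrE// ler_nat ltnS.
Qed.

End inner_sets.

Section exhausted_exit.
Context {R : realType} {T : pmetricType R} (X : process T) (hX : is_hunt X).
Local Notation Om := (sample X).
Local Notation PX x := (@Pc _ _ X x).
Local Notation OmP x := (caratheodory_type (law X x)^*%mu).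
Local Notation raw := (raw_filtration (X:=X)).
Local Notation filt := (filtration (X:=X)).
Variable V : set T.

Definition inner_exit n : Om -> \bar R := exit_time (closure (inner V n)).

(* The exit time of [V] up to null sets, but measurable for the unaugmented
   filtration. *)
Definition raw_exit (w : Om) : \bar R := ereal_sup (range (inner_exit ^~ w)).

Lemma exit_time_ge0 (D : set T) (w : Om) : 0 <= exit_time D w.
Proof. by apply: le_ereal_inf_tmp => _ [s [s0 _] <-]; rewrite lee_fin. Qed.

Lemma le_exit_time (D1 D2 : set T) (w : Om) :
  D1 `<=` D2 -> exit_time D1 w <= exit_time D2 w.
Proof.
move=> D12; apply: le_ereal_inf => _ [s [s0 Xs] <-]; exists s => //; split => //.
by move=> [y Dy Xy]; apply: Xs; exists y => //; exact: D12.
Qed.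

Lemma before_exit (D : set T) (w : Om) (s : R) :
  (0 <= s)%R -> s%:E < exit_time D w -> (Some @` D : set T^∂) (X s w).
Proof.
move=> s0 sD; apply: contrapT => nD.
by move: sD; rewrite ltNge => /negP; apply; apply: ereal_inf_lbound; exists s.
Qed.

Lemma exit_time_ltP (D : set T) (w : Om) (u : \bar R) :
  exit_time D w < u ->
  exists s, [/\ (0 <= s)%R, s%:E < u & ~ (Some @` D : set T^∂) (X s w)].
Proof.
move=> /ereal_inf_lt[_ [s [s0 Xs] <-] su].
by exists s.
Qed.

Lemma nondecreasing_inner_exit w : {homo inner_exit ^~ w : i j / (i <= j)%N >-> i <= j}.
Proof.
by move=> i j ij; apply: le_exit_time; apply: closure_subset; exact: inner_le.
Qed.

Lemma inner_exit_cvg w : inner_exit n w @[n --> \oo] --> raw_exit w.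
Proof. exact/ereal_nondecreasing_cvgn/nondecreasing_inner_exit. Qed.

Lemma inner_exit_le n w : inner_exit n w <= raw_exit w.
Proof. by apply: ereal_sup_ubound; exists n. Qed.

Lemma raw_exit_ge0 w : 0 <= raw_exit w.
Proof. exact: le_trans (exit_time_ge0 _ _) (inner_exit_le 0 w). Qed.

Hypothesis exV : exhausted V.

Let K n := closure (inner V n).

Let oV : open V. Proof. by case: exV. Qed.
Let oI n : open (inner V n). Proof. by case: exV. Qed.
Let cK n : compact (K n). Proof. by case: exV => _ _ _ + _; apply. Qed.
Let KV n : K n `<=` V. Proof. by case: exV => _ _ _ _; apply. Qed.
Let VI : V `<=` \bigcup_n inner V n. Proof. by case: exV. Qed.
Let closedK n : closed (K n). Proof. exact: closed_closure. Qed.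

Lemma raw_exit_le w : raw_exit w <= exit_time V w.
Proof. by apply: ge_ereal_sup => _ [n _ <-]; apply: le_exit_time; exact: KV. Qed.

(** At ∂ this uses compactness: complements of closed compact sets are neighbourhoods of ∂. *)
Let outK n (s : R) w : ~ (Some @` K n : set T^∂) (X s w) ->
  nbhs (X s w) (~` (Some @` K n) : set T^∂).
Proof.
case: (X s w) => [y|] nK.
  have /(one_point_compactification_some_nbhs) : nbhs y (~` K n).
    apply: open_nbhs_nbhs; split; first exact: closed_openC.
    by move=> Ky; apply: nK; exists y.
  apply: filterS => _ [z nKz <-] [z' Kz' [zz]]; by apply: nKz; rewrite -zz.
exists (K n); first by split.
by move=> _ [[z nKz <-] [z' Kz' [zz]]|-> [z' _]]; [apply: nKz; rewrite -zz|].
Qed.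

(** Leaving the compact set [K n] means entering an open subset of the compactification, which by
    right continuity is seen at rational times; hence the unaugmented filtration suffices. *)
Lemma inner_exit_raw n (u : R) : raw u%:E [set w | inner_exit n w < u%:E].
Proof.
pose F (q : rat) : set Om :=
  if (0 <= ratr q :> R)%R && (ratr q < u)%R
  then ~` (X (ratr q) @^-1` (Some @` K n)) else set0.
have -> : [set w | inner_exit n w < u%:E] = \bigcup_q F q.
  apply/seteqP; split => [w /= /exit_time_ltP[s [s0 su nK]]|w [q _]].
    have [e e0 eK] := right_near hX s0 (outK nK).
    have : (s < Num.min (s + e) u)%R by rewrite lt_min ltrDl e0 -lte_fin su.
    move=> /rat_in_itvoo[q]; rewrite in_itv /= lt_min => /and3P[sq qe qu].
    exists q => //; rewrite /F qu (le_trans s0 (ltW sq)) /=.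
    by apply: eK; rewrite (ltW sq).
  rewrite /F; case: ifPn => // /andP[q0 qu] nK /=.
  apply: (@le_lt_trans _ _ (ratr q)%:E); last by rewrite lte_fin.
  by apply: ereal_inf_lbound; exists (ratr q).
apply: (@bigcupT_measurable_rat _ (g_sigma_algebraType _)) => q; rewrite /F.
case: ifPn => [/andP[q0 qu]|_]; last exact: sigma_algebra0.
apply: (@measurableC _ (g_sigma_algebraType _)).
apply: raw_filtration_gen => //; first by rewrite lee_fin ltW.
apply: measurable_some; rewrite -[K n]setCK; apply: measurableC.
by apply: sub_sigma_algebra; exact: closed_openC.
Qed.

Let OmR := g_sigma_algebraType (raw +oo).

Lemma inner_exit_measurable n :
  measurable_fun setT (inner_exit n : OmR -> \bar R).
Proof.
apply: (measurability _ (ErealGenInftyO.measurableE R)).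
move=> _ [_ [u ->] <-]; rewrite setTI; apply: sub_sigma_algebra.
have -> : inner_exit n @^-1` `]-oo, u%:E[%classic = [set w | inner_exit n w < u%:E].
  by apply/seteqP; split => w /=; rewrite in_itv.
by apply: (@raw_filtration_le _ _ _ u%:E); [exact: leey|exact: inner_exit_raw].
Qed.

Lemma raw_exit_measurable : measurable_fun setT (raw_exit : OmR -> \bar R).
Proof.
apply: (emeasurable_fun_cvg (fun n => inner_exit n : OmR -> \bar R)).
  by move=> n; exact: inner_exit_measurable.
by move=> w _; exact: inner_exit_cvg.
Qed.

Lemma raw_measurable_fun (f : Om -> \bar R) :
  measurable_fun setT (f : OmR -> \bar R) -> measurable_fun setT f.
Proof.
move=> mf _ B mB; have := mf measurableT B mB; rewrite !setTI => rB.
apply: (@raw_filtration_measurable _ _ _ hX +oo).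
move: rB; rewrite /measurable /= sigma_algebra_id//; exact: smallest_sigma_algebra.
Qed.

Lemma inner_exit_stopping n : stopping_time (inner_exit n).
Proof.
split => [w|s s0]; first exact: exit_time_ge0.
apply: (hunt_filtration_right_continuous hX) => // u su.
(* These times decrease to [s] without exceeding [u], so each event is already in the filtration at
   time [u]. *)
pose F k := [set w | inner_exit n w < (s + (u - s) / k.+1%:R)%:E].
have -> : [set w | inner_exit n w <= s%:E] = ~` \bigcup_k ~` F k.
  rewrite setC_bigcup; under eq_bigcapr do rewrite setCK.
  apply/seteqP; split => [w /= Tw k _|w /= Fw].
    rewrite /F /=; apply: le_lt_trans Tw _; rewrite lte_fin ltrDl.
    by rewrite divr_gt0// subr_gt0.
  apply/lee_addgt0Pr => e e0.
  have : (0 < e / (u - s))%R by rewrite divr_gt0// subr_gt0.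
  move=> /ltr_add_invr[k]; rewrite add0r => ke.
  apply: (le_trans (ltW (Fw k I))); rewrite -EFinD lee_fin lerD2l.
  have us0 : (0 < u - s)%R by rewrite subr_gt0.
  by move: ke; rewrite ltr_pdivlMr// mulrC => /ltW.
apply: filtrationC => //; apply: filtration_bigcup => // k; apply: filtrationC => //.
apply: raw_filtration_augmented.
apply: (@raw_filtration_le _ _ _ (s + (u - s) / k.+1%:R)%:E); last exact: inner_exit_raw.
rewrite lee_fin -lerBrDl ler_pdivrMr// ler_peMr ?subr_ge0 ?(ltW su)//.
by rewrite ler1n.
Qed.

Lemma raw_exit_stopping : stopping_time raw_exit.
Proof.
split => [w|s s0]; first exact: raw_exit_ge0.
have -> : [set w | raw_exit w <= s%:E] =
    ~` \bigcup_n ~` [set w | inner_exit n w <= s%:E].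
  rewrite setC_bigcup; under eq_bigcapr do rewrite setCK.
  apply/seteqP; split => [w /= Tw k _ /=|w /= Fw].
    exact: le_trans (inner_exit_le _ _) Tw.
  by apply: ge_ereal_sup => _ [n _ <-]; exact: Fw.
apply: filtrationC => //; apply: filtration_bigcup => // k; apply: filtrationC => //.
exact: (inner_exit_stopping k).2.
Qed.

Lemma raw_exit_at_time (B : set (borel T^∂)) : measurable B ->
  raw +oo ([set w | raw_exit w < +oo] `&` [set w | B (at_time (raw_exit w) w)]).
Proof.
move=> mB.
have GS q : (0 <= q)%R -> q%:E < +oo -> measurable ([set w | raw_exit w < q%:E] : set OmR).
  move=> _ _; have := emeasurable_fun_infty_o measurableT raw_exit_measurable q%:E.
  by rewrite setTI.
have GX q (O : set T) : (0 <= q)%R -> q%:E < +oo -> open O ->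
    measurable (X q @^-1` (Some @` O) : set OmR).
  move=> q0 qu oO; apply: sub_sigma_algebra; apply: raw_filtration_gen => //.
  exact: measurable_some_open.
have m1 := measurable_lt_time raw_exit_ge0 GS.
have := measurable_at_time hX raw_exit_ge0 GS GX m1 mB.
by rewrite /measurable /= sigma_algebra_id//; exact: smallest_sigma_algebra.
Qed.

(** Paths that never exit, or that exit by dying, are excluded automatically, since their value is
    ∂. *)
Definition exit_in (A : set T) : set Om :=
  [set w | (Some @` A : set T^∂) (at_time (raw_exit w) w)].

Lemma exit_in_raw (A : set (borel T)) : measurable A -> raw +oo (exit_in A).
Proof.
move=> mA; have := raw_exit_at_time (measurable_some mA).
rewrite [X in raw _ X -> _](_ : _ = exit_in A)//.
apply/seteqP; split => [w []//|w /= Aw]; split => //=.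
move: Aw; rewrite /exit_in /=; have := raw_exit_ge0 w.
by case: (raw_exit w) => [s| |] // _; [rewrite ltry|case].
Qed.

Lemma exit_in_measurable (A : set (borel T)) : measurable A -> measurable (exit_in A).
Proof. by move=> /exit_in_raw; exact: raw_filtration_measurable. Qed.

Lemma inner_exit_notin n (s : R) w : inner_exit n w = s%:E ->
  ~ (Some @` inner V n : set T^∂) (X s w).
Proof.
move=> Tw [y Iy Xy].
have s0 : (0 <= s)%R by rewrite -lee_fin -Tw exit_time_ge0.
have [e e0 eI] := right_near_open hX s0 (@oI n) (esym Xy) Iy.
have : (s + e)%:E <= inner_exit n w.
  apply: le_ereal_inf_tmp => _ [u [u0 nK] <-].
  rewrite lee_fin leNgt; apply/negP => ue; apply: nK.
  have [us|su] := ltP u s.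
    by apply: before_exit => //; rewrite -/(inner_exit n w) Tw lte_fin.
  have [z Iz <-] := eI u (introT andP (conj su ue)).
  by exists z => //; exact: subset_closure.
by rewrite Tw lee_fin leNgt ltrDl e0.
Qed.

Definition quasi_bad : set Om := [set w | raw_exit w < +oo /\
  ~ (at_time (inner_exit n w) w @[n --> \oo] --> at_time (raw_exit w) w)].

Lemma quasi_bad0 x : (PX x) quasi_bad = 0.
Proof.
apply: (hunt_quasi_left_continuous hX).
- exact: inner_exit_stopping.
- exact: raw_exit_stopping.
- exact: nondecreasing_inner_exit.
- exact: inner_exit_cvg.
Qed.

Lemma inner_exit_fin n w (s : R) : raw_exit w = s%:E ->
  exists t, [/\ inner_exit n w = t%:E, (0 <= t)%R & (t <= s)%R].
Proof.
move=> ws; have := inner_exit_le n w; have := exit_time_ge0 (K n) w.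
rewrite ws -/(inner_exit n w); case: (inner_exit n w) => [t| |] //.
by rewrite !lee_fin => t0 ts; exists t.
Qed.

(** If X at the raw exit time lies in [V], it lies in some open [inner V k]. Convergence along the
    inner exit times would put X in [inner V k], hence in [inner V n], at the n-th of them for some
    n >= k, which [inner_exit_notin] forbids. *)
Lemma exit_in_quasi_bad : exit_in V `<=` quasi_bad.
Proof.
move=> w Vw; have := raw_exit_ge0 w; move: Vw; rewrite /exit_in /quasi_bad /=.
case ws : (raw_exit w) => [s| |] //; last by case.
move=> [y Vy Xy] _; rewrite ltry; split => // cvg.
have [k _ Iy] := VI Vy.
have : nbhs (at_time s%:E w) (Some @` inner V k : set T^∂).
  rewrite -Xy; apply: one_point_compactification_some_nbhs.
  exact: open_nbhs_nbhs.
move=> /cvg[N _ HN].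
have := HN (maxn N k) (leq_maxl _ _); rewrite /=.
have [t [Tt t0 ts]] := inner_exit_fin (maxn N k) ws.
rewrite Tt /= => -[z Iz Xz].
apply: (inner_exit_notin Tt); exists z => //.
by apply: inner_le Iz; exact: leq_maxr.
Qed.

Lemma raw_exitE w : ~ exit_in V w -> raw_exit w = exit_time V w.
Proof.
move=> nV; apply/eqP; rewrite eq_le raw_exit_le /=.
have := raw_exit_ge0 w; case ws : (raw_exit w) => [s| |] // s0.
  apply: ereal_inf_lbound; exists s => //; split; first by rewrite -lee_fin.
  by move=> Vs; apply: nV; rewrite /exit_in /= ws.
by rewrite leey.
Qed.

Lemma exit_in_self0 x : law X x (exit_in V) = 0.
Proof.
rewrite -PcE; last by apply: exit_in_measurable; exact: sub_sigma_algebra.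
apply/eqP; rewrite eq_le measure_ge0 andbT -(quasi_bad0 x).
by apply: Pc_le; exact: exit_in_quasi_bad.
Qed.

End exhausted_exit.

(** * Exit distributions as measures on the state space *)

Lemma measurable_fun_oapp d d' (O : measurableType d) (U : measurableType d')
    (R : realType) (Y : O -> option U) (f : U -> \bar R) :
  (forall A, measurable A -> measurable [set w | (Some @` A) (Y w)]) ->
  measurable_fun setT f -> measurable_fun setT (fun w => oapp f 0 (Y w)).
Proof.
move=> mY mf _ B mB; rewrite setTI.
have -> : (fun w => oapp f 0 (Y w)) @^-1` B = [set w | (Some @` (f @^-1` B)) (Y w)] `|`
    (~` [set w | (Some @` setT) (Y w)] `&` (if pselect (B 0) then setT else set0)).
  apply/seteqP; split => w /=; case E : (Y w) => [y|] /=.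
  - by left; exists y.
  - by move=> B0; right; split; [case|case: pselect].
  - by move=> [[z Bz [<-]]//|[nY _]]; exfalso; apply: nY; exists y.
  - by move=> [[z _ //]|[_]]; case: pselect.
apply: measurableU; first by apply: mY; rewrite -[X in measurable X]setTI; exact: mf.
apply: measurableI; first by apply: measurableC; exact: mY.
by case: pselect => ?; [exact: measurableT|exact: measurable0].
Qed.

Lemma partial_pushforward d d' (O : measurableType d) (U : measurableType d')
    (R : realType) (mu : {measure set O -> \bar R}) (Y : O -> option U) :
  (forall A, measurable A -> measurable [set w | (Some @` A) (Y w)]) ->
  exists nu : {measure set U -> \bar R},
    (forall A, measurable A -> nu A = mu [set w | (Some @` A) (Y w)]) /\
    (forall f, measurable_fun setT f -> (forall y, 0 <= f y) ->
      \int[nu]_y f y = \int[mu]_w oapp f 0 (Y w)).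
Proof.
move=> mY.
pose D := [set w | (Some @` [set: U]) (Y w)].
have mD : measurable D by exact: mY.
(* The default value is taken only off [D], and [mu] is restricted to [D] before being pushed
   forward. *)
pose Y' w := odflt point (Y w).
have DY' w A : (D w /\ A (Y' w)) <-> (Some @` A) (Y w).
  rewrite /D /Y' /=; case: (Y w) => [y|]; last by split => [[[]]|[]].
  by split => [[_ Ay]|[z Az [<-]]]; [exists y|split => //; exists z].
have mY' : measurable_fun setT Y'.
  move=> _ A mA; rewrite setTI.
  rewrite (_ : _ @^-1` _ = [set w | (Some @` A) (Y w)] `|`
    (~` D `&` (if pselect (A point) then setT else set0))).
    apply: measurableU; first exact: mY.
    apply: measurableI; first exact: measurableC.
    by case: pselect => ?; [exact: measurableT|exact: measurable0].
  apply/seteqP; split => w /=.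
    have [Dw Aw|nD] := pselect (D w); first by left; exact/DY'.
    rewrite /Y'; case E : (Y w) => [y|]; last by right; split => //; case: pselect.
    by exfalso; apply: nD; rewrite /D /= E; exists y.
  move=> [/DY'[] //|[nD]]; rewrite /Y'; case E : (Y w) => [y|].
    by exfalso; apply: nD; rewrite /D /= E; exists y.
  by case: pselect.
pose nu := pushforward (mrestr mu mD) Y'.
have nuE A : measurable A -> nu A = mu [set w | (Some @` A) (Y w)].
  move=> mA; rewrite /nu /pushforward /mrestr; congr (mu _).
  by apply/seteqP; split => w /=; have := DY' w A; tauto.
have mif (f : U -> \bar R) : measurable_fun setT f ->
    measurable_fun setT (fun w => oapp f 0 (Y w)) by exact: measurable_fun_oapp.
have if0 (f : U -> \bar R) w : (forall y, 0 <= f y) -> 0 <= oapp f 0 (Y w).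
  by move=> f0; case: (Y w) => /=.
suff H : forall f, measurable_fun setT f -> (forall y, 0 <= f y) ->
  \int[nu]_y f y = \int[mu]_w oapp f 0 (Y w) by exists nu; split.
apply: ge0_measurable_fun_ind => [A mA|c f c0 mf f0 IH|f g mf mg f0 g0 IHf IHg|].
- rewrite integral_indic// setIT [LHS]nuE//.
  rewrite (_ : (fun w => _) = fun w => (\1_[set w | (Some @` A) (Y w)] w)%:E).
    by rewrite integral_indic// ?setIT//; exact: mY.
  apply/funext => w; rewrite !indicE.
  have [Aw|nA] := pselect ((Some @` A) (Y w)).
    by rewrite [in RHS]mem_set//; case: Aw => y Ay <- /=; rewrite indicE mem_set.
  rewrite [in RHS]memNset//; case E : (Y w) nA => [y|] //= nA.
  by rewrite indicE memNset// => Ay; apply: nA; exists y.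
- rewrite ge0_integralZl_EFin// IH -ge0_integralZl_EFin//; last 2 first.
  + by move=> w _; exact: if0.
  + exact: mif.
  by apply: eq_integral => w _; case: (Y w) => //=; rewrite mule0.
- rewrite ge0_integralD// IHf IHg -ge0_integralD//; last 4 first.
  + by move=> w _; exact: if0.
  + exact: mif.
  + by move=> w _; exact: if0.
  + exact: mif.
  by apply: eq_integral => w _; case: (Y w) => //=; rewrite adde0.
- move=> f_ f mf f0 ndf cf IH.
  have cL : \int[nu]_y f_ n y @[n --> \oo] --> \int[nu]_y f y.
    have := @cvg_monotone_convergence _ _ _ nu setT measurableT f_.
    rewrite (_ : (fun w => limn _) = f); first by apply.
    by apply/funext => w; apply/cvg_lim => //; exact: cf.
  have cR : \int[mu]_w oapp (f_ n) 0 (Y w) @[n --> \oo] --> \int[mu]_w oapp f 0 (Y w).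
    have := @cvg_monotone_convergence _ _ _ mu setT measurableT
      (fun n w => oapp (f_ n) 0 (Y w)).
    rewrite (_ : (fun w => limn _) = fun w => oapp f 0 (Y w)).
      apply => [n|n w _|w _ m n mn]; first exact: mif.
        exact: if0.
      by case: (Y w) => //= y; exact: ndf.
    apply/funext => w; apply/cvg_lim => //; case: (Y w) => /= [y|]; first exact: cf.
    exact: cvg_cst.
  have E : (fun n => \int[nu]_y f_ n y) = fun n => \int[mu]_w oapp (f_ n) 0 (Y w).
    by apply/funext.
  by rewrite E in cL; exact: (cvg_unique _ cL cR).
Unshelve. all: exact: mY'. Qed.

Section exit_distribution.
Context {R : realType} {T : pmetricType R} (X : process T) (hX : is_hunt X).
Local Notation Om := (sample X).
Local Notation PX x := (@Pc _ _ X x).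
Local Notation OmP x := (caratheodory_type (law X x)^*%mu).
Local Notation raw := (raw_filtration (X:=X)).

Lemma exit_distribution_exists (V : set T) (x : T^∂) : exhausted V ->
  exists nu : {measure set (borel T) -> \bar R},
    (forall A, measurable A -> nu A = law X x (exit_in V A)) /\
    (forall f : T -> \bar R, measurable_fun setT (f : borel T -> \bar R) ->
      (forall y, 0 <= f y) ->
      \int[nu]_y f y = \int[law X x]_w oapp f 0 (at_time (raw_exit V w) w)).
Proof.
move=> exV.
apply: (@partial_pushforward _ _ (sample X) (borel T) R (law X x)
  (fun w => at_time (raw_exit V w) w)).
by move=> A mA; exact: (exit_in_measurable hX exV).
Qed.

Lemma measurable_start (z : T^∂) : measurable [set w : Om | X 0%R w = z].
Proof.
have mz : measurable ([set z] : set (borel T^∂)).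
  case: z => [z|].
    rewrite (_ : [set Some z] = Some @` [set z]).
      apply: measurable_some; rewrite -[[set z]]setCK; apply: measurableC.
      by apply: sub_sigma_algebra; apply: closed_openC; exact/accessible_closed_set1/hausdorff_accessible/metric_hausdorff.
    by apply/seteqP; split => [_ ->|_ [_ -> <-]] //; exists z.
  rewrite (_ : [set None] = ~` (Some @` [set: T])).
    by apply: measurableC; apply: measurable_some_open; exact: openT.
  apply/seteqP; split => [_ -> [] //|[y|] //= nS].
  by exfalso; apply: nS; exists y.
by have := hunt_measurable hX (lexx 0%R) measurableT mz; rewrite setTI.
Qed.

Lemma law_start_sub (z : T^∂) (A : set Om) : measurable A ->
  [set w | X 0%R w = z] `<=` A -> law X z A = 1.
Proof.
move=> mA zA; apply/eqP; rewrite eq_le probability_le1//=.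
rewrite -(hunt_normal hX z); apply: le_measure => //; rewrite inE//.
exact: measurable_start.
Qed.

Lemma law_start_disj (z : T^∂) (A : set Om) : measurable A ->
  (forall w, X 0%R w = z -> ~ A w) -> law X z A = 0.
Proof.
move=> mA zA; rewrite -[A]setCK probability_setC; last exact: measurableC.
by rewrite law_start_sub ?subee//; exact: measurableC.
Qed.

Lemma exit_in_start (V A : set T) (z : T) : exhausted V ->
  measurable (A : set (borel T)) -> ~ V z ->
  law X (Some z) (exit_in V A) = (\1_A z)%:E.
Proof.
move=> exV mA nV.
have at0 w : X 0%R w = Some z -> raw_exit V w = 0.
  move=> X0; apply/eqP; rewrite eq_le raw_exit_ge0 andbT.
  apply: ge_ereal_sup => _ [n _ <-]; apply: ereal_inf_lbound.
  exists 0%R => //; split => // -[y Ky]; rewrite X0 => -[yz].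
  by apply: nV; rewrite -yz; case: exV => _ _ _ _ KV; exact: KV Ky.
have mE := exit_in_measurable hX exV mA.
rewrite indicE; have [Az|nA] := pselect (A z).
  rewrite mem_set// law_start_sub// => w /= X0.
  by rewrite /exit_in /= at0//= X0; exists z.
rewrite memNset// law_start_disj// => w X0.
by rewrite /exit_in /= at0//= X0 => -[y Ay [yz]]; apply: nA; rewrite -yz.
Qed.

Lemma exit_in_dead (V A : set T) : exhausted V -> measurable (A : set (borel T)) ->
  law X ∂ (exit_in V A) = 0.
Proof.
move=> exV mA; apply: law_start_disj; first exact: (exit_in_measurable hX exV).
move=> w X0; rewrite /exit_in /=; have := raw_exit_ge0 V w.
case: (raw_exit V w) => [s| |] // s0; last by case.
by rewrite /= (dead_le hX (lexx _) _ X0) -?lee_fin// => -[].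
Qed.

Lemma exit_time_shift (U : set T) (S : Om -> \bar R) th w : shift_by S th ->
  0 <= S w -> S w <= exit_time U w ->
  exit_time U w = S w + exit_time U (th w).
Proof.
move=> Sth; case ES : (S w) => [s| |] // s0 sU; last first.
  have := exit_time_ge0 U (th w); case: (exit_time U (th w)) => [u| |] // _;
  by move: sU; rewrite leye_eq => /eqP.
rewrite lee_fin in s0; apply/eqP; rewrite eq_le; apply/andP; split.
  rewrite -leeBlDl//; apply: le_ereal_inf_tmp => _ [u [u0 nU] <-].
  rewrite leeBlDl// -EFinD; apply: ereal_inf_lbound; exists (s + u)%R => //.
  by split; [exact: addr_ge0|move: nU; rewrite Sth// ES].
apply: le_ereal_inf_tmp => _ [v [v0 nU] <-].
have sv : (s <= v)%R.
  by rewrite -lee_fin; apply: (le_trans sU); apply: ereal_inf_lbound; exists v.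
rewrite -leeBrDl//; apply: ereal_inf_lbound; exists (v - s)%R => //.
split; first by rewrite subr_ge0.
by rewrite Sth ?subr_ge0// ES /= subrKC.
Qed.

Lemma at_time_shift (S : Om -> \bar R) th (t : \bar R) w : shift_by S th ->
  0 <= S w -> 0 <= t -> at_time t (th w) = at_time (S w + t) w.
Proof.
move=> Sth; case ES : (S w) => [s| |] //; case: t => [t| |] // s0 t0 /=.
  by rewrite Sth ?ES// -lee_fin.
by rewrite Sth ?ES// -lee_fin.
Qed.

Lemma le_measure_null d (O : measurableType d) (mu : {measure set O -> \bar R})
    (A B N : set O) : measurable A -> measurable B -> measurable N ->
  mu N = 0 -> A `<=` B `|` N -> mu A <= mu B.
Proof.
move=> mA mB mN N0 AB; rewrite -[leRHS]adde0 -N0.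
apply: (le_trans _ (measureU2 mu mB mN)).
by apply: le_measure; rewrite ?inE//; exact: measurableU.
Qed.

Lemma measureU_null d (O : measurableType d) (mu : {measure set O -> \bar R})
    (A B : set O) : measurable A -> measurable B ->
  mu A = 0 -> mu B = 0 -> mu (A `|` B) = 0.
Proof.
move=> mA mB A0 B0; apply/eqP; rewrite eq_le measure_ge0 andbT.
have <- : mu A + mu B = 0 by rewrite A0 B0 adde0.
exact: measureU2.
Qed.

(** This is the strong Markov property at the exit from [V]. Additivity under the shift is available
    for true exit times, so the events are compared off the null set where the path or its shift has
    its raw exit position in [U]; elsewhere raw and true exit times from [U] agree. *)
Lemma exit_markov (V U A : set T) (x : T^∂) : exhausted V -> exhausted U ->
  V `<=` U -> measurable (A : set (borel T)) ->
  law X x (exit_in U A) =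
  \int[law X x]_w law X (at_time (raw_exit V w) w) (exit_in U A).
Proof.
move=> exV exU VU mA.
have stV := raw_exit_stopping hX exV.
have [th Sth] := exists_shift hX (raw_exit_ge0 V).
have oU : measurable (U : set (borel T)) by apply: sub_sigma_algebra; case: exU.
have mG := exit_in_measurable hX exU mA.
have mN := exit_in_measurable hX exU oU.
have [mthG thG] := strong_markov hX x stV Sth (exit_in_raw hX exU mA).
have [mthN thN] := strong_markov hX x stV Sth (exit_in_raw hX exU oU).
have thN0 : (PX x) (th @^-1` exit_in U U) = 0.
  by rewrite thN; apply: integral0_eq => w _; exact: exit_in_self0.
have N0 : (PX x) (exit_in U U) = 0 by rewrite PcE// exit_in_self0.
have PG := measurable_Pc x mG; have PN := measurable_Pc x mN.
have key w : ~ exit_in U U w -> ~ exit_in U U (th w) ->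
    exit_in U A (th w) <-> exit_in U A w.
  move=> n1 n2; rewrite /exit_in /= (raw_exitE exU n1) (raw_exitE exU n2).
  rewrite (at_time_shift Sth (raw_exit_ge0 V w) (exit_time_ge0 _ _)).
  rewrite -(exit_time_shift Sth (raw_exit_ge0 V w))//.
  by apply: (le_trans (raw_exit_le exV w)); exact: le_exit_time.
have N'0 := measureU_null PN mthN N0 thN0.
have mN' := measurableU _ _ PN mthN.
rewrite -PcE// -integral_Pc//; last first.
  apply: (@measurableT_comp _ _ _ Om (borel T^∂) (\bar R)
    (fun z => law X z (exit_in U A)) setT (fun w => at_time (raw_exit V w) w)).
    by apply: (law_raw_measurable hX); exact: (exit_in_raw hX exU mA).
  apply: measurable_fun_opc => // O oO; rewrite setTI.
  by apply: (exit_in_measurable hX exV); exact: sub_sigma_algebra.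
rewrite -thG.
have sub1 : exit_in U A `<=` th @^-1` exit_in U A `|` (exit_in U U `|` th @^-1` exit_in U U).
  move=> w Gw; have [n1|?] := pselect (exit_in U U w); first by right; left.
  have [n2|?] := pselect (exit_in U U (th w)); first by right; right.
  by left; apply/key.
have sub2 : th @^-1` exit_in U A `<=` exit_in U A `|` (exit_in U U `|` th @^-1` exit_in U U).
  move=> w Gw; have [n1|?] := pselect (exit_in U U w); first by right; left.
  have [n2|?] := pselect (exit_in U U (th w)); first by right; right.
  by left; apply/key.
apply/eqP; rewrite eq_le; apply/andP; split.
  exact: (@le_measure_null _ (OmP x) (PX x) _ _ _ PG mthG mN' N'0 sub1).
exact: (@le_measure_null _ (OmP x) (PX x) _ _ _ mthG PG mN' N'0 sub2).
Qed.

End exit_distribution.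

(** * The Lévy system and jumps out of a set *)

Lemma null_caratheodory (R : realType) (O : pointedType)
    (mu : {outer_measure set O -> \bar R}) (A : set O) :
  mu A = 0 -> measurable (A : set (caratheodory_type mu)).
Proof.
move=> A0; apply: le_caratheodory_measurable => B.
have -> : mu (B `&` A) = 0.
  apply/eqP; rewrite eq_le outer_measure_ge0 andbT -A0.
  by apply: le_outer_measure; exact: subIsetr.
by rewrite add0e; apply: le_outer_measure; exact: subIsetl.
Qed.

Section lebesgue_time.
Context {R : realType}.
Local Notation leb := (@lebesgue_measure R).

Lemma lebesgue_measure_le (u : \bar R) : 0 <= u ->
  measurable [set s : measurableTypeR R | (0 <= s)%R /\ s%:E <= u] /\
  leb [set s : R | (0 <= s)%R /\ s%:E <= u] = u.
Proof.
case: u => [u| |] // u0.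
  have -> : [set s : R | (0 <= s)%R /\ s%:E <= u%:E] = `[0%R, u]%classic.
    by apply/seteqP; split => s /=; rewrite in_itv /= lee_fin => /andP.
  split; first exact: measurable_itv.
  rewrite lebesgue_measure_itv /= lte_fin oppr0 adde0.
  by case: ltP => // u0'; congr EFin; apply/eqP; rewrite eq_le u0' andbT -lee_fin.
have -> : [set s : R | (0 <= s)%R /\ s%:E <= +oo] = `[0%R, +oo[%classic.
  by apply/seteqP; split => s /=; rewrite in_itv /= ?andbT ?leey => // -[].
split; first exact: measurable_itv.
by rewrite lebesgue_measure_itv /= ltry.
Qed.

Lemma lebesgue_measure_lt (u : \bar R) : 0 <= u ->
  measurable [set s : measurableTypeR R | (0 <= s)%R /\ s%:E < u] /\
  leb [set s : R | (0 <= s)%R /\ s%:E < u] = u.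
Proof.
case: u => [u| |] // u0.
  have -> : [set s : R | (0 <= s)%R /\ s%:E < u%:E] = `[0%R, u[%classic.
    by apply/seteqP; split => s /=; rewrite in_itv /= lte_fin => /andP.
  split; first exact: measurable_itv.
  rewrite lebesgue_measure_itv /= lte_fin oppr0 adde0.
  by case: ltP => // u0'; congr EFin; apply/eqP; rewrite eq_le u0' andbT -lee_fin.
have -> : [set s : R | (0 <= s)%R /\ s%:E < +oo] = `[0%R, +oo[%classic.
  by apply/seteqP; split => s /=; rewrite in_itv /= ?andbT ?ltry => // -[].
split; first exact: measurable_itv.
by rewrite lebesgue_measure_itv /= ltry.
Qed.

End lebesgue_time.

Section integral_indicator_pair.
Context d (U : measurableType d) (R : realType).

Lemma integral_indic_pair (mu : {measure set U -> \bar R}) (V A : set U) (y : U) :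
  measurable A -> V y -> \int[mu]_z (\1_V y * \1_A z)%:E = mu A.
Proof.
move=> mA Vy; rewrite indicE mem_set//.
under eq_integral do rewrite mul1r.
by rewrite integral_indic// setIT.
Qed.

Lemma integral_indic_pair0 (mu : {measure set U -> \bar R}) (V A : set U) (y : U) :
  ~ V y -> \int[mu]_z (\1_V y * \1_A z)%:E = 0.
Proof.
by move=> nV; rewrite indicE memNset//; apply: integral0_eq => z _; rewrite mul0r.
Qed.

End integral_indicator_pair.

Section jumps.
Context {R : realType} {T : pmetricType R} (X : process T) (hX : is_hunt X).
Local Notation Om := (sample X).
Local Notation PX x := (@Pc _ _ X x).
Local Notation OmP x := (caratheodory_type (law X x)^*%mu).
Variables (V A : set T) (x : T).
Hypothesis exV : exhausted V.
Hypothesis mA : measurable (A : set (borel T)).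
Hypothesis AV : A `&` closure V = set0.
Hypothesis Vx : V x.

Let jump (s : R) (w : Om) : \bar R :=
  if (left_limit s w, X s w) is (Some y, Some z)
  then (\1_V y * \1_A z)%:E else 0.

Let notAV y : A y -> V y -> False.
Proof.
move=> Ay Vy; have : (A `&` closure V) y by split => //; exact: subset_closure.
by rewrite AV.
Qed.

Lemma left_limit_in (K : set T) (s u0 : R) w : compact K -> closed K ->
  (0 <= u0 < s)%R ->
  (forall u, (u0 <= u < s)%R -> (Some @` K : set T^∂) (X u w)) ->
  (Some @` K : set T^∂) (left_limit s w).
Proof.
move=> cK clK /andP[u00 u0s] HK.
have cv : X u w @[u --> s^'-] --> left_limit s w.
  by have := @hunt_left_limits _ _ _ hX s w (le_lt_trans u00 u0s).
apply: contrapT => nK.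
have nb : nbhs (left_limit s w) (~` (Some @` K) : set T^∂).
  move: nK; case: (left_limit s w) => [y|] nK.
    have /(one_point_compactification_some_nbhs) : nbhs y (~` K).
      apply: open_nbhs_nbhs; split; first exact: closed_openC.
      by move=> Ky; apply: nK; exists y.
    apply: filterS => _ [z nKz <-] [z' Kz' [zz]].
    by rewrite -zz in nKz; exact: (nKz Kz').
  exists K; first by split.
  move=> _ [[z nKz <-] [z' Kz' [zz]]|-> [z' _]] //.
  by rewrite -zz in nKz; exact: (nKz Kz').
have : \forall u \near s^'-, (~` (Some @` K) : set T^∂) (X u w) by exact: (cv _ nb).
have n1 : \forall u \near s^'-, (u0 < u)%R by exact: nbhs_left_gt.
have n2 : \forall u \near s^'-, (u < s)%R by exact: nbhs_left_lt.
move=> n3; have : \forall u \near s^'-, False.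
  near=> u; have /(_ _)[] : (~` (Some @` K) : set T^∂) (X u w) by near: u.
  apply: HK; apply/andP; split; last by near: u.
  by apply: ltW; near: u.
by move=> /filter_ex[].
Unshelve. all: by end_near. Qed.

(** No jump before the exit ends in [A], since the path is still in [V]. If the exit position is in
    [A], hence away from [closure V], some inner exit time must equal the raw exit time: otherwise
    points of [V] would converge to a point of [A]. Until then the path stays in a compact subset of
    [V], so the left limit is in [V] and the exit jump is counted exactly once. *)
Lemma jump_sum w : ~ quasi_bad V w -> X 0%R w = Some x ->
  \esum_(s in [set s : R | (0 < s)%R /\ s%:E <= raw_exit V w]) jump s w =
  (\1_(exit_in V A) w)%:E.
Proof.
move=> ok X0.
have jump0 s : 0 <= jump s w.
  rewrite /jump; case: (left_limit s w) => [y|] //; case: (X s w) => [z|] //.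
have before s : (0 <= s)%R -> s%:E < raw_exit V w -> (Some @` V : set T^∂) (X s w).
  by move=> s0 ss; apply: before_exit => //; apply: lt_le_trans ss (raw_exit_le exV w).
have notA s : (forall z, X s w = Some z -> ~ A z) -> jump s w = 0.
  move=> nA; rewrite /jump; case: (left_limit s w) => [y|] //.
  case E : (X s w) => [z|] //; rewrite [\1_A z]indicE memNset ?mulr0//.
  exact: nA.
have early s : (0 < s)%R -> s%:E < raw_exit V w -> jump s w = 0.
  move=> s0 ss; apply: notA => z Xs Az; have [y Vy] := before s (ltW s0) ss.
  by rewrite Xs => -[yz]; apply: (@notAV y) => //; rewrite yz.
rewrite indicE; have [Aw|nA] := pselect (exit_in V A w); last first.
  rewrite memNset//; apply: esum1 => s [s0]; rewrite le_eqVlt => /predU1P[ss|]; last exact: early.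
  by apply: notA => z Xs Az; apply: nA; rewrite /exit_in /= -ss /= Xs; exists z.
rewrite mem_set//; move: Aw; rewrite /exit_in /=.
have := raw_exit_ge0 V w; case ws : (raw_exit V w) => [s0| |] //; last by move=> _ [].
rewrite lee_fin => s00 /= [z Az Xz].
have s0gt : (0 < s0)%R.
  rewrite lt_neqAle s00 andbT; apply/eqP => s0E.
  by move: Xz; rewrite -s0E X0 => -[zx]; apply: (@notAV z) => //; rewrite zx.
have cvg : at_time (inner_exit V n w) w @[n --> \oo] --> at_time (raw_exit V w) w.
  by apply: contrapT => nc; apply: ok; split => //; rewrite ws ltry.
have [n Tn] : exists n, inner_exit V n w = s0%:E.
  apply: contrapT => nT.
  have lt n : exists t, [/\ inner_exit V n w = t%:E, (0 <= t)%R & (t < s0)%R].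
    have [t [Tt t0 ts]] := inner_exit_fin n ws; exists t; split => //.
    rewrite lt_neqAle ts andbT; apply/eqP => tE; apply: nT; exists n.
    by rewrite Tt tE.
  have nz : nbhs (at_time (raw_exit V w) w) (Some @` (~` closure V) : set T^∂).
    rewrite ws /= -Xz; apply: one_point_compactification_some_nbhs.
    apply: open_nbhs_nbhs; split; first exact/closed_openC/closed_closure.
    by move=> Vz; have : (A `&` closure V) z by []; rewrite AV.
  have [N _ /(_ N (leqnn _))] := cvg _ nz; rewrite /=.
  have [t [-> t0 ts]] := lt N; rewrite /= => -[y nVy yX].
  have [|y' Vy' y'X] := before t t0; first by rewrite ws lte_fin.
  by apply: nVy; move: yX; rewrite -y'X => -[->]; exact: subset_closure.
have [_ _ _ cK KV] := exV.
have [y Ky yl] : (Some @` closure (inner V n) : set T^∂) (left_limit s0 w).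
  apply: (@left_limit_in _ s0 0%R) => //; first exact: closed_closure.
    by rewrite lexx.
  move=> u /andP[u0 us]; apply: before_exit => //.
  by rewrite -/(inner_exit V n w) Tn lte_fin.
have js0 : jump s0 w = 1.
  rewrite /jump -yl -Xz !indicE !mem_set//; first by rewrite mulr1.
  exact: KV Ky.
rewrite (esumID [set s0])//.
rewrite (_ : _ `&` [set s0] = [set s0]); last first.
  by apply/seteqP; split => [s []|_ ->] //; split => //.
rewrite esum_set1// js0 esum1 ?adde0// => s [[s1 ss] /eqP ne].
by apply: early => //; rewrite ws lte_fin lt_neqAle ne -lee_fin.
Qed.


Lemma levy_jump_expectation (N : R.-ker borel T ~> borel T) : levy_system X N ->
  law X (Some x) (exit_in V A) = \int[PX (Some x)]_w
    \int[@lebesgue_measure R]_(s in [set s : R | (0 <= s)%R /\ s%:E <= raw_exit V w])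
      (if X s w is Some y then \int[N y]_z (\1_V y * \1_A z)%:E else 0).
Proof.
move=> [_ levy].
have mV : measurable (V : set (borel T)) by apply: sub_sigma_algebra; case: exV.
pose f (p : (measurableTypeR R * borel T * borel T)%type) : R := (\1_V p.1.2 * \1_A p.2)%R.
have mf : measurable_fun setT f.
  pose P : Type := (measurableTypeR R * borel T * borel T)%type.
  apply: measurable_funM.
    apply: (@measurableT_comp _ _ _ _ (borel T) R (\1_V : borel T -> R) setT
      (fun p : P => p.1.2)); first exact: measurable_indic.
    exact: (measurableT_comp measurable_snd measurable_fst).
  apply: (@measurableT_comp _ _ _ _ (borel T) R (\1_A : borel T -> R) setT
    (fun p : P => p.2)); first exact: measurable_indic.
  exact: measurable_snd.
have f0 p : (0 <= f p)%R by rewrite mulr_ge0.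
have fd s y : f (s, y, y) = 0%R.
  rewrite /f /= !indicE; have [Vy|nV] := pselect (V y).
    by rewrite [y \in A]memNset ?mulr0// => Ay; exact: (@notAV y).
  by rewrite memNset ?mul0r.
have := levy f (raw_exit V) x mf f0 fd (raw_exit_stopping hX exV).
rewrite /f /= => <-.
have mG := exit_in_measurable hX exV mA.
have PG : measurable (exit_in V A : set (OmP (Some x))) by exact: measurable_Pc.
rewrite -PcE//.
have -> : PX (Some x) (exit_in V A) = \int[PX (Some x)]_w (\1_(exit_in V A) w)%:E.
  by rewrite integral_indic ?setIT.
have m1 : measurable_fun setT
    ((fun w => (\1_(exit_in V A) w)%:E) : OmP (Some x) -> \bar R).
  by apply/measurable_EFinP; exact: measurable_indic.
have mX0 : measurable (~` [set w | X 0%R w = Some x] : set (OmP (Some x))).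
  by apply: measurableC; apply: measurable_Pc; exact: (measurable_start hX).
have ae : ae_eq (PX (Some x)) setT (fun w => (\1_(exit_in V A) w)%:E)
   (fun w => \esum_(s in [set s : R | (0 < s)%R /\ s%:E <= raw_exit V w]) jump s w).
  exists (quasi_bad V `|` ~` [set w | X 0%R w = Some x]); split.
  - apply: measurableU => //; apply: null_caratheodory.
    exact: (quasi_bad0 hX exV).
  - apply: measureU_null => //.
    + by apply: null_caratheodory; exact: (quasi_bad0 hX exV).
    + exact: (quasi_bad0 hX exV).
    + rewrite -[LHS]/(PX (Some x) (~` [set w | X 0%R w = Some x])).
      rewrite PcE; last by apply: measurableC; exact: (measurable_start hX).
      by rewrite probability_setC ?(hunt_normal hX) ?subee//; exact: (measurable_start hX).
  - move=> w /= nE; apply: contrapT => /not_orP[nq /contrapT X0]; apply: nE => _.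
    by rewrite jump_sum.
(* The jump sum inherits measurability from the indicator by completeness. *)
have m2 := ae_measurable_fun (@measure_is_complete_caratheodory _ _ _) ae m1.
apply: ge0_ae_eq_integral => // w _.
apply: esum_ge0 => s _; rewrite /jump.
by case: (left_limit s w) => [y|] //; case: (X s w) => [z|].
Qed.

Lemma exit_levy_le (N : R.-ker borel T ~> borel T) (C : R) : levy_system X N ->
  (0 <= C)%R -> (forall y, V y -> N y A <= C%:E) ->
  law X (Some x) (exit_in V A) <= C%:E * \int[law X (Some x)]_w raw_exit V w.
Proof.
move=> levy C0 NC; rewrite (levy_jump_expectation levy).
have mr := raw_measurable_fun hX (raw_exit_measurable hX exV).
have r0 (w : Om) : 0 <= raw_exit V w := raw_exit_ge0 V w.
have -> : C%:E * \int[law X (Some x)]_w raw_exit V w =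
    \int[PX (Some x)]_w (C%:E * raw_exit V w).
  rewrite integral_Pc; first by rewrite ge0_integralZl_EFin.
    exact: measurable_funeM.
  by move=> w; rewrite mule_ge0.
apply: ge0_le_integral_nomeas => w _.
  apply: integral_ge0 => s _; case: (X s w) => // y.
  by apply: integral_ge0 => z _; rewrite lee_fin mulr_ge0.
have [mD lD] := lebesgue_measure_le (r0 w).
rewrite -[in leRHS]lD -integral_cst//; apply: ge0_le_integral_nomeas => s _.
  by case: (X s w) => // y; apply: integral_ge0 => z _; rewrite lee_fin mulr_ge0.
case: (X s w) => [y|]; last by rewrite lee_fin.
have [Vy|nV] := pselect (V y).
  by rewrite integral_indic_pair// ; exact: NC.
by rewrite integral_indic_pair0// lee_fin.
Qed.

Lemma exit_levy_ge (N : R.-ker borel T ~> borel T) (c : R) : levy_system X N ->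
  (0 <= c)%R -> (forall y, V y -> c%:E <= N y A) ->
  c%:E * \int[law X (Some x)]_w raw_exit V w <= law X (Some x) (exit_in V A).
Proof.
move=> levy c0 Nc; rewrite (levy_jump_expectation levy).
have mr := raw_measurable_fun hX (raw_exit_measurable hX exV).
have r0 (w : Om) : 0 <= raw_exit V w := raw_exit_ge0 V w.
have -> : c%:E * \int[law X (Some x)]_w raw_exit V w =
    \int[PX (Some x)]_w (c%:E * raw_exit V w).
  rewrite integral_Pc; first by rewrite ge0_integralZl_EFin.
    exact: measurable_funeM.
  by move=> w; rewrite mule_ge0.
apply: ge0_le_integral_nomeas => w _; first by rewrite mule_ge0// lee_fin.
(* The lower bound on the rate holds only while the path is in [V], that is, strictly before the
   exit; omitting the end point does not change the Lebesgue measure. *)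
have [mD lD] := lebesgue_measure_lt (r0 w).
rewrite -[in leLHS]lD -integral_cst// integral_mkcond [leRHS]integral_mkcond.
apply: ge0_le_integral_nomeas => s _; rewrite !patchE.
  by case: ifP => // _; rewrite lee_fin.
case: ifPn => [/set_mem[s0 ss]|_].
  rewrite mem_set; last by split => //; exact: ltW.
  have [|y Vy <-] := @before_exit _ _ X V w s s0.
    exact: lt_le_trans ss (raw_exit_le exV w).
  by rewrite integral_indic_pair//; exact: Nc.
case: ifP => // _; case: (X s w) => // y.
by apply: integral_ge0 => z _; rewrite lee_fin mulr_ge0.
Qed.

End jumps.

Lemma metric_ball_open {R : realType} {T : pmetricType R} (x : T) (r : R) :
  open (ball x r).
Proof.
rewrite openE => y; rewrite /interior ballEmdist /= => xy.
apply/nbhs_ballP; exists (r - mdist x y)%R => [|z]; first by rewrite /= subr_gt0.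
rewrite !ballEmdist /= => yz.
by apply: (le_lt_trans (metric_triangle _ y _)); rewrite -ltrBrDl.
Qed.

Section exit_tail.
Context {R : realType} {T : pmetricType R} (X : process T) (hX : is_hunt X).
Local Notation PX x := (@Pc _ _ X x).

(** A path that exits [V] to a point outside [ball x s] either does so before time t, and then
    leaves the ball before t, or has raw exit time at least t, which Markov's inequality controls by
    the mean exit time. *)
Lemma exit_tail (phi : R -> R) (r0 : \bar R) (C : R) (V : set T) (x : T) (s t : R) :
  EP_le X phi r0 C -> exhausted V -> (0 < t)%R -> (0 < s)%R -> s%:E < r0 ->
  law X (Some x) (exit_in V (~` ball x s)) <=
  (C * t / phi s)%:E + t^-1%:E * \int[law X (Some x)]_w raw_exit V w.
Proof.
move=> EP exV t0 s0 sr.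
have mr := raw_measurable_fun hX (raw_exit_measurable hX exV).
have mB : measurable (~` ball x s : set (borel T)).
  by apply: measurableC; apply: sub_sigma_algebra; exact: metric_ball_open.
have mt : measurable [set w : sample X | t%:E <= raw_exit V w].
  by have := emeasurable_fun_c_infty measurableT mr t%:E; rewrite setTI.
rewrite -PcE; last exact: (exit_in_measurable hX exV).
apply: (@le_trans _ _ ((PX (Some x)) [set w | exit_time (ball x s) w < t%:E] +
    (PX (Some x)) [set w | t%:E <= raw_exit V w])).
  apply: (le_trans _ (outer_measureU2 _ _ _)); apply: Pc_le => w /=.
  rewrite /exit_in /=; have := raw_exit_ge0 V w.
  case: (raw_exit V w) => [u| |] //; last by move=> _ [].
  rewrite lee_fin => u0 /= [z nBz Xz].
  have [ut|tu] := ltP u t; [left|right]; last by rewrite lee_fin.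
  apply: (@le_lt_trans _ _ u%:E); last by rewrite lte_fin.
  apply: ereal_inf_lbound; exists u => //; split => //.
  by rewrite -Xz => -[z' Bz' [zz]]; apply: nBz; rewrite -zz.
apply: leeD; first exact: EP.
rewrite PcE// lee_pdivlMl//.
have := @le_integral_comp_abse _ _ _ (law X (Some x)) setT measurableT
  (raw_exit V) t id (@measurable_id _ _ _) (fun _ => id) (fun _ _ _ _ => id) mr t0.
rewrite setTI.
have -> : [set w | t%:E <= `|raw_exit V w|] = [set w : sample X | t%:E <= raw_exit V w].
  by apply/seteqP; split => w /=; rewrite gee0_abs// raw_exit_ge0.
move=> /le_trans; apply.
by apply: ge0_le_integral_nomeas => w _ //; rewrite gee0_abs// raw_exit_ge0.
Qed.

End exit_tail.

(** * The Carleson estimate *)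

Lemma le_integral_scaled d (U : measurableType d) (R : realType)
    (m1 m2 : {measure set U -> \bar R}) (F : set U) (f : U -> \bar R) (c : R) :
  measurable F -> (0 <= c)%R ->
  (forall B, measurable B -> B `<=` F -> m1 B <= c%:E * m2 B) ->
  measurable_fun setT f -> (forall x, 0 <= f x) ->
  \int[m1]_(x in F) f x <= c%:E * \int[m2]_(x in F) f x.
Proof.
move=> mF c0 m12 mf f0.
have sub (B : set U) : B `<=` F -> B `&` F = B by move=> /setIidl.
have E1 (m : {measure set U -> \bar R}) :
    \int[m]_(x in F) f x = \int[mrestr m mF]_(x in F) f x.
  by apply: eq_measure_integral => B mB BF; rewrite -[RHS]/(m (B `&` F)) sub.
rewrite E1 [in leRHS]E1 -[c]/((NngNum c0)%:num) -ge0_integral_mscale//; last first.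
  exact: measurable_funTS.
apply: ge0_le_measure_integral => // B mB.
rewrite /mscale /mrestr /=; apply: m12; first exact: measurableI.
exact: subIsetr.
Qed.

Lemma le_integral_off d (U : measurableType d) (R : realType)
    (mu : {measure set U -> \bar R}) (V : set U) (f1 f2 : U -> \bar R) :
  measurable V -> mu V = 0 ->
  measurable_fun setT f1 -> (forall x, 0 <= f1 x) ->
  measurable_fun setT f2 -> (forall x, 0 <= f2 x) ->
  (forall x, ~ V x -> f1 x <= f2 x) ->
  \int[mu]_x f1 x <= \int[mu]_x f2 x.
Proof.
move=> mV V0 mf1 f10 mf2 f20 f12; apply: ae_ge0_le_integral => //.
exists V; split => // x /= nE; apply: contrapT => nV; apply: nE => _.
exact: f12.
Qed.

Section harmonic_setting.
Variables (R : realType) (Q lam : R) (g : nat).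

(* [om V x] is the exit distribution of [V] from [x] and [e V x] the mean exit
   time; all implicit constants are collected in [Q] and [g]. *)
Record harmonic_setting (T : pmetricType R)
    (N : T -> {measure set (borel T) -> \bar R})
    (om : set T -> T -> {measure set (borel T) -> \bar R})
    (e : set T -> T -> \bar R) (phi : R -> R) (xi : T) (r : R)
    (adm := fun V : set T => open V /\ V `<=` ball xi (2 * r)) : Prop := {
  hs_r : (0 < r)%R ;
  hs_phi_gt0 : forall s, (0 < s)%R -> (0 < phi s)%R ;
  hs_phi_le : forall s t, (0 < s)%R -> (s <= t)%R -> (phi s <= phi t)%R ;
  hs_phi_dbl : forall L s, (1 <= L)%R -> (0 < s)%R ->
    (phi (L * s) <= Q * L ^+ g * phi s)%R ;
  hs_N_cmp : forall L (w w' : T) (A : set (borel T)), (1 <= L)%R -> measurable A ->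
    ~ A w -> ~ A w' -> (forall z, A z -> mdist w' z <= L * mdist w z)%R ->
    N w A <= (Q * L ^+ g)%:E * N w' A ;
  hs_N_tail : forall (y : T) s, (0 < s)%R -> N y (~` ball y s) <= (Q / phi s)%:E ;
  hs_N_ring : forall (y : T) s, (0 < s)%R -> (s <= 2 * r)%R ->
    ((Q * phi s)^-1)%:E <= N y (ball y (lam * s)%R `\` ball y s) ;
  hs_om_le1 : forall V x, adm V -> om V x setT <= 1 ;
  hs_om_self : forall V x, adm V -> om V x V = 0 ;
  hs_om_out : forall V x (A : set (borel T)), adm V -> measurable A -> ~ V x ->
    om V x A = (\1_A x)%:E ;
  hs_om_meas : forall V (A : set (borel T)), adm V -> measurable A ->
    measurable_fun setT ((fun z => om V z A) : borel T -> \bar R) ;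
  hs_om_markov : forall V U x (A : set (borel T)), adm V -> adm U -> V `<=` U ->
    measurable A -> om U x A = \int[om V x]_z om U z A ;
  hs_om_levy_le : forall V x (A : set (borel T)) (C : R), adm V -> V x ->
    measurable A -> A `&` closure V = set0 -> (0 <= C)%R ->
    (forall y, V y -> N y A <= C%:E) -> om V x A <= C%:E * e V x ;
  hs_om_levy_ge : forall V x (A : set (borel T)) (c : R), adm V -> V x ->
    measurable A -> A `&` closure V = set0 -> (0 <= c)%R ->
    (forall y, V y -> c%:E <= N y A) -> c%:E * e V x <= om V x A ;
  hs_om_tail : forall V x s t, adm V -> (0 < s)%R -> (s <= r)%R -> (0 < t)%R ->
    om V x (~` ball x s) <= (Q * t / phi s)%:E + t^-1%:E * e V x ;
  hs_e_gt0 : forall V x, adm V -> V x -> 0 < e V x }.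

End harmonic_setting.

Section core.
Context {R : realType} {Q lam : R} {g : nat}.
Hypotheses (Q1 : (1 <= Q)%R) (lam2 : (2 <= lam)%R).
Context {T : pmetricType R} {N : T -> {measure set (borel T) -> \bar R}}
  {om : set T -> T -> {measure set (borel T) -> \bar R}}
  {e : set T -> T -> \bar R} {phi : R -> R} {xi : T} {r : R}.
Hypothesis H : harmonic_setting Q lam g N om e phi xi r.

Let adm (V : set T) := open V /\ V `<=` ball xi (2 * r).

Lemma ballP (x y : T) (s : R) : ball x s y <-> (mdist x y < s)%R.
Proof. by rewrite ballEmdist. Qed.

Lemma nballP (x y : T) (s : R) : ~ ball x s y <-> (s <= mdist x y)%R.
Proof. by rewrite ballEmdist /= leNgt; split => /negP. Qed.

Lemma measurable_ball_borel (x : T) (s : R) : measurable (ball x s : set (borel T)).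
Proof. by apply: sub_sigma_algebra; exact: metric_ball_open. Qed.

Lemma closure_ball_le (x z : T) (s : R) (V : set T) : V `<=` ball x s ->
  closure V z -> (mdist x z <= s)%R.
Proof.
move=> Vs clz; apply/ler_addgt0Pr => d d0.
have [y [Vy zy]] := clz _ (nbhsx_ballx z d d0).
move: (Vs y Vy) zy; rewrite !ballEmdist /= => xy zy.
by rewrite (le_trans (metric_triangle x y z))// lerD// ?ltW// metric_sym.
Qed.

Lemma om_le1 V x (A : set (borel T)) : adm V -> measurable A -> om V x A <= 1.
Proof.
move=> aV mA; apply: (le_trans _ (hs_om_le1 H x aV)).
by apply: le_measure; rewrite ?inE.
Qed.

Lemma om_fin V x (A : set (borel T)) : adm V -> measurable A ->
  om V x A \is a fin_num.
Proof.
by move=> aV mA; rewrite ge0_fin_numE// (le_lt_trans (om_le1 x aV mA))// ltry.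
Qed.

(** A jump rate of at least [c / phi s] into [F] during the whole stay in [V] cannot produce an exit
    probability above 1. This bounds the mean exit time and in particular makes it finite. *)
Lemma e_bound V x (F : set (borel T)) (c s : R) : adm V -> V x -> measurable F ->
  F `&` closure V = set0 -> (0 < c)%R -> (0 < s)%R ->
  (forall y, V y -> (c / phi s)%:E <= N y F) ->
  exists E, [/\ e V x = E%:E, (0 < E)%R, (c * E / phi s <= fine (om V x F))%R &
    (c * E <= phi s)%R].
Proof.
move=> aV Vx mF FV c0 s0 cN.
have p0 := hs_phi_gt0 H s0; have cp0 : (0 < c / phi s)%R by rewrite divr_gt0.
have := hs_om_levy_ge H aV Vx mF FV (ltW cp0) cN.
have := hs_e_gt0 H aV Vx; have := om_le1 x aV mF; have := om_fin x aV mF.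
case: (e V x) => [E| |] // + + + +.
  move=> /fineK <-; rewrite lte_fin -EFinM !lee_fin => p1 E0 cE.
  exists E; split => //; first by rewrite mulrAC.
  move: cE => /le_trans/(_ p1); rewrite mulrAC ler_pdivrMr// mul1r.
  exact.
by move=> fp _ _; rewrite gt0_muley ?lte_fin// leye_eq => /eqP E; rewrite E in fp.
Qed.

(** If the mean exit time is at most [phi s / (16 * Q)], the tail bound shows that the exit position
    is outside [ball x s] with probability at most 1/2. Otherwise the Lévy lower bound puts mass at
    least [c / (16 * Q)] on [F], which is missing from the rest. *)
Lemma near_exit V x (F : set (borel T)) (c s : R) : adm V -> V x -> measurable F ->
  F `&` closure V = set0 -> F `<=` ~` ball x s -> (0 < c)%R -> (0 < s <= r)%R ->
  (forall y, V y -> (c / phi s)%:E <= N y F) ->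
  om V x (~` ball x s `\` F) <= (Num.max (1 / 2) (1 - c / (16 * Q)))%:E.
Proof.
move=> aV Vx mF FV Fs c0 /andP[s0 sr] cN.
have p0 := hs_phi_gt0 H s0.
have [E [eE E0 cE _]] := e_bound aV Vx mF FV c0 s0 cN.
have mB : measurable (~` ball x s : set (borel T)).
  by apply: measurableC; exact: measurable_ball_borel.
have Q0 : (0 < Q)%R by exact: lt_le_trans Q1.
(* This makes the first term of the tail bound 1/4; the threshold of the case distinction makes the
   second at most 1/4. *)
pose t := (phi s / (4 * Q))%R.
have t0 : (0 < t)%R by rewrite divr_gt0// mulr_gt0.
have mD : measurable (~` ball x s `\` F : set (borel T)) by exact: measurableD.
rewrite -(fineK (om_fin x aV mD)) lee_fin le_max.
have [small|big] := leP (E / phi s)%R (1 / (16 * Q))%R.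
  apply/orP; left; rewrite -lee_fin fineK ?om_fin//.
  apply: (@le_trans _ _ (om V x (~` ball x s))).
    by apply: le_measure; rewrite ?inE//; exact: subIsetl.
  apply: (le_trans (hs_om_tail H x aV s0 sr t0)); rewrite eE -EFinM -EFinD lee_fin.
  have -> : (Q * t / phi s = 1 / 4)%R by rewrite /t; field; rewrite !gt_eqF.
  have -> : (t^-1 * E = 4 * Q * (E / phi s))%R by rewrite /t; field; rewrite !gt_eqF.
  have : (4 * Q * (E / phi s) <= 4 * Q * (1 / (16 * Q)))%R.
    by rewrite ler_pM2l// mulr_gt0.
  have -> : (4 * Q * (1 / (16 * Q)) = 1 / 4)%R by field; rewrite gt_eqF.
  lra.
apply/orP; right.
have : (fine (om V x (~` ball x s `\` F)) + fine (om V x F) <= 1)%R.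
  rewrite -lee_fin EFinD !fineK ?om_fin//.
  rewrite -measureU//; first by apply: om_le1 => //; exact: measurableU.
  by rewrite setDE -setIA setICl setI0.
have : (c / (16 * Q) <= c * E / phi s)%R.
  by rewrite -!mulrA ler_pM2l// -[leLHS]mul1r ltW.
by lra.
Qed.

Section far.
Variables (k1 : R) (h : T -> \bar R).
Hypothesis k10 : (0 < k1)%R.
Hypothesis mh : measurable_fun setT (h : borel T -> \bar R).
Hypothesis h0 : forall z, 0 <= h z.
Hypothesis h1 : forall z, h z <= 1.

Definition far_set : set T := ~` ball xi (k1 * r).
Definition far_mass : \bar R := \int[N xi]_(z in (far_set : set (borel T))) h z.

Lemma measurable_far_set : measurable (far_set : set (borel T)).
Proof. by apply: measurableC; exact: measurable_ball_borel. Qed.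

Let k1r : (0 < k1 * r)%R. Proof. by rewrite mulr_gt0// (hs_r H). Qed.

Let Q0 : (0 < Q)%R. Proof. exact: lt_le_trans Q1. Qed.

Lemma N_far_fin (B : set (borel T)) : measurable B -> B `<=` far_set ->
  N xi B \is a fin_num.
Proof.
move=> mB BF; rewrite ge0_fin_numE//.
apply: (@le_lt_trans _ _ (Q / phi (k1 * r))%:E); last by rewrite ltry.
apply: (le_trans _ (hs_N_tail H xi k1r)).
apply: le_measure; rewrite ?inE//; exact: measurable_far_set.
Qed.

Lemma far_mass_fin : far_mass \is a fin_num.
Proof.
rewrite ge0_fin_numE; last exact: integral_ge0.
apply: (@le_lt_trans _ _ (\int[N xi]_(z in (far_set : set (borel T))) 1)).
  by apply: ge0_le_integral_nomeas.
rewrite integral_cst; last exact: measurable_far_set.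
rewrite mul1e -ge0_fin_numE//; apply: N_far_fin => //; exact: measurable_far_set.
Qed.

(** On subsets of [F] the jump kernels from all points of [V] are dominated by the kernel at [xi],
    so the Lévy bound becomes an inequality between measures, which is integrated against [h]. *)
Lemma far_upper V x (F : set (borel T)) (L E : R) : adm V -> V x -> measurable F ->
  F `<=` far_set -> F `&` closure V = set0 -> (1 <= L)%R ->
  (forall w z, V w -> F z -> (mdist xi z <= L * mdist w z)%R) ->
  e V x = E%:E -> (0 <= E)%R ->
  \int[om V x]_(z in F) h z <= (Q * L ^+ g * E)%:E * far_mass.
Proof.
move=> aV Vx mF Ff FV L1 HL eE E0.
have QL0 : (0 <= Q * L ^+ g)%R.
  by rewrite mulr_ge0 ?exprn_ge0 ?(ltW Q0)//; exact: le_trans L1.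
have FV' z : F z -> V z -> False.
  move=> Fz Vz; have : (F `&` closure V) z by split => //; exact: subset_closure.
  by rewrite FV.
apply: (@le_trans _ _ ((Q * L ^+ g * E)%:E * \int[N xi]_(z in F) h z)).
  apply: le_integral_scaled => //; first by rewrite mulr_ge0.
  move=> B mB BF.
  have Nf := N_far_fin mB (subset_trans BF Ff).
  have -> : (Q * L ^+ g * E)%:E * N xi B = (Q * L ^+ g * fine (N xi B))%:E * e V x.
    by rewrite -[in LHS](fineK Nf) eE -!EFinM mulrAC.
  apply: (hs_om_levy_le H) => //.
  - by apply/seteqP; split => z // -[/BF Fz clz]; rewrite -FV.
  - by rewrite mulr_ge0// fine_ge0.
  - move=> y Vy; rewrite EFinM fineK//; apply: (hs_N_cmp H L1 mB).
    + by move=> /BF Fy; exact: FV' Fy Vy.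
    + by move=> /BF/Ff; rewrite /far_set => /nballP; rewrite mdistxx leNgt k1r.
    + by move=> z /BF Fz; exact: HL.
apply: lee_wpmul2l; first by rewrite lee_fin mulr_ge0.
apply: ge0_subset_integral => //; first exact: measurable_far_set.
exact: measurable_funTS.
Qed.

Lemma far_lower V x (L E : R) : adm V -> V x ->
  far_set `&` closure V = set0 -> (1 <= L)%R ->
  (forall w z, V w -> far_set z -> (mdist w z <= L * mdist xi z)%R) ->
  e V x = E%:E -> (0 <= E)%R ->
  (E / (Q * L ^+ g))%:E * far_mass <= \int[om V x]_(z in far_set) h z.
Proof.
move=> aV Vx FV L1 HL eE E0.
have QL0 : (0 < Q * L ^+ g)%R.
  by rewrite mulr_gt0 ?exprn_gt0//; exact: lt_le_trans L1.
have mF := measurable_far_set.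
have FV' z : far_set z -> V z -> False.
  move=> Fz Vz; have : (far_set `&` closure V) z by split => //; exact: subset_closure.
  by rewrite FV.
have [E00|En0] := eqVneq E 0%R.
  by rewrite E00 mul0r mul0e; apply: integral_ge0.
have E1 : (0 < E)%R by rewrite lt_neqAle eq_sym En0.
rewrite -lee_pdivlMl ?divr_gt0// invf_div.
apply: le_integral_scaled => //; first by rewrite divr_ge0// ltW.
move=> B mB BF.
have Nf := N_far_fin mB BF.
rewrite -[in leRHS](fineK (om_fin x aV mB)) -[N xi B]fineK// -EFinM lee_fin.
have : (fine (N xi B) / (Q * L ^+ g) * E <= fine (om V x B))%R.
  rewrite -lee_fin EFinM -eE fineK ?om_fin//; apply: (hs_om_levy_ge H) => //.
  - by apply/seteqP; split => z // -[/BF Fz clz]; rewrite -FV.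
  - by rewrite divr_ge0// ?fine_ge0// ltW.
  - move=> y Vy; rewrite mulrC EFinM fineK// lee_pdivrMl//.
    apply: (hs_N_cmp H L1 mB).
    + by move=> /BF; rewrite /far_set => /nballP; rewrite mdistxx leNgt k1r.
    + by move=> /BF Fy; exact: FV' Fy Vy.
    + by move=> z /BF Fz; exact: HL.
by rewrite mulrAC ler_pdivrMr// mulrAC ler_pdivlMr// mulrC [X in _ -> (_ <= X)%R]mulrC.
Qed.

End far.

Lemma closure_ball_disj x s (V : set T) (F : set T) : V `<=` ball x s ->
  (forall z, F z -> (s < mdist x z)%R) -> F `&` closure V = set0.
Proof.
move=> Vs Fs; apply/seteqP; split => z // -[Fz clz].
by have := closure_ball_le Vs clz; rewrite leNgt Fs.
Qed.

(** Seen from a point of the ring, [w] is at most twice as far away as [y], so the rate at the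
    centre transfers to [w]. *)
Lemma N_ring_lower (y w : T) (s : R) : (0 < s)%R -> (s <= 2 * r)%R -> ball y s w ->
  ((Q ^+ 2 * 2 ^+ g * phi s)^-1)%:E <= N w (ball y (lam * s)%R `\` ball y s).
Proof.
move=> s0 sr yw.
have Q0 : (0 < Q)%R by exact: lt_le_trans Q1.
have p0 := hs_phi_gt0 H s0.
have mR : measurable (ball y (lam * s)%R `\` ball y s : set (borel T)).
  by apply: measurableD; exact: measurable_ball_borel.
have cmp : N y (ball y (lam * s)%R `\` ball y s) <=
    (Q * 2 ^+ g)%:E * N w (ball y (lam * s)%R `\` ball y s).
  apply: (hs_N_cmp H) => //.
  - by rewrite ler1n.
  - by move=> [_]; apply; exact: ballxx.
  - by case.
  - move=> z [_ /nballP sz]; apply: (le_trans (metric_triangle w y z)).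
    move: yw; rewrite ballEmdist /= metric_sym => yw; lra.
have := le_trans (hs_N_ring H y s0 sr) cmp.
rewrite muleC -lee_pdivrMr ?mulr_gt0 ?exprn_gt0// -EFinM => /(le_trans _); apply.
rewrite lee_fin -invfM lef_pV2 ?posrE ?mulr_gt0 ?exprn_gt0//.
by rewrite le_eqVlt; apply/orP; left; apply/eqP; ring.
Qed.

Section carleson.
Variables (D A : set T) (kap dl : R).
Hypothesis kap02 : (0 < kap < 2)%R.
(** The gap between [kap] and 2 is cut into eight layers of width [dl]. Far means beyond
    [kap + 2 * dl], the final bound holds up to [kap + 5 * dl], and the iteration stays below
    [kap + 6 * dl]; the last two layers keep the auxiliary balls inside [ball xi (2 * r)]. *)
Hypothesis kdl : (kap + 8 * dl = 2)%R.
Hypothesis oD : open D.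
Hypothesis mA : measurable (A : set (borel T)).
Hypothesis Afar : A `<=` ~` ball xi (2 * r).

Let U := D `&` ball xi (2 * r).
Let h z := om U z A.
Let k1 := (kap + 2 * dl)%R.
Let r0 : (0 < r)%R := hs_r H.
Let Q0 : (0 < Q)%R. Proof. exact: lt_le_trans Q1. Qed.
Let dl0 : (0 < dl)%R. Proof. by case/andP: kap02 => ? ?; have := kdl; lra. Qed.
Let kap0 : (0 < kap)%R. Proof. by case/andP: kap02. Qed.
Let k1_gt0 : (0 < k1)%R. Proof. by rewrite addr_gt0// mulr_gt0. Qed.

Lemma adm_ball x s : ball x s `<=` ball xi (2 * r) -> adm (D `&` ball x s).
Proof.
move=> xs; split; first by apply: openI => //; exact: metric_ball_open.
by move=> z [_]; exact: xs.
Qed.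

Let aU : adm U. Proof. exact: adm_ball. Qed.
Let mh : measurable_fun setT (h : borel T -> \bar R).
Proof. exact: (hs_om_meas H aU mA). Qed.
Let h0 z : 0 <= h z. Proof. exact: measure_ge0. Qed.
Let h1 z : h z <= 1. Proof. exact: om_le1. Qed.
Let hf z : h z \is a fin_num. Proof. exact: om_fin. Qed.
Let h_out z : ball xi (2 * r) z -> ~ D z -> h z = 0.
Proof.
move=> Bz nD; rewrite /h (hs_om_out H)//; last by case.
by rewrite indicE memNset// => /Afar.
Qed.
Let f z := fine (h z).
Let La := (phi r * fine (far_mass k1 h))%R.
Let La0 : (0 <= La)%R.
Proof.
rewrite mulr_ge0 ?(ltW (hs_phi_gt0 H r0))//; apply: fine_ge0; exact: integral_ge0.
Qed.

Let sub_ball x s (a b : R) : ball xi (a * r) x -> (a * r + s <= b * r)%R ->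
  ball x s `<=` ball xi (b * r).
Proof.
rewrite ballEmdist /= => xa ab z; rewrite !ballEmdist /= => xz.
by have := metric_triangle xi x z; lra.
Qed.

(** One jump-rate constant for both [inner_rate] and [shell_rate]; [q] is the bound that [near_exit]
    gives for it. *)
Let c0 := ((Q ^+ 4 * (4 / dl) ^+ g)^-1)%R.
Let q := (Num.max (1 / 2) (1 - c0 / (16 * Q)))%R.

Let c00 : (0 < c0)%R.
Proof. by rewrite invr_gt0 mulr_gt0 ?exprn_gt0// divr_gt0. Qed.

(** The process is stopped on leaving the part of [ball x s] in [D]. Exits outside [F] have mass at
    most [q] and meet values at most [M]. Jumps into [F] contribute the mean exit time times the far
    mass, and by [e_bound] and s <= r this is a multiple of [La] depending on [s] only through
    [L]. *)
Lemma carleson_step x s M L (F := far_set k1 `\` ball x (2 * s)) : D x ->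
  (0 < s <= r)%R -> ball x s `<=` ball xi (2 * r) ->
  (forall w, ball x s w -> (c0 / phi s)%:E <= N w F) ->
  (forall z, ~ F z -> ball xi (2 * r) z /\ (D z -> (f z <= M)%R)) ->
  (0 <= M)%R -> (1 + 2 * r / s <= L)%R ->
  (f x <= q * M + Q * L ^+ g / c0 * La)%R.
Proof.
move=> Dx /andP[s0 sr] xs cN near M0 HL.
pose V := D `&` ball x s; have aV : adm V by exact: adm_ball.
have Vx : V x by split => //; exact: ballxx.
have Vball : V `<=` ball x s by move=> z [].
have VU : V `<=` U by move=> z [Dz /xs].
have rs0 : (0 < 2 * r / s)%R by rewrite divr_gt0// mulr_gt0.
have L1 : (1 <= L)%R by lra.
have mF : measurable (F : set (borel T)).
  by apply: measurableD; [exact: measurable_far_set|exact: measurable_ball_borel].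
have Ffar : F `<=` far_set k1 by move=> z [].
have Fs z : F z -> (2 * s <= mdist x z)%R by move=> [_ /nballP].
have FV : F `&` closure V = set0.
  by apply: (closure_ball_disj Vball) => z /Fs; lra.
have FB : F `<=` ~` ball x s by move=> z /Fs; move=> ? /ballP; lra.
have cNV w : V w -> (c0 / phi s)%:E <= N w F by move=> [_]; exact: cN.
have [E [eE E0 _ cE]] := e_bound aV Vx mF FV c00 s0 cNV.
have sr0 : (0 < s <= r)%R by rewrite s0.
have nearq := near_exit aV Vx mF FV FB c00 sr0 cNV.
have farE : \int[om V x]_(z in F) h z <= (Q * L ^+ g * E)%:E * far_mass k1 h.
  have k10 := k1_gt0.
  apply: (far_upper k10 mh h0 aV Vx mF Ffar FV L1 _ eE (ltW E0)).
  (* Points of [F] are at distance at least s from w, so d(xi, z) <= 2 r + d(w, z) <= (2 r / s + 1)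
     d(w, z). *)
  move=> w z [_ /ballP xw] Fz.
  have wz : (s <= mdist w z)%R by have := Fs z Fz; have := metric_triangle x w z; lra.
  have xiw : (mdist xi w < 2 * r)%R by have /xs := (ballP x w s).2 xw; rewrite ballEmdist.
  apply: (@le_trans _ _ ((1 + 2 * r / s) * mdist w z)%R); last first.
    by rewrite ler_wpM2r// mdist_ge0.
  have : (2 * r <= 2 * r / s * mdist w z)%R.
    by rewrite mulrAC ler_pdivlMr// ler_pM2l// mulr_gt0.
  by have := metric_triangle xi w z; lra.
have mS : measurable (~` ball x s `\` F : set (borel T)).
  apply: measurableD => //; apply: measurableC; exact: measurable_ball_borel.
have hx : h x <= M%:E * om V x (~` ball x s `\` F) + \int[om V x]_(z in F) h z.
  rewrite /h (hs_om_markov H x aV aU VU mA) -/h.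
  apply: (@le_trans _ _ (\int[om V x]_z
      (M%:E * (\1_(~` ball x s `\` F) z)%:E + (h \_ F) z))); last first.
    rewrite ge0_integralD//; last 4 first.
    - by move=> z _; rewrite mule_ge0// lee_fin.
    - by apply: measurable_funeM; apply/measurable_EFinP; exact: measurable_indic.
    - by move=> z _; exact: erestrict_ge0.
    - by apply/(measurable_restrictT _ mF); exact: measurable_funTS.
    rewrite ge0_integralZl_EFin//; last 1 first.
    - by apply/measurable_EFinP; exact: measurable_indic.
    by rewrite integral_indic// setIT -integral_mkcond.
  apply: (@le_integral_off _ (borel T) R (om V x) V h) => //.
  - by apply: sub_sigma_algebra; case: aV.
  - exact: (hs_om_self H).
  - apply: emeasurable_funD.
      by apply: measurable_funeM; apply/measurable_EFinP; exact: measurable_indic.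
    by apply/(measurable_restrictT _ mF); exact: measurable_funTS.
  - move=> z; apply: adde_ge0; first by rewrite mule_ge0// lee_fin.
    exact: erestrict_ge0.
  move=> z nVz; rewrite patchE.
  have [Fz|nF] := pselect (F z).
    rewrite mem_set//; apply: leeDr; by rewrite mule_ge0// lee_fin.
  rewrite memNset// adde0.
  have [Bz nearz] := near z nF.
  have [Dz|nD] := pselect (D z); last first.
    by rewrite h_out// mule_ge0// lee_fin.
  have xz : ~ ball x s z by move=> xz; apply: nVz.
  rewrite indicE mem_set// mule1 -(fineK (hf z)) lee_fin.
  exact: nearz.
rewrite -lee_fin fineK//; apply: (le_trans hx); rewrite EFinD; apply: leeD.
  by rewrite mulrC EFinM; apply: lee_wpmul2l; rewrite // lee_fin.
apply: (le_trans farE).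
rewrite -(fineK (far_mass_fin k1_gt0 h0 h1)).
rewrite -EFinM lee_fin /La -!mulrA ler_pM2l// ler_pM2l; last first.
  by rewrite exprn_gt0//; lra.
rewrite mulrA; apply: ler_wpM2r; first by apply: fine_ge0; exact: integral_ge0.
rewrite mulrC ler_pdivlMr// mulrC; apply: (le_trans cE).
exact: (hs_phi_le H).
Qed.

Variable th : R.
Hypothesis th01 : (0 < th < 1)%R.
(** The step radii shrink like th^j, so the far term may grow by th^-g from one step to the next.
    The hypothesis keeps [q] times this growth at most 2 q / (1 + q) < 1. *)
Hypothesis thq : ((1 + q) / 2 <= th ^+ g)%R.

Let th0 : (0 < th)%R. Proof. by case/andP: th01. Qed.
Let th1 : (th < 1)%R. Proof. by case/andP: th01. Qed.

Let q01 : (1 / 2 <= q < 1)%R.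
Proof.
rewrite /q le_max lexx /= gt_max; apply/andP; split; first by lra.
by rewrite gtrBl divr_gt0// mulr_gt0.
Qed.

Let lam0 : (0 < lam)%R. Proof. by have := lam2; lra. Qed.
Let dlr : (0 < dl * r)%R. Proof. exact: mulr_gt0. Qed.
Let kapr : (0 < kap * r)%R. Proof. exact: mulr_gt0. Qed.
Let kdlr : (kap * r + 8 * (dl * r) = 2 * r)%R. Proof. by rewrite -kdl; ring. Qed.
Let dlV : (0 < dl^-1)%R. Proof. by rewrite invr_gt0. Qed.
Let two_dl : (0 < 2 / dl)%R. Proof. exact: mulr_gt0. Qed.
Let four_dl : (0 < 4 / dl)%R. Proof. exact: mulr_gt0. Qed.
Let dl_le : (dl <= 1 / 4)%R. Proof. by have := kap0; have := kdl; lra. Qed.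

(** Up to a factor th^-j this bounds the ratio [L] of [carleson_step]: the shell radius gives 2 r /
    s = 4 lam / (dl (1 - th)) th^-j, and the additional 1 costs at most a quarter of that. *)
Definition carleson_ratio : R := (5 * lam / (dl * (1 - th)))%R.
(** The solution K of K = q K 2 / (1 + q) + B, where B is the product of the factors before the last
    one. *)
Definition carleson_const : R :=
  (Q * carleson_ratio ^+ g / c0 * ((1 + q) / (1 - q)))%R.

(** Radii increasing from [kap + 5 * dl] towards [kap + 6 * dl]: the estimate at one radius uses
    values at the next. *)
Let t (j : nat) : R := (kap + 6 * dl - dl * th ^+ j)%R.

Let c0_ring (w : T) s : (0 < s)%R -> (s <= 2 * r)%R ->
  (phi s <= Q * (2 / dl) ^+ g * phi (dl * s / 2))%R.
Proof.
move=> s0 sr; have -> : s = (2 / dl * (dl * s / 2))%R by field; rewrite gt_eqF.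
rewrite [X in (_ <= _ * phi (dl * X / 2))%R](_ : _ = s); last by field; rewrite gt_eqF.
apply: (hs_phi_dbl H); last by rewrite divr_gt0// mulr_gt0.
by rewrite ler_pdivlMr// mul1r; have := dl_le; lra.
Qed.

Let ratio1 : (1 <= lam / (dl * (1 - th)))%R.
Proof.
have d1 : (0 < 1 - th)%R by rewrite subr_gt0.
rewrite ler_pdivlMr; last exact: mulr_gt0.
rewrite mul1r; apply: (@le_trans _ _ 1%R); last by have := lam2; lra.
rewrite -[leRHS]mulr1; apply: ler_pM; rewrite ?ltW//.
  by have := dl_le; lra.
by have := th0; lra.
Qed.

Let ratio0 : (0 < carleson_ratio)%R.
Proof. by rewrite /carleson_ratio -mulrA mulr_gt0// (lt_le_trans _ ratio1). Qed.

Let B0 := (Q * carleson_ratio ^+ g / c0)%R.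
Let B00 : (0 < B0)%R.
Proof. by rewrite divr_gt0// mulr_gt0// exprn_gt0. Qed.

Let Tt := (th^-1 ^+ g)%R.
Let Tt0 : (0 < Tt)%R. Proof. by rewrite exprn_gt0// invr_gt0. Qed.

Let const_fix : (q * carleson_const * Tt + B0 <= carleson_const)%R.
Proof.
have [q12 q1] := andP q01.
have T2 : (Tt <= 2 / (1 + q))%R.
  rewrite /Tt exprVn -[leRHS]invrK lef_pV2 ?posrE ?exprn_gt0//; last first.
    by rewrite invr_gt0 divr_gt0//; lra.
  by rewrite invf_div.
have q1n : (0 < 1 - q)%R by lra.
have K0 : (0 < q * carleson_const)%R.
  rewrite mulr_gt0//; first by lra.
  by rewrite /carleson_const -/B0 mulr_gt0// divr_gt0//; lra.
apply: (@le_trans _ _ (q * carleson_const * (2 / (1 + q)) + B0)%R).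
  by rewrite lerD2r ler_pM2l.
rewrite le_eqVlt; apply/orP; left; apply/eqP.
by rewrite /carleson_const -/B0; field; rewrite !gt_eqF//; lra.
Qed.

Let const0 : (0 <= carleson_const)%R.
Proof.
have [q12 q1] := andP q01.
by rewrite /carleson_const mulr_ge0 ?(ltW B00)// divr_ge0//; lra.
Qed.

Let thj j : (0 < th ^+ j <= 1)%R.
Proof. by rewrite exprn_gt0//= exprn_ile1// ltW. Qed.

(* Far from the boundary of [ball xi (2 * r)]: a ball of radius [dl * r], and
   jumps beyond [ball xi (2 * r)]. *)
Let inner_rate y w : ball xi ((kap + 3 * dl) * r) y -> ball y (dl * r) w ->
  (c0 / phi (dl * r))%:E <= N w (far_set k1 `\` ball y (2 * (dl * r))).
Proof.
move=> yin yw.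
have wB : ball xi (2 * r) w.
  move: yin yw; rewrite !ballEmdist /= => yin yw.
  have := metric_triangle xi y w; have := kdlr; have := dlr; lra.
have r20 : (0 < 2 * r)%R by rewrite mulr_gt0.
have := N_ring_lower r20 (lexx _) wB => rl.
apply: (le_trans _ (le_trans rl _)); last first.
  apply: le_measure; rewrite ?inE.
  - by apply: measurableD; exact: measurable_ball_borel.
  - by apply: measurableD; [exact: measurable_far_set|exact: measurable_ball_borel].
  move=> z [_ /nballP z2]; split; first by apply/nballP; rewrite /k1; have := kdlr; have := dlr; lra.
  apply/nballP; move: yin; rewrite ballEmdist /= => yin.
  have := metric_triangle xi y z; have := kdlr; have := dlr; lra.
have pd := hs_phi_gt0 H dlr; have p2 := hs_phi_gt0 H r20.
rewrite lee_fin /c0 -invfM lef_pV2 ?posrE ?mulr_gt0 ?exprn_gt0//.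
have := c0_ring xi r20 (lexx _).
rewrite (_ : dl * (2 * r) / 2 = dl * r)%R; last by field.
move=> pp; apply: (@le_trans _ _ (Q ^+ 2 * 2 ^+ g * (Q * (2 / dl) ^+ g * phi (dl * r)))%R).
  by rewrite ler_pM2l// mulr_gt0 ?exprn_gt0.
have -> : (4 / dl = 2 * (2 / dl) :> R)%R by field; rewrite gt_eqF.
rewrite [in leRHS]exprMn.
have -> : (Q ^+ 2 * 2 ^+ g * (Q * (2 / dl) ^+ g * phi (dl * r)) =
  Q ^+ 3 * (2 ^+ g * (2 / dl) ^+ g) * phi (dl * r))%R by ring.
rewrite ler_pM2r// ler_pM2r ?mulr_gt0 ?exprn_gt0//.
by rewrite [leRHS]exprS ler_peMl ?exprn_ge0// ltW.
Qed.

(** Here the ball must be small, and the target has to be at the same scale: it is the ring around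
    [y] with radii 2 s and 2 lam s, which stays outside [ball xi (k1 * r)] because 2 lam s <= dl
    r. *)
Let shell_rate y w s : (0 < s)%R -> (2 * lam * s <= dl * r)%R ->
  ~ ball xi ((kap + 3 * dl) * r) y -> ball y s w ->
  (c0 / phi s)%:E <= N w (far_set k1 `\` ball y (2 * s)).
Proof.
move=> s0 sdl /nballP yout yw.
have s20 : (0 < 2 * s)%R by rewrite mulr_gt0.
have ls : (4 * s <= 2 * lam * s)%R by rewrite ler_pM2r//; have := lam2; lra.
have s2r : (2 * s <= 2 * r)%R.
  have : (dl * r <= 1 / 4 * r)%R by rewrite ler_pM2r.
  by have := r0; lra.
have yw2 : ball y (2 * s) w by move: yw; rewrite !ballEmdist /=; lra.
have := N_ring_lower s20 s2r yw2 => rl.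
apply: (le_trans _ (le_trans rl _)); last first.
  apply: le_measure; rewrite ?inE.
  - by apply: measurableD; exact: measurable_ball_borel.
  - by apply: measurableD; [exact: measurable_far_set|exact: measurable_ball_borel].
  move=> z [/ballP z1 z2]; split => //; apply/nballP.
  have := metric_triangle xi z y; rewrite (metric_sym z y) /k1.
  have := kdlr; have := dlr; lra.
have ps := hs_phi_gt0 H s0; have p2 := hs_phi_gt0 H s20.
rewrite lee_fin /c0 -invfM lef_pV2 ?posrE ?mulr_gt0 ?exprn_gt0//.
have pp : (phi (2 * s) <= Q * 2 ^+ g * phi s)%R by apply: (hs_phi_dbl H) => //; lra.
apply: (@le_trans _ _ (Q ^+ 2 * 2 ^+ g * (Q * 2 ^+ g * phi s))%R).
  by rewrite ler_pM2l// mulr_gt0 ?exprn_gt0.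
have -> : (Q ^+ 2 * 2 ^+ g * (Q * 2 ^+ g * phi s) = Q ^+ 3 * (2 * 2) ^+ g * phi s)%R.
  by rewrite exprMn; ring.
rewrite ler_pM2r//; apply: ler_pM; rewrite ?exprn_ge0 ?(ltW Q0)//.
- by rewrite [leRHS]exprS ler_peMl ?exprn_ge0// ltW.
- have le4 : (2 * 2 <= 4 / dl :> R)%R.
    by rewrite ler_pdivlMr//; have := dl_le; lra.
  have ge4 : (0 <= 2 * 2 :> R)%R by lra.
  by apply: lerXn2r => //; rewrite nnegrE ?(ltW four_dl).
Qed.

(** Induction on [n] for all [j] at once: one application of [carleson_step] lowers [n] by one and
    moves to the radius [t j.+1]. The remainder q^n starts from the trivial bound f <= 1 and
    vanishes as n grows with j fixed. *)
Let carleson_iter n j y : D y -> ball xi (t j * r) y ->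
  (f y <= carleson_const * Tt ^+ j * La + q ^+ n)%R.
Proof.
have [q12 q1] := andP q01.
have q0 : (0 <= q)%R by lra.
elim: n j y => [|n IH] j y Dy yj.
  have f1 : (f y <= 1)%R by rewrite -lee_fin fineK.
  by rewrite expr0 (le_trans f1)// lerDr mulr_ge0// mulr_ge0// exprn_ge0// ltW.
pose M := (carleson_const * Tt ^+ j.+1 * La + q ^+ n)%R.
have M0 : (0 <= M)%R.
  rewrite addr_ge0 ?exprn_ge0// mulr_ge0// mulr_ge0// exprn_ge0//.
  exact: ltW.
have [tj0 tj1] := andP (thj j).
have tS : (t j.+1 = t j + dl * th ^+ j * (1 - th))%R by rewrite /t exprS; ring.
have gap0 : (0 <= dl * th ^+ j * (1 - th))%R.
  by rewrite mulr_ge0// ?subr_ge0 ?(ltW th1)// mulr_ge0// ltW.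
have t_lo : (kap * r + 5 * (dl * r) <= t j.+1 * r)%R.
  have -> : (kap * r + 5 * (dl * r) = (kap + 5 * dl) * r)%R by ring.
  rewrite ler_pM2r// /t.
  have [_ tj1'] := andP (thj j.+1).
  have : (dl * th ^+ j.+1 <= dl * 1)%R by rewrite ler_pM2l.
  by lra.
have t_hi i : (t i * r <= kap * r + 6 * (dl * r))%R.
  have -> : (kap * r + 6 * (dl * r) = (kap + 6 * dl) * r)%R by ring.
  rewrite ler_pM2r// /t gerBl mulr_ge0 ?(ltW dl0)//.
  by have [/ltW] := andP (thj i).
have fin (P : R) : (P <= q * M + Q * (carleson_ratio * th^-1 ^+ j) ^+ g / c0 * La)%R ->
    (P <= carleson_const * Tt ^+ j * La + q ^+ n.+1)%R.
  move=> /le_trans; apply.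
  have -> : ((carleson_ratio * th^-1 ^+ j) ^+ g = carleson_ratio ^+ g * Tt ^+ j)%R.
    by rewrite exprMn /Tt -!exprM mulnC.
  have : ((q * carleson_const * Tt + B0) * (Tt ^+ j * La) <=
      carleson_const * (Tt ^+ j * La))%R.
    by apply: ler_wpM2r => //; rewrite mulr_ge0// exprn_ge0// ltW.
  have -> : (q * M + Q * (carleson_ratio ^+ g * Tt ^+ j) / c0 * La =
    (q * carleson_const * Tt + B0) * (Tt ^+ j * La) + q ^+ n.+1)%R.
    by rewrite /M /B0 !exprS; ring.
  by move=> ?; rewrite lerD2r -[leRHS]mulrA.
(* A point outside the target is in [ball xi (k1 * r)] or in [ball y (2 * s)]; either way it is
   inside the next radius, where the induction hypothesis applies. *)
have near s z : (t j * r + 2 * s <= t j.+1 * r)%R \/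
    (ball xi ((kap + 3 * dl) * r) y /\ s = dl * r)%R ->
    ~ (far_set k1 `\` ball y (2 * s)) z ->
    ball xi (2 * r) z /\ (D z -> (f z <= M)%R).
  move=> cases nF.
  suff zj : ball xi (t j.+1 * r) z.
    split; last by move=> Dz; exact: IH.
    move: zj; rewrite !ballEmdist /=; have := t_hi j.+1; have := kdlr; have := dlr; lra.
  have [z1|z1] := pselect (ball xi (k1 * r) z).
    by move: z1; rewrite !ballEmdist /= /k1; have := kdlr; have := dlr; lra.
  have z2 : ball y (2 * s) z by apply: contrapT => z2; apply: nF.
  move: z2; rewrite !ballEmdist /= => z2.
  have := metric_triangle xi y z.
  case: cases => [ss|[yin ->]] in z2 *.
    by move: yj; rewrite ballEmdist /=; lra.
  by move: yin; rewrite ballEmdist /=; have := kdlr; have := dlr; lra.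
have [yin|yout] := pselect (ball xi ((kap + 3 * dl) * r) y).
  apply: fin; apply: (carleson_step (s := (dl * r)%R)) => //.
  - by rewrite dlr /= -[leRHS]mul1r ler_pM2r//; have := dl_le; lra.
  - apply: (sub_ball yin); have := kdlr; have := dlr; lra.
  - by move=> w; exact: inner_rate.
  - by move=> z; apply: near; right.
  - have -> : (2 * r / (dl * r) = 2 / dl)%R by field; rewrite !gt_eqF.
    have th1j : (1 <= th^-1 ^+ j)%R by rewrite exprn_ege1// invf_ge1// ltW.
    apply: (@le_trans _ _ carleson_ratio); last by rewrite ler_peMr// ltW.
    have d2 : (2 / dl <= lam / (dl * (1 - th)))%R.
      rewrite ler_pdivlMr; last by rewrite mulr_gt0// subr_gt0.
      have -> : (2 / dl * (dl * (1 - th)) = 2 * (1 - th))%R by field; rewrite gt_eqF.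
      by have := lam2; have := th0; lra.
    by rewrite /carleson_ratio -mulrA; have := ratio1; lra.
(* Chosen so that 2 lam s is the gap (t j.+1 - t j) r. This is at most dl r, as [shell_rate]
   requires, and leaves room for [ball y (2 * s)]. *)
pose s := (dl * (1 - th) * th ^+ j * r / (2 * lam))%R.
have gapr0 : (0 < dl * (1 - th) * th ^+ j * r)%R by rewrite !mulr_gt0// subr_gt0.
have s0 : (0 < s)%R by rewrite divr_gt0// mulr_gt0.
have sE : (2 * lam * s = dl * (1 - th) * th ^+ j * r)%R.
  by rewrite /s; field; rewrite gt_eqF.
have sgap : (2 * lam * s <= dl * r)%R.
  rewrite sE ler_pM2r// -mulrA -[leRHS]mulr1 ler_pM2l// mulr_ile1 ?subr_ge0 ?(ltW tj0) ?(ltW th1)//.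
  by rewrite gerBl ltW.
have ls : (4 * s <= 2 * lam * s)%R by rewrite ler_pM2r//; have := lam2; lra.
have tgap : (t j * r + 2 * s <= t j.+1 * r)%R.
  rewrite tS (mulrDl (t j)) lerD2l.
  have -> : (dl * th ^+ j * (1 - th) * r = 2 * lam * s)%R by rewrite sE; ring.
  lra.
have dlr4 : (dl * r <= 1 / 4 * r)%R by rewrite ler_pM2r.
apply: fin; apply: (carleson_step (s := s)) => //.
- by rewrite s0 /=; have := r0; lra.
- by apply: (sub_ball yj); have := t_hi j.+1; have := kdlr; have := dlr; lra.
- by move=> w; exact: shell_rate.
- by move=> z; apply: near; left.
- have th1j : (1 <= th^-1 ^+ j)%R by rewrite exprn_ege1// invf_ge1// ltW.
  have -> : (2 * r / s = 4 * (lam / (dl * (1 - th)) * th^-1 ^+ j))%R.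
    rewrite /s exprVn; field.
    by rewrite !gt_eqF// subr_gt0.
  have -> : (carleson_ratio * th^-1 ^+ j = 5 * (lam / (dl * (1 - th)) * th^-1 ^+ j))%R.
    by rewrite /carleson_ratio; ring.
  have : (1 * 1 <= lam / (dl * (1 - th)) * th^-1 ^+ j)%R.
    by apply: ler_pM => //; exact: ratio1.
  by lra.
Qed.

Lemma carleson y : D y -> ball xi ((kap + 5 * dl) * r) y -> (f y <= carleson_const * La)%R.
Proof.
move=> Dy yB.
have t0E : t 0 = (kap + 5 * dl)%R by rewrite /t expr0; ring.
apply/ler_addgt0Pr => d d0.
have qlt : (`|q| < 1)%R by case/andP: q01 => ? ?; rewrite ger0_norm//; lra.
have /cvgrPdist_lt/(_ d d0)[n _ /(_ n (leqnn _))] := cvg_expr qlt.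
rewrite /= sub0r normrN => qn.
have := @carleson_iter n 0%N y Dy; rewrite t0E expr0 mulr1 => /(_ yB)/le_trans; apply.
by rewrite lerD2l; apply: le_trans (ltW qn); exact: ler_norm.
Qed.

End carleson.

End core.

(** * Comparison near the boundary *)

(** The terms anticipate an exit from a small ball: [v] is the comparison function, [S1] carries the
    nearby error, [S2 m] the shells, [S3] the region of the Carleson bound, [F] the far jumps. The
    bound is asked only off [V], since the exit distribution does not charge [V]. *)
Lemma integral_bound d (U : measurableType d) (R : realType)
    (mu : {measure set U -> \bar R}) (V : set U) (h v : U -> \bar R)
    (k a b : R) (n : nat) (c : nat -> R) (S1 S3 F : set U) (S2 : nat -> set U) :
  measurable V -> mu V = 0 ->
  measurable_fun setT h -> (forall z, 0 <= h z) ->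
  measurable_fun setT v -> (forall z, 0 <= v z) ->
  measurable S1 -> (forall m, measurable (S2 m)) -> measurable S3 -> measurable F ->
  (0 <= k)%R -> (0 <= a)%R -> (0 <= b)%R -> (forall m, 0 <= c m)%R ->
  (forall z, ~ V z -> h z <= k%:E * v z + (a%:E * (\1_S1 z)%:E +
    (\sum_(m < n) (c m)%:E * (\1_(S2 m) z)%:E +
    (b%:E * (\1_S3 z)%:E + (h \_ F) z)))) ->
  \int[mu]_z h z <= k%:E * \int[mu]_z v z + (a%:E * mu S1 +
    (\sum_(m < n) (c m)%:E * mu (S2 m) + (b%:E * mu S3 + \int[mu]_(z in F) h z))).
Proof.
move=> mV V0 mh h0 mv v0 mS1 mS2 mS3 mF k0 a0 b0 c0 hb.
have mi (S : set U) : measurable S -> measurable_fun setT (fun z => (\1_S z)%:E : \bar R).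
  by move=> mS; apply/measurable_EFinP; exact: measurable_indic.
have m0 (x : R) (S : set U) z : (0 <= x)%R -> 0 <= x%:E * (\1_S z)%:E.
  by move=> x0; rewrite mule_ge0// lee_fin.
have mki (x : R) (S : set U) : measurable S -> measurable_fun setT (fun z => x%:E * (\1_S z)%:E).
  by move=> mS; apply: measurable_funeM; exact: mi.
have hF0 z : 0 <= (h \_ F) z by exact: erestrict_ge0.
have mhF : measurable_fun setT (h \_ F).
  by apply/(measurable_restrictT _ mF); exact: measurable_funTS.
have ii (x : R) (S : set U) : (0 <= x)%R -> measurable S ->
    \int[mu]_z (x%:E * (\1_S z)%:E) = x%:E * mu S.
  by move=> x0 mS; rewrite ge0_integralZl_EFin ?integral_indic ?setIT//; exact: mi.
have s0 z : 0 <= \sum_(m < n) (c m)%:E * (\1_(S2 m) z)%:E by apply: sume_ge0 => m _; exact: m0.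
have ms : measurable_fun setT (fun z => \sum_(m < n) (c m)%:E * (\1_(S2 m) z)%:E).
  by apply: emeasurable_sum => m; exact: mki.
have t1 z : 0 <= b%:E * (\1_S3 z)%:E + (h \_ F) z by apply: adde_ge0 => //; exact: m0.
have mt1 : measurable_fun setT (fun z => b%:E * (\1_S3 z)%:E + (h \_ F) z).
  by apply: emeasurable_funD => //; exact: mki.
have t2 z : 0 <= \sum_(m < n) (c m)%:E * (\1_(S2 m) z)%:E +
    (b%:E * (\1_S3 z)%:E + (h \_ F) z) by exact: adde_ge0.
have mt2 := emeasurable_funD ms mt1.
have t3 z : 0 <= a%:E * (\1_S1 z)%:E + (\sum_(m < n) (c m)%:E * (\1_(S2 m) z)%:E +
    (b%:E * (\1_S3 z)%:E + (h \_ F) z)) by apply: adde_ge0 => //; exact: m0.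
have mt3 := emeasurable_funD (mki a S1 mS1) mt2.
have kv0 z : 0 <= k%:E * v z by rewrite mule_ge0.
have mkv : measurable_fun setT (fun z => k%:E * v z) by exact: measurable_funeM.
apply: (le_trans (le_integral_off mV V0 mh h0 (emeasurable_funD mkv mt3) _ hb)).
  by move=> z; exact: adde_ge0.
rewrite ge0_integralD// ge0_integralZl_EFin//.
rewrite ge0_integralD//; [|by move=> z _; exact: m0|exact: mki].
rewrite ii// ge0_integralD// ge0_integral_sum//; last 2 first.
- by move=> m; exact: mki.
- by move=> m z _; exact: m0.
rewrite ge0_integralD//; [|by move=> z _; exact: m0|exact: mki].
rewrite ii// -integral_mkcond.
by under eq_bigr do rewrite ii//.
Qed.

Lemma first_exit_index (P : nat -> Prop) n : P 0%N -> ~ P n ->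
  exists m, [/\ (m < n)%N, P m & ~ P m.+1].
Proof.
elim: n => [//|n IH] P0 nP; have [Pn|nPn] := pselect (P n).
  by exists n; split.
by have [m [mn Pm nPm]] := IH P0 nPn; exists m; split => //; exact: ltnW.
Qed.

Lemma sum_half (R : realType) n : (\sum_(m < n) (2^-1) ^+ m <= 2 :> R)%R.
Proof.
suff -> : (\sum_(m < n) (2^-1) ^+ m = 2 - 2 * (2^-1) ^+ n :> R)%R.
  by rewrite gerBl mulr_ge0// exprn_ge0.
elim: n => [|n IH]; first by rewrite big_ord0 expr0; ring.
by rewrite big_ord_recr /= IH exprS; field.
Qed.

Section boundary.
Context {R : realType} {Q lam : R} {g : nat}.
Hypotheses (Q1 : (1 <= Q)%R) (lam2 : (2 <= lam)%R).
Context {T : pmetricType R} {N : T -> {measure set (borel T) -> \bar R}}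
  {om : set T -> T -> {measure set (borel T) -> \bar R}}
  {e : set T -> T -> \bar R} {phi : R -> R} {xi : T} {r : R}.
Hypothesis H : harmonic_setting Q lam g N om e phi xi r.

Let adm (V : set T) := open V /\ V `<=` ball xi (2 * r).
Let Q0 : (0 < Q)%R. Proof. exact: lt_le_trans Q1. Qed.
Let r0 : (0 < r)%R := hs_r H.
Let pr : (0 < phi r)%R := hs_phi_gt0 H r0.

(** Leaving [ball xi (rho * r)] directly from [V] takes a jump of length at least sg r, whose rate
    is at most [Q / phi (sg * r)]; doubling brings this back to scale r. *)
Lemma exit_beyond V x rho sg E : adm V -> V x -> (0 < sg <= 1)%R ->
  V `<=` ball xi (rho * r - sg * r) -> e V x = E%:E -> (0 <= E)%R ->
  om V x (~` ball xi (rho * r)) <= (Q ^+ 2 * sg^-1 ^+ g * (E / phi r))%:E.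
Proof.
move=> aV Vx /andP[sg0 sg1] Vb eE E0.
have sgr : (0 < sg * r)%R by rewrite mulr_gt0.
have psg := hs_phi_gt0 H sgr.
have mB : measurable (~` ball xi (rho * r) : set (borel T)).
  by apply: measurableC; exact: measurable_ball_borel.
have -> : ((Q ^+ 2 * sg^-1 ^+ g * (E / phi r))%:E = (Q ^+ 2 * sg^-1 ^+ g / phi r)%:E * e V x)%E.
  by rewrite eE -EFinM; congr EFin; ring.
apply: (hs_om_levy_le H) => //.
- by apply: (closure_ball_disj Vb) => z /nballP; lra.
- by rewrite divr_ge0 ?(ltW pr)// mulr_ge0 ?exprn_ge0 ?invr_ge0 ?(ltW Q0) ?(ltW sg0).
move=> y Vy.
apply: (@le_trans _ _ (N y (~` ball y (sg * r)))).
  apply: le_measure; rewrite ?inE//.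
    by apply: measurableC; exact: measurable_ball_borel.
  move=> z /nballP xz; apply/nballP.
  have := Vb y Vy; rewrite ballEmdist /=; have := metric_triangle xi y z; lra.
apply: (le_trans (hs_N_tail H y sgr)); rewrite lee_fin.
rewrite ler_pdivrMr// mulrAC ler_pdivlMr//.
have := @hs_phi_dbl _ _ _ _ _ _ _ _ _ _ _ H sg^-1%R (sg * r)%R.
rewrite mulKf ?gt_eqF// => /(_ _ sgr); rewrite invf_ge1// => /(_ sg1).
by rewrite expr2 -!mulrA ler_pM2l.
Qed.

Variables (D A : set T) (kap dl K1 : R).
Hypothesis kap02 : (0 < kap < 2)%R.
Hypothesis kdl : (kap + 8 * dl = 2)%R.
Hypothesis oD : open D.
Hypothesis mA : measurable (A : set (borel T)).
Hypothesis Afar : A `<=` ~` ball xi (2 * r).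

Let U := D `&` ball xi (2 * r).
Let h z := om U z A.
Let k1 := (kap + 2 * dl)%R.
Let f z := fine (h z).
Let La := (phi r * fine (far_mass (N := N) (xi := xi) (r := r) k1 h))%R.
Hypothesis K10 : (0 <= K1)%R.
Hypothesis carl : forall y, D y -> ball xi ((kap + 5 * dl) * r) y -> (f y <= K1 * La)%R.

Let dl0 : (0 < dl)%R. Proof. by case/andP: kap02 => ? ?; have := kdl; lra. Qed.
Let kap0 : (0 < kap)%R. Proof. by case/andP: kap02. Qed.
Let dlr : (0 < dl * r)%R. Proof. exact: mulr_gt0. Qed.
Let kapr : (0 < kap * r)%R. Proof. exact: mulr_gt0. Qed.
Let kdlr : (kap * r + 8 * (dl * r) = 2 * r)%R. Proof. by rewrite -kdl; ring. Qed.
Let dl_le : (dl <= 1 / 4)%R. Proof. by have := kap0; have := kdl; lra. Qed.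
Let k10 : (0 < k1)%R. Proof. by rewrite addr_gt0// mulr_gt0. Qed.

Let aU : adm U. Proof. exact: adm_ball. Qed.
Let mh : measurable_fun setT (h : borel T -> \bar R).
Proof. exact: (hs_om_meas H aU mA). Qed.
Let h0 z : 0 <= h z. Proof. exact: measure_ge0. Qed.
Let h1 z : h z <= 1. Proof. exact: (om_le1 H). Qed.
Let hf z : h z \is a fin_num. Proof. exact: (om_fin H). Qed.
Let h_out z : ball xi (2 * r) z -> ~ D z -> h z = 0.
Proof.
move=> Bz nD; rewrite /h (hs_om_out H)//; last by case.
by rewrite indicE memNset// => /Afar.
Qed.
Let La0 : (0 <= La)%R.
Proof. by rewrite mulr_ge0 ?(ltW pr)//; apply: fine_ge0; exact: integral_ge0. Qed.

Let W := D `&` ball xi ((kap + dl) * r).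
Let ring := ball xi (lam * (2 * r)) `\` ball xi (2 * r).
Let u z := om W z ring.

Let aW : adm W.
Proof.
apply: adm_ball => // z; rewrite !ballEmdist /=; have := kdlr; have := dlr; lra.
Qed.
Let mring : measurable (ring : set (borel T)).
Proof. by apply: measurableD; exact: measurable_ball_borel. Qed.
Let mu_ : measurable_fun setT (u : borel T -> \bar R).
Proof. exact: (hs_om_meas H aW mring). Qed.
Let u0 z : 0 <= u z. Proof. exact: measure_ge0. Qed.
Let uf z : u z \is a fin_num. Proof. exact: (om_fin H). Qed.

Let c1 := (Q ^+ 3 * 4 ^+ g)^-1%R.
Let c10 : (0 < c1)%R. Proof. by rewrite invr_gt0 mulr_gt0// exprn_gt0. Qed.

Let ring_rate w : ball xi (2 * r) w -> (c1 / phi r)%:E <= N w ring.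
Proof.
move=> wB; have r20 : (0 < 2 * r)%R by rewrite mulr_gt0.
apply: (le_trans _ (N_ring_lower Q1 H r20 (lexx _) wB)).
have p2 := hs_phi_gt0 H r20.
rewrite lee_fin /c1 -invfM lef_pV2 ?posrE ?mulr_gt0 ?exprn_gt0//.
have pp : (phi (2 * r) <= Q * 2 ^+ g * phi r)%R by apply: (hs_phi_dbl H) => //; lra.
apply: (@le_trans _ _ (Q ^+ 2 * 2 ^+ g * (Q * 2 ^+ g * phi r))%R).
  by rewrite ler_pM2l// mulr_gt0 ?exprn_gt0.
have -> : (4 = 2 * 2 :> R)%R by ring.
by rewrite exprMn le_eqVlt; apply/orP; left; apply/eqP; ring.
Qed.

(* Exit through [ring] of any set [V] inside [W] costs at least the mean exit
   time, so [u] is superharmonic with this slack. *)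
Let slack V x s : V `<=` W -> adm V -> V x -> V `<=` ball x s ->
  (forall z, ring z -> (s < mdist x z)%R) ->
  exists E, [/\ e V x = E%:E, (0 < E)%R &
   \int[om V x]_z (u \_ W) z <= (fine (u x) - c1 * (E / phi r))%:E].
Proof.
move=> VW aV Vx Vs ringx.
have FV : ring `&` closure V = set0 by exact: (closure_ball_disj Vs).
have cN y : V y -> (c1 / phi r)%:E <= N y ring.
  by move=> /VW Wy; apply: ring_rate; exact: aW.2.
have [E [eE E0 cE _]] := e_bound H aV Vx mring FV c10 r0 cN.
exists E; split => //.
have mW : measurable (W : set (borel T)) by apply: sub_sigma_algebra; case: aW.
(* Outside [W] the function [u] is the indicator of [ring], and [ring] does not meet [W]. *)
have : u x = \int[om V x]_z (u \_ W) z + om V x ring.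
  rewrite /u (hs_om_markov H x aV aW VW mring) -/u.
  rewrite (@eq_integral _ (borel T) R (om V x) setT
    (fun z => (u \_ W) z + (\1_ring z)%:E)).
    rewrite ge0_integralD//; first by rewrite integral_indic// setIT.
    - by move=> z _; exact: erestrict_ge0.
    - by apply/(measurable_restrictT _ mW); exact: measurable_funTS.
    - by apply/measurable_EFinP; exact: measurable_indic.
  move=> z _; rewrite patchE; have [Wz|nW] := pselect (W z).
    rewrite mem_set// indicE memNset ?adde0//.
    by move=> [_]; apply; exact: aW.2.
  by rewrite memNset// add0e /u (hs_om_out H).
have ofin := om_fin H x aV mring.
rewrite -[om V x ring](fineK ofin) -[u x](fineK (uf x)) => ux.
have i0 : 0 <= \int[om V x]_z (u \_ W) z.
  by apply: integral_ge0 => z _; exact: erestrict_ge0.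
move: i0 ux; case: (\int[om V x]_z (u \_ W) z) => [I| |] // _.
  rewrite -EFinD => -[->]; rewrite lee_fin; have := cE; rewrite -mulrA /=; lra.
Qed.


(* Halving the radius multiplies [phi r / phi s] by up to [2 ^ g], and [eta] is
   small enough to make up for this loss at every step of [claimS]. *)
Let eta : R := (2^-1 ^+ g.+1)%R.
Let rho n : R := (kap + dl * 2^-1 ^+ n)%R.
(** The first bound serves the nearby error, which must not exceed [eta * an n] plus a quarter of
    the slack; the second makes the m-th shell cost at most 2^-m times an eighth of the slack. *)
Let al : R := (Num.min (eta / (4 * Q ^+ 2 * (4 / dl) ^+ g / c1))
  (c1 / (8 * Q ^+ 2 * (8 / dl) ^+ g)))%R.
Let an n : R := (al * eta ^+ n)%R.
(** The coefficients of the two errors without a factor [an]: exits beyond [rho 0] controlled by the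
    Carleson bound, and far jumps. *)
Let G3 : R := (K1 * Q ^+ 2 * (4 / dl) ^+ g + Q * (3 / dl) ^+ g)%R.
(** The first summand lets half of the slack absorb [G3]; the second makes the claim for n = 0 a
    consequence of the Carleson bound. *)
Let K2 : R := (2 * G3 / c1 + K1 / al)%R.

Let dlV0 : (0 < dl^-1)%R. Proof. by rewrite invr_gt0. Qed.
Let idl (x : R) : (0 < x)%R -> (0 < (x / dl) ^+ g)%R.
Proof. by move=> x0; rewrite exprn_gt0// divr_gt0. Qed.
Let eta0 : (0 < eta)%R. Proof. by rewrite exprn_gt0// invr_gt0. Qed.
Let half (n : nat) : (0 < (2^-1 : R) ^+ n <= 1)%R.
Proof. by rewrite exprn_gt0 ?invr_gt0//= exprn_ile1//; lra. Qed.
Let al0 : (0 < al)%R.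
Proof.
rewrite lt_min; apply/andP; split.
  apply: divr_gt0 => //; apply: divr_gt0 => //; apply: mulr_gt0; last exact: idl.
  by rewrite mulr_gt0// exprn_gt0.
apply: divr_gt0 => //; apply: mulr_gt0; last exact: idl.
by rewrite mulr_gt0// exprn_gt0.
Qed.
Let al_eta : (al * (4 * Q ^+ 2 * (4 / dl) ^+ g / c1) <= eta)%R.
Proof.
rewrite -ler_pdivlMr; first by rewrite ge_min lexx.
apply: divr_gt0 => //; apply: mulr_gt0; last exact: idl.
by rewrite mulr_gt0// exprn_gt0.
Qed.
Let al_c1 : (al * (8 * Q ^+ 2 * (8 / dl) ^+ g) <= c1)%R.
Proof.
rewrite -ler_pdivlMr; first by rewrite ge_min lexx orbT.
apply: mulr_gt0; last exact: idl.
by rewrite mulr_gt0// exprn_gt0.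
Qed.
Let an0 n : (0 < an n)%R. Proof. by rewrite mulr_gt0// exprn_gt0. Qed.
Let G30 : (0 <= G3)%R.
Proof.
rewrite addr_ge0// mulr_ge0 ?(ltW Q0) ?(ltW (idl _))//.
by rewrite mulr_ge0// exprn_ge0// ltW.
Qed.
Let K20 : (0 <= K2)%R.
Proof. by rewrite addr_ge0// divr_ge0 ?mulr_ge0 ?(ltW c10) ?(ltW al0). Qed.
Let K2al : (K1 <= K2 * al)%R.
Proof.
rewrite /K2 mulrDl mulfVK ?gt_eqF// lerDr mulr_ge0 ?(ltW al0)//.
by rewrite divr_ge0 ?(ltW c10)// mulr_ge0.
Qed.
Let K2G : (2 * G3 <= K2 * c1)%R.
Proof.
rewrite /K2 [leRHS]mulrDl mulfVK ?gt_eqF// lerDl mulr_ge0 ?(ltW c10)//.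
by rewrite divr_ge0 ?(ltW al0).
Qed.
Let eta_half n : (eta ^+ n * (2 ^+ n) ^+ g = 2^-1 ^+ n)%R.
Proof.
rewrite /eta -exprM -exprM mulSn addnC exprD mulrAC.
by rewrite [(n * g)%N]mulnC [(g * n)%N]mulnC -exprMn mulVf// expr1n mul1r.
Qed.

Let claim n := forall x, D x -> ball xi (rho n * r) x ->
  (f x <= K2 * La * (fine (u x) + an n))%R.
Let far_carl z : D z -> ball xi (k1 * r) z -> (f z <= K1 * La)%R.
Proof.
move=> Dz zk; apply: carl => //.
move: zk; rewrite !ballEmdist /= /k1; have := dlr; lra.
Qed.

(** The exit position from a small ball around [x] is inside radius [rho n], in a shell between
    [rho m.+1] and [rho m], between [rho 0] and the far set, or far. The slack [c1 * Eb] of [u] pays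
    for all of it: a quarter for nearby exits, a quarter for the shells, one half for the rest. Only
    [eta * an n], which is [an n.+1], remains. *)
Let claimS n : (forall m, (m <= n)%N -> claim m) -> claim n.+1.
Proof.
move=> IH x Dx xB.
pose hn : R := (2^-1 ^+ n)%R.
have /andP[hn0 hn1] := half n; rewrite -/hn in hn0 hn1.
(* Since [rho n.+1] is kap + dl 2^-n / 2, the ball around [x] ends at least dl 2^-n r / 4 before the
   radius [rho n * r]. *)
pose sg := (dl * hn / 4)%R; pose s := (sg * r)%R.
have sg0 : (0 < sg)%R by rewrite /sg divr_gt0 // mulr_gt0.
have s0 : (0 < s)%R by rewrite mulr_gt0.
have dhn : (dl * hn * r <= dl * r)%R by rewrite ler_pM2r// ler_piMr// ltW.
have sE : (s = dl * hn * r / 4)%R by rewrite /s /sg mulrAC.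
have rS : (rho n.+1 * r = kap * r + dl * hn * r / 2)%R.
  by rewrite /rho exprS -/hn; field.
have xB' := xB; move: xB'; rewrite ballEmdist /= rS => xB'.
have xs_rho b : (rho n.+1 * r + s <= b)%R -> ball x s `<=` ball xi b.
  move=> bb z /ballP xz; apply/ballP.
  by have := metric_triangle xi x z; rewrite rS in bb; lra.
pose V := D `&` ball x s.
have Vs : V `<=` ball x s by move=> z [].
have aV : adm V.
  apply: adm_ball => //; apply: xs_rho; rewrite rS; have := kdlr; have := dlr; lra.
have Vx : V x by split => //; exact: ballxx.
have VW : V `<=` W.
  move=> z [Dz xz]; split => //; apply: (xs_rho _ _ z xz); rewrite rS; have := dlr; lra.
have VU : V `<=` U.
  move=> z [Dz xz]; split => //; apply: (xs_rho _ _ z xz).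
  by rewrite rS; have := dlr; have := kdlr; lra.
have [E [eE E0 uE]] : exists E, [/\ e V x = E%:E, (0 < E)%R &
   \int[om V x]_z (u \_ W) z <= (fine (u x) - c1 * (E / phi r))%:E].
  apply: (slack VW aV Vx Vs) => z [_ /nballP zz].
  by have := metric_triangle xi x z; have := dlr; have := kdlr; lra.
pose Eb := (E / phi r)%R; rewrite -/Eb in uE.
have Eb0 : (0 < Eb)%R by rewrite divr_gt0.
have mB y t : measurable (~` ball y t : set (borel T)).
  by apply: measurableC; exact: measurable_ball_borel.
have mW : measurable (W : set (borel T)) by apply: sub_sigma_algebra; case: aW.
pose FF : set T := far_set (xi := xi) (r := r) k1.
set k := (K2 * La)%R; have k0 : (0 <= k)%R by rewrite mulr_ge0.
have tail : (an n * fine (om V x (~` ball x s)) <= eta * an n + c1 * Eb / 4)%R.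
  (* Makes the mean-exit-time term of the tail bound exactly [c1 * Eb / 4]. The other term becomes
     quadratic in [an n], and its spare factor [an n] outweighs [phi r / phi s]. *)
  pose t := (4 * an n * phi r / c1)%R.
  have t0 : (0 < t)%R := divr_gt0 (mulr_gt0 (mulr_gt0 (ltr0Sn _ 3) (an0 n)) pr) c10.
  have sr : (s <= r)%R by rewrite sE; have := dlr; have := kapr; have := kdlr; lra.
  have ps := hs_phi_gt0 H s0.
  have sgV1 : (1 <= sg^-1)%R.
    by rewrite invf_ge1// /sg; have := dl_le; have : (dl * hn <= dl)%R; [by rewrite ler_piMr// ltW|lra].
  have := @hs_phi_dbl _ _ _ _ _ _ _ _ _ _ _ H sg^-1%R s sgV1 s0.
  rewrite {1}/s mulKf ?gt_eqF// -ler_pdivrMr// => pps.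
  have := hs_om_tail H x aV s0 sr t0.
  rewrite eE -[om V x _](fineK (om_fin H x aV (mB _ _))) -EFinM -EFinD lee_fin => Pl.
  apply: (le_trans (ler_wpM2l (ltW (an0 n)) Pl)); rewrite mulrDr; apply: lerD.
    have -> : (an n * (Q * t / phi s) = an n * (4 * Q / c1 * (an n * (phi r / phi s))))%R.
      by rewrite /t; field; rewrite !gt_eqF.
    rewrite [leRHS]mulrC ler_pM2l//; apply: (le_trans _ al_eta).
    have -> : (al * (4 * Q ^+ 2 * (4 / dl) ^+ g / c1) =
        4 * Q / c1 * (Q * (al * (4 / dl) ^+ g)))%R by ring.
    rewrite ler_pM2l; last by rewrite divr_gt0// mulr_gt0.
    apply: (le_trans (ler_wpM2l (ltW (an0 n)) pps)).
    have -> : (an n * (Q * sg^-1 ^+ g) = Q * (al * (4 / dl) ^+ g) * hn)%R.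
      have -> : (sg^-1 = 4 / dl * 2 ^+ n)%R.
        by rewrite /sg /hn exprVn; field; rewrite !gt_eqF// exprn_gt0.
      rewrite /hn -eta_half /an exprMn; ring.
    by apply: ler_piMr; rewrite // !mulr_ge0 ?(ltW Q0) ?(ltW al0) ?(ltW (idl _)).
  by rewrite le_eqVlt; apply/orP; left; apply/eqP; rewrite /t /Eb; field; rewrite !gt_eqF.
(* By [eta_half], [an m] times the doubling loss (2^m)^g is al 2^-m, so the shell costs are summable
   with a bound independent of n. *)
have beyond m : (m < n)%N ->
    (an m * fine (om V x (~` ball xi (rho m.+1 * r))) <= 2^-1 ^+ m * (c1 * Eb / 8))%R.
  move=> mn; pose hm : R := (2^-1 ^+ m)%R.
  have /andP[hm0 hm1] := half m; rewrite -/hm in hm0 hm1.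
  have hnm : (2 * hn <= hm)%R.
    have -> : (hm = 2 * (2^-1 * hm))%R by rewrite mulVKf.
    rewrite ler_pM2l// /hm /hn -exprS; apply: ler_wiXn2l => //; lra.
  have dhm : (dl * (2 * hn) * r <= dl * hm * r)%R by rewrite ler_pM2r// ler_pM2l.
  pose sm := (dl * hm / 8)%R.
  have sm0 : (0 < sm)%R by rewrite /sm divr_gt0// mulr_gt0.
  have sm1 : (0 < sm <= 1)%R.
    by rewrite sm0 /sm; have := dl_le; have : (dl * hm <= dl)%R; [by rewrite ler_piMr// ltW|lra].
  have Vm : V `<=` ball xi (rho m.+1 * r - sm * r).
    move=> z [_ xz]; apply: (xs_rho _ _ z xz).
    have -> : (rho m.+1 * r = kap * r + dl * hm * r / 2)%R by rewrite /rho exprS -/hm; field.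
    have -> : (sm * r = dl * hm * r / 8)%R by rewrite /sm mulrAC.
    rewrite rS; lra.
  have := exit_beyond aV Vx sm1 Vm eE (ltW E0).
  rewrite -[om V x _](fineK (om_fin H x aV (mB _ _))) lee_fin -/Eb => ol.
  apply: (le_trans (ler_wpM2l (ltW (an0 m)) ol)).
  have -> : (an m * (Q ^+ 2 * sm^-1 ^+ g * Eb) =
      hm * (al * (8 * Q ^+ 2 * (8 / dl) ^+ g) * Eb / 8))%R.
    have -> : (sm^-1 = 8 / dl * 2 ^+ m)%R.
      by rewrite /sm /hm exprVn; field; rewrite !gt_eqF// exprn_gt0.
    by rewrite /hm -eta_half /an exprMn; field.
  by rewrite -/hm ler_pM2l// ler_pM2r// ler_pM2r.
have last : (fine (om V x (~` ball xi (rho 0 * r))) <= Q ^+ 2 * (4 / dl) ^+ g * Eb)%R.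
  have Vm : V `<=` ball xi (rho 0%N * r - dl / 4 * r).
    move=> z [_ xz]; apply: (xs_rho _ _ z xz); rewrite rS /rho expr0; have := dlr; lra.
  have d4 : (0 < dl / 4 <= 1)%R by have := dl_le; have := dl0; lra.
  have := exit_beyond aV Vx d4 Vm eE (ltW E0).
  by rewrite -[om V x _](fineK (om_fin H x aV (mB _ _))) lee_fin -/Eb invf_div.
have far : \int[om V x]_(z in FF) h z <= (Q * (3 / dl) ^+ g * Eb * La)%:E.
  have FV : FF `&` closure V = set0.
    apply: (closure_ball_disj Vs) => z; rewrite /FF /far_set /k1 => /nballP.
    by have := metric_triangle xi x z; have := dlr; lra.
  have L1 : (1 <= 3 / dl)%R by rewrite ler_pdivlMr//; have := dl_le; lra.
  apply: (le_trans (far_upper Q1 H k10 mh h0 aV Vx (measurable_far_set _) (@subset_refl _ _)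
    FV L1 _ eE (ltW E0))); last first.
    rewrite -(fineK (far_mass_fin H k10 h0 h1)) -EFinM lee_fin /La /Eb.
    by rewrite le_eqVlt; apply/orP; left; apply/eqP; field; rewrite !gt_eqF.
  move=> w z [_ xw]; rewrite /FF /far_set /k1 => /nballP zk.
  have wk : ball xi ((kap + dl) * r) w by apply: (xs_rho _ _ w xw); rewrite rS; have := dlr; lra.
  move: wk; rewrite ballEmdist /= => wk.
  have tr := metric_triangle xi w z.
  have wz : (dl * r <= mdist w z)%R by lra.
  rewrite mulrAC ler_pdivlMr//.
  have : (dl * mdist xi z <= dl * (2 * r + mdist w z))%R.
    by rewrite ler_pM2l//; have := kdlr; have := dlr; lra.
  have : (dl * mdist w z <= 1 / 4 * mdist w z)%R by rewrite ler_wpM2r// mdist_ge0.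
  by rewrite mulrDr mulrC; lra.
have hx : h x <= k%:E * \int[om V x]_z (u \_ W) z + ((k * an n)%:E * om V x (~` ball x s) +
    (\sum_(m < n) (k * an m)%:E * om V x (~` ball xi (rho m.+1 * r)) +
     ((K1 * La)%:E * om V x (~` ball xi (rho 0 * r)) +
      \int[om V x]_(z in FF) h z))).
  rewrite /h (hs_om_markov H x aV aU VU mA) -/h.
  apply: (@integral_bound _ (borel T) R (om V x) V h (u \_ W) k (k * an n) (K1 * La) n
    (fun m => k * an m)%R (~` ball x s) (~` ball xi (rho 0 * r))
    (FF) (fun m => ~` ball xi (rho m.+1 * r))) => //.
  - by apply: sub_sigma_algebra; case: aV.
  - exact: (hs_om_self H).
  - by apply/(measurable_restrictT _ mW); exact: measurable_funTS.
  - by move=> z; exact: erestrict_ge0.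
  - exact: measurable_far_set.
  - by rewrite mulr_ge0// ltW.
  - by rewrite mulr_ge0.
  - by move=> m; rewrite mulr_ge0// ltW.
  move=> z nVz; have hF0 : 0 <= (h \_ FF) z by exact: erestrict_ge0.
  have v0 : 0 <= (u \_ W) z by exact: erestrict_ge0.
  have i0 (y : R) (S : set T) : (0 <= y)%R -> 0 <= y%:E * (\1_S z)%:E.
    by move=> y0; rewrite mule_ge0// lee_fin.
  have kan m : (0 <= k * an m)%R by rewrite mulr_ge0// ltW.
  have K1La : (0 <= K1 * La)%R by rewrite mulr_ge0.
  have sum0 : 0 <= \sum_(m < n) (k * an m)%:E * (\1_(~` ball xi (rho m.+1 * r)) z)%:E.
    by apply: sume_ge0 => m _; exact: i0.
  have kv0 : 0 <= k%:E * (u \_ W) z by rewrite mule_ge0.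
  have [Fz|nF] := pselect (FF z).
    have <- : (h \_ FF) z = h z by rewrite patchE mem_set.
    by rewrite 3!addeA; apply: leeDr; rewrite !adde_ge0// i0.
  have zk : ball xi (k1 * r) z by exact: contrapT.
  have [Dz|nD] := pselect (D z); last first.
    rewrite h_out//; first by rewrite !adde_ge0// i0.
    by move: zk; rewrite !ballEmdist /= /k1; have := kdlr; have := dlr; lra.
  have [zW|nW] := pselect (ball xi (rho 0%N * r) z); last first.
    apply: (@le_trans _ _ ((K1 * La)%:E * (\1_(~` ball xi (rho 0%N * r)) z)%:E)).
      by rewrite indicE mem_set// mule1 -(fineK (hf z)) lee_fin; exact: far_carl.
    apply: (le_trans _ (leeDr _ kv0)); apply: (le_trans _ (leeDr _ (i0 _ _ (kan n)))).
    by apply: (le_trans _ (leeDr _ sum0)); exact: leeDl.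
  have vz : (u \_ W) z = u z.
    by rewrite patchE mem_set//; split => //; move: zW; rewrite /rho expr0 mulr1.
  have key m : (m <= n)%N -> ball xi (rho m * r) z ->
      h z <= k%:E * (u \_ W) z + (k * an m)%:E.
    move=> mn zm; rewrite vz -(fineK (hf z)) -(fineK (uf z)) -EFinM -EFinD lee_fin -mulrDr.
    exact: (IH m mn z Dz zm).
  have [zn|zn] := pselect (ball xi (rho n * r) z).
    apply: (le_trans (key n (leqnn n) zn)); apply: leeD2l.
    have xz : ~ ball x s z by move=> xz; exact: nVz.
    by rewrite indicE mem_set// mule1; apply: leeDl; rewrite !adde_ge0// i0.
  (* The claim at this [m] is used at z, and its error is charged to the m-th term of the sum. *)
  have [m [mn zm nzm]] := @first_exit_index (fun m => ball xi (rho m * r) z) n zW zn.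
  apply: (le_trans (key m (ltnW mn) zm)); apply: leeD2l.
  apply: (le_trans _ (leeDr _ (i0 _ _ (kan n)))).
  apply: (@le_trans _ _ (\sum_(m < n) (k * an m)%:E *
      (\1_(~` ball xi (rho m.+1 * r)) z)%:E)); last first.
    by apply: leeDl; rewrite adde_ge0// i0.
  rewrite (bigD1 (Ordinal mn)) //= indicE mem_set// mule1; apply: leeDl.
  by apply: sume_ge0 => j _; exact: i0.
rewrite -lee_fin fineK//; apply: (le_trans hx).
pose o S := fine (om V x S).
have oE S : measurable (S : set (borel T)) -> om V x S = (o S)%:E.
  by move=> mS; rewrite /o fineK//; exact: (om_fin H).
rewrite !oE//; under eq_bigr do rewrite oE// -EFinM -mulrA.
rewrite sumEFin -mulr_sumr.
have uI : k%:E * \int[om V x]_z (u \_ W) z <= (k * (fine (u x) - c1 * Eb))%:E.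
  by rewrite [leRHS]EFinM; apply: lee_wpmul2l; rewrite // lee_fin.
apply: (le_trans (leeD uI (leeD2l _ (leeD2l _ (leeD2l _ far))))).
rewrite -!EFinM -!EFinD lee_fin.
set P := o (~` ball x s); set S := (\sum_(i < n) _)%R; set O := o _.
have S2 : (S <= 2 * (c1 * Eb / 8))%R.
  apply: (@le_trans _ _ (\sum_(i < n) 2^-1 ^+ i * (c1 * Eb / 8))%R).
    by apply: ler_sum => i _; exact: beyond.
  rewrite -mulr_suml ler_wpM2r ?sum_half//.
  exact: ltW (divr_gt0 (mulr_gt0 c10 Eb0) (ltr0Sn _ _)).
have kP : (k * (an n * P) <= k * (eta * an n + c1 * Eb / 4))%R by rewrite ler_wpM2l.
have kS : (k * S <= k * (2 * (c1 * Eb / 8)))%R by rewrite ler_wpM2l.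
have kO : (K1 * La * O <= K1 * La * (Q ^+ 2 * (4 / dl) ^+ g * Eb))%R.
  by rewrite ler_wpM2l// mulr_ge0.
have kG : (2 * G3 * (Eb * La) <= K2 * c1 * (Eb * La))%R.
  by rewrite ler_wpM2r// mulr_ge0// ltW.
have anS : an n.+1 = (eta * an n)%R by rewrite /an exprS mulrCA.
rewrite anS; move: kP kS kO kG; rewrite /k /G3.
move: (k0); rewrite /k => ?; lra.
Qed.

Let claim_all n : claim n.
Proof.
elim/ltn_ind: n => -[_ x Dx|n IH].
  rewrite /rho expr0 mulr1 => xB.
  apply: (@le_trans _ _ (K1 * La)%R).
    apply: far_carl => //; move: xB; rewrite !ballEmdist /= /k1; have := dlr; lra.
  rewrite mulrAC ler_wpM2r//; apply: (le_trans K2al); rewrite ler_wpM2l//.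
  by rewrite /an expr0 mulr1 lerDr fine_ge0.
by apply: claimS => m mn; exact: IH.
Qed.

Lemma boundary_upper x : D x -> ball xi (kap * r) x -> (f x <= K2 * La * fine (u x))%R.
Proof.
move=> Dx xB; apply/ler_addgt0Pr => d d0.
have eta1 : (`|eta| < 1)%R.
  by rewrite ger0_norm ?(ltW eta0)// exprn_ilt1//; lra.
have kl : (0 <= K2 * La * al)%R := mulr_ge0 (mulr_ge0 K20 La0) (ltW al0).
have d1 : (0 < d / (K2 * La * al + 1))%R by rewrite divr_gt0// ltr_wpDl.
have /cvgrPdist_lt/(_ _ d1)[n _ /(_ n (leqnn _))] := cvg_expr eta1.
rewrite /= sub0r normrN ger0_norm ?exprn_ge0 ?(ltW eta0)// => en.
have xn : ball xi (rho n * r) x.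
  move: xB; rewrite !ballEmdist /= => /lt_le_trans; apply.
  by rewrite ler_pM2r// lerDl mulr_ge0 ?(ltW dl0)//; have /andP[/ltW] := half n.
apply: (le_trans (claim_all Dx xn)); rewrite mulrDr lerD2l /an mulrA.
apply: (@le_trans _ _ ((K2 * La * al + 1) * eta ^+ n)%R).
  by rewrite ler_wpM2r ?exprn_ge0 ?(ltW eta0)// lerDl.
by rewrite mulrC -ler_pdivlMr ?ltW// ltr_wpDl.
Qed.

Let C3 : R := (Q ^+ 2 * dl^-1 ^+ g)%R.
Let C30 : (0 < C3)%R.
Proof. by rewrite mulr_gt0// exprn_gt0. Qed.

(** The mean exit time from [W] is eliminated between an upper bound for [u], by all jumps out of
    [ball xi (2 * r)], and a lower bound for [f], by jumps to the far set followed by the exit from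
    [U]. *)
Lemma boundary_lower y : D y -> ball xi (kap * r) y ->
  (0 < fine (u y) /\ fine (u y) * La <= C3 * (Q * 2 ^+ g) * f y)%R.
Proof.
move=> Dy yB.
have Vs : W `<=` ball xi ((kap + dl) * r) by move=> z [].
have Wy : W y by split => //; move: yB; rewrite !ballEmdist /=; have := dlr; lra.
have ringW : ring `&` closure W = set0.
  by apply: (closure_ball_disj Vs) => z [_ /nballP]; have := dlr; have := kdlr; lra.
have cN z : W z -> (c1 / phi r)%:E <= N z ring by move=> Wz; apply: ring_rate; exact: aW.2.
have [E [eE E0 cE _]] := e_bound H aW Wy mring ringW c10 r0 cN.
split; first by apply: lt_le_trans cE; rewrite divr_gt0// mulr_gt0.
have uE : (fine (u y) <= C3 * (E / phi r))%R.
  rewrite -lee_fin fineK//; apply: (@le_trans _ _ (om W y (~` ball xi (2 * r)))).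
    apply: le_measure; rewrite ?inE//; last by move=> z [].
    by apply: measurableC; exact: measurable_ball_borel.
  apply: (exit_beyond aW Wy _ _ eE (ltW E0)).
    by have := dl_le; rewrite dl0 /=; lra.
  by move=> z [_]; rewrite !ballEmdist /=; have := dlr; have := kdlr; lra.
have FW : far_set (xi := xi) (r := r) k1 `&` closure W = set0.
  apply: (closure_ball_disj Vs) => z; rewrite /far_set /k1 => /nballP.
  by have := dlr; lra.
have WU : W `<=` U.
  by move=> z [Dz zB]; split => //; move: zB; rewrite !ballEmdist /=; have := kdlr; have := dlr; lra.
have fE : (E / (Q * 2 ^+ g) * fine (far_mass (N := N) (xi := xi) (r := r) k1 h) <= f y)%R.
  rewrite -lee_fin EFinM fineK; last exact: (far_mass_fin H k10 h0 h1).
  rewrite /f fineK//.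
  apply: (@le_trans _ _ (\int[om W y]_(z in far_set (xi := xi) (r := r) k1) h z)).
    apply: (far_lower Q1 H k10 mh h0 aW Wy FW _ _ eE (ltW E0)); first by rewrite ler1n.
    move=> w z /Vs; rewrite /far_set /k1 => /ballP wB /nballP zB.
    by have := metric_triangle w xi z; rewrite (metric_sym w xi); have := dlr; lra.
  rewrite [leRHS]/h (hs_om_markov H y aW aU WU mA) -/h.
  apply: ge0_subset_integral => //.
  exact: measurable_far_set.
move: fE; rewrite /La; set M := fine (far_mass _ _) => fE.
have M0 : (0 <= M)%R by apply: fine_ge0; exact: integral_ge0.
have QQ : (0 < Q * 2 ^+ g)%R by rewrite mulr_gt0// exprn_gt0.
apply: (@le_trans _ _ (C3 * (E / phi r) * (phi r * M))%R).
  by rewrite ler_wpM2r// mulr_ge0// ltW.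
have -> : (C3 * (E / phi r) * (phi r * M) =
    C3 * (Q * 2 ^+ g) * (E / (Q * 2 ^+ g) * M))%R.
  by field; rewrite !gt_eqF// exprn_gt0.
by rewrite ler_pM2l//; exact: mulr_gt0.
Qed.

Definition boundary_const : R := (K2 * (C3 * (Q * 2 ^+ g)))%R.

Lemma boundary_comparison x y : D x -> ball xi (kap * r) x -> D y -> ball xi (kap * r) y ->
  [/\ (0 < fine (u x))%R, (0 < fine (u y))%R &
    (f x * fine (u y) <= boundary_const * (f y * fine (u x)))%R].
Proof.
move=> Dx xB Dy yB.
have [ux _] := boundary_lower Dx xB; have [uy fy] := boundary_lower Dy yB.
split => //.
apply: (le_trans (ler_wpM2r (ltW uy) (boundary_upper Dx xB))).
have -> : (K2 * La * fine (u x) * fine (u y) = K2 * fine (u x) * (fine (u y) * La))%R by ring.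
have -> : (boundary_const * (f y * fine (u x)) =
    K2 * fine (u x) * (C3 * (Q * 2 ^+ g) * f y))%R by rewrite /boundary_const; ring.
by rewrite ler_wpM2l// mulr_ge0// ltW.
Qed.

End boundary.

Lemma bernoulli (R : realType) (x : R) n : (0 <= x <= 1)%R -> (1 - n%:R * x <= (1 - x) ^+ n)%R.
Proof.
move=> /andP[x0 x1]; elim: n => [|n IH]; first by rewrite mul0r subr0 expr0.
rewrite exprS; have x1' : (0 <= 1 - x)%R by lra.
apply: (le_trans _ (ler_wpM2l x1' IH)); rewrite -natr1.
have : (0 <= n%:R * (x * x))%R by rewrite !mulr_ge0.
lra.
Qed.

(** The order of quantifiers matters: the constant precedes the space and the ball, which gives
    uniformity, and [u] precedes [A], so that the same [u] serves two harmonic functions. *)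
Lemma exit_ratio_bound (R : realType) (kap Q lam : R) (g : nat) :
  (0 < kap < 2)%R -> (1 <= Q)%R -> (2 <= lam)%R ->
  exists2 C : R, (1 < C)%R &
    forall (T : pmetricType R) (N : T -> {measure set (borel T) -> \bar R})
      (om : set T -> T -> {measure set (borel T) -> \bar R}) (e : set T -> T -> \bar R)
      (phi : R -> R) (xi : T) (r : R), harmonic_setting Q lam g N om e phi xi r ->
    forall D : set T, open D -> exists u : T -> R,
    forall A : set (borel T), measurable A -> A `<=` ~` ball xi (2 * r) ->
    forall x y, D x -> ball xi (kap * r) x -> D y -> ball xi (kap * r) y ->
      let f z := fine (om (D `&` ball xi (2 * r)) z A) in
      [/\ 0 < u x, 0 < u y & f x * u y <= C * (f y * u x)]%R.
Proof.
move=> kap02 Q1 lam2; pose dl := ((2 - kap) / 8)%R.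
have kdl : (kap + 8 * dl = 2)%R by rewrite /dl; field.
have dl0 : (0 < dl)%R by case/andP: kap02 => ? ?; rewrite /dl; lra.
have Q0 : (0 < Q)%R by exact: lt_le_trans Q1.
pose c0 := ((Q ^+ 4 * (4 / dl) ^+ g)^-1)%R.
have c00 : (0 < c0)%R by rewrite invr_gt0 mulr_gt0// exprn_gt0// divr_gt0.
pose q := (Num.max (1 / 2) (1 - c0 / (16 * Q)))%R.
have q1 : (q < 1)%R.
  by rewrite gt_max; apply/andP; split; [lra|rewrite gtrBl divr_gt0// mulr_gt0].
have q2 : (1 / 2 <= q)%R by rewrite le_max lexx.
(* By Bernoulli, th^g >= 1 - g (1 - q) / (2 (g + 1)) >= (1 + q) / 2; taking g + 1 avoids dividing by
   zero. *)
pose th := (1 - (1 - q) / (2 * g.+1%:R))%R.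
have g0 : (0 < 2 * g.+1%:R :> R)%R by rewrite mulr_gt0.
have t01 : (0 < (1 - q) / (2 * g.+1%:R) < 1)%R.
  rewrite divr_gt0 ?subr_gt0//= ltr_pdivrMr// mul1r.
  have : (1 <= g.+1%:R :> R)%R by rewrite ler1n.
  by lra.
have th01 : (0 < th < 1)%R.
  by case/andP: t01 => ? ?; rewrite /th subr_gt0 gtrBl; apply/andP; split.
have thq : ((1 + q) / 2 <= th ^+ g)%R.
  have t01' : (0 <= (1 - q) / (2 * g.+1%:R) <= 1)%R by case/andP: t01 => ? ?; apply/andP; split; exact: ltW.
  apply: (le_trans _ (bernoulli g t01')).
  have : (g%:R * ((1 - q) / (2 * g.+1%:R)) <= (1 - q) / 2)%R.
    rewrite mulrA ler_pdivrMr//.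
    have -> : ((1 - q) / 2 * (2 * g.+1%:R) = (1 - q) * g.+1%:R)%R by field.
    by rewrite mulrC ler_pM2l ?subr_gt0// ler_nat.
  by move: (g%:R * _)%R => P; lra.
pose K1 := @carleson_const R Q lam g dl th.
pose B := @boundary_const R Q g dl K1.
exists (Num.max 2%R B); first by rewrite lt_max ltr1n.
move=> T N om e phi xi r H D oD.
pose W := D `&` ball xi ((kap + dl) * r).
exists (fun z => fine (om W z (ball xi (lam * (2 * r)) `\` ball xi (2 * r)))).
move=> A mA Afar x y Dx xB Dy yB /=.
have K10 : (0 <= K1)%R.
  have -> : K1 = (Q * (@carleson_ratio R lam dl th) ^+ g / c0 * ((1 + q) / (1 - q)))%R by [].
  apply: mulr_ge0; last by rewrite divr_ge0//; lra.
  apply: divr_ge0; last exact: ltW.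
  rewrite mulr_ge0 ?(ltW Q0)// exprn_ge0// divr_ge0//; first by lra.
  by case/andP: th01 => ? ?; rewrite mulr_ge0 ?(ltW dl0)//; lra.
have carl z Dz zB := carleson Q1 lam2 H kap02 kdl oD mA Afar th01 thq (y := z) Dz zB.
have [ux uy le_f] := boundary_comparison Q1 H kap02 kdl oD mA Afar K10 carl Dx xB Dy yB.
split => //; apply: (le_trans le_f); apply: ler_wpM2r; last by rewrite le_max lexx orbT.
by rewrite mulr_ge0 ?(ltW ux)// fine_ge0.
Qed.

(** * Volume doubling and the jump kernel *)

Lemma closed_cball {R : realType} {T : pmetricType R} (x : T) (t : R) :
  closed [set z | (mdist x z <= t)%R].
Proof.
rewrite -openC openE => y /= /negP; rewrite -ltNge => ty.
apply/nbhs_ballP; exists (mdist x y - t)%R => [|z]; first by rewrite /= subr_gt0.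
rewrite ballEmdist /= => yz; apply/negP; rewrite -ltNge.
by have := metric_triangle x z y; rewrite (metric_sym z y); lra.
Qed.

Section volume.
Context {R : realType} {T : pmetricType R} (m : {measure set (borel T) -> \bar R}).
Hypotheses (lc : locally_compact [set: T]) (rad : radon m) (full : full_support m).
Variable C_VD : R.
Hypotheses (C1 : (1 < C_VD)%R) (vd : VD m C_VD).

Let C0 : (0 < C_VD)%R. Proof. exact: lt_trans C1. Qed.

Lemma small_compact_ball (x : T) (V : set T) : open V -> V x ->
  exists2 t : R, (0 < t)%R & compact [set z | (mdist x z <= t)%R] /\
    [set z | (mdist x z <= t)%R] `<=` V.
Proof.
move=> oV Vx; have [U] := lc I (x := x); rewrite withinET => Ux [cU _].
have : nbhs x (U `&` V) by apply: filterI => //; exact: open_nbhs_nbhs.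
move=> /nbhs_ballP[t /= t0 tU].
have sub : [set z | (mdist x z <= t / 2)%R] `<=` U `&` V.
  by move=> z /= xz; apply: tU; rewrite ballEmdist /=; lra.
exists (t / 2)%R; first by rewrite divr_gt0.
split; last by move=> z /sub[].
by apply: (subclosed_compact _ cU); [exact: closed_cball|move=> z /sub[]].
Qed.

Lemma ball_measure_gt0 (x : T) (s : R) : (0 < s)%R -> 0 < m (ball x s).
Proof.
by move=> s0; apply: full; [exact: metric_ball_open|exists x; exact: ballxx].
Qed.

Lemma le_ball_measure (x y : T) (s t : R) : (mdist x y + s <= t)%R ->
  m (ball y s) <= m (ball x t).
Proof.
move=> st; apply: le_measure; rewrite ?inE; try exact: measurable_ball_borel.
by move=> z /ballP yz; apply/ballP; have := metric_triangle x y z; lra.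
Qed.

Lemma doubling_pow (x : T) (s : R) k : (0 < s)%R ->
  m (ball x (2 ^+ k * s)) <= (C_VD ^+ k)%:E * m (ball x s).
Proof.
move=> s0; elim: k => [|k IH]; first by rewrite !expr0 mul1r mul1e.
rewrite !exprS -mulrA; apply: (le_trans (vd _ _)); first by rewrite mulr_gt0// exprn_gt0.
by rewrite EFinM -muleA lee_wpmul2l// lee_fin ltW.
Qed.

Lemma pow2_between (L : R) : (1 <= L)%R -> exists k, (L <= 2 ^+ k <= 2 * L)%R.
Proof.
move=> L1; have ex : exists k, (L <= 2 ^+ k)%R.
  exists (Num.truncn L).+1; apply: ltW.
  have /andP[_ /lt_le_trans] := truncn_itv (le_trans ler01 L1); apply.
  rewrite -natrX ler_nat; exact: ltnW (ltn_expl _ _).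
case: (ex_minnP ex) => -[|k] kL kmin.
  by exists 0%N; rewrite kL expr0; lra.
exists k.+1; rewrite kL exprS ler_pM2l//= leNgt; apply/negP => /ltW/kmin.
by rewrite ltnn.
Qed.

(** Rounding the doubling constant up to a power of 2 gives growth with a natural exponent; rounding
    [L] up to a power of 2 costs the factor 2. *)
Lemma volume_growth (dd : nat) (x : T) (L s : R) : (C_VD <= 2 ^+ dd)%R ->
  (1 <= L)%R -> (0 < s)%R ->
  m (ball x (L * s)) <= ((2 * L) ^+ dd)%:E * m (ball x s).
Proof.
move=> Cd L1 s0; have [k /andP[Lk kL]] := pow2_between L1.
apply: (@le_trans _ _ (m (ball x (2 ^+ k * s)))).
  by apply: le_ball_measure; rewrite mdistxx add0r ler_pM2r.
apply: (le_trans (doubling_pow _ _ s0)); apply: lee_wpmul2r => //.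
rewrite lee_fin; apply: (@le_trans _ _ ((2 ^+ dd) ^+ k)%R).
  by apply: lerXn2r; rewrite ?nnegrE ?exprn_ge0// ltW.
rewrite exprAC; apply: lerXn2r; rewrite ?nnegrE ?exprn_ge0//.
by rewrite mulr_ge0//; lra.
Qed.

(** Balls need not be relatively compact, so only a small one has finite measure by [radon];
    doubling reaches the others. *)
Lemma ball_measure_fin (x : T) (s : R) : m (ball x s) < +oo.
Proof.
have [t t0 [ct _]] := small_compact_ball openT (I : setT x).
have fint : m (ball x t) < +oo.
  apply: (@le_lt_trans _ _ (m [set z | (mdist x z <= t)%R])).
    apply: le_measure; rewrite ?inE.
    - exact: measurable_ball_borel.
    - by rewrite -[X in measurable X]setCK; apply: measurableC; apply: sub_sigma_algebra; rewrite /mkset openC; exact: closed_cball.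
    by move=> z /ballP/ltW.
  by case: rad => + _ _; apply.
have [k /andP[Lk _]] : exists k, (Num.max 1 (s / t) <= 2 ^+ k <= 2 * Num.max 1 (s / t))%R.
  by apply: pow2_between; rewrite le_max lexx.
apply: (@le_lt_trans _ _ (m (ball x (2 ^+ k * t)))).
  apply: le_ball_measure; rewrite mdistxx add0r -ler_pdivrMr//.
  by apply: le_trans Lk; rewrite le_max lexx orbT.
apply: (le_lt_trans (doubling_pow _ _ t0)).
by rewrite lte_mul_pinfty// lee_fin exprn_ge0// ltW.
Qed.

Lemma ball_measure_fin_num (x : T) (s : R) : m (ball x s) \is a fin_num.
Proof. by rewrite ge0_fin_numE// ball_measure_fin. Qed.

Variable dd : nat.
Hypothesis Cd : (C_VD <= 2 ^+ dd)%R.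

Let separated (d : R) := pairwise (fun x y : T => d <= mdist x y)%R.

(** The balls of radius d / 2 around the points are disjoint, lie in one ball, and each carries a
    fixed share of its measure by [volume_growth]. *)
Lemma separated_size (xi : T) (rho d : R) : (0 < d)%R -> (0 < rho)%R ->
  exists K : R, forall s : seq T, (forall x, x \in s -> ball xi rho x) ->
    separated d s -> ((size s)%:R <= K)%R.
Proof.
move=> d0 rho0; pose L := ((2 * rho + d) / (d / 2))%R.
have d20 : (0 < d / 2)%R by rewrite divr_gt0.
have L1 : (1 <= L)%R by rewrite ler_pdivlMr// mul1r; lra.
have LE : (L * (d / 2) = 2 * rho + d)%R by rewrite /L mulfVK ?gt_eqF.
pose M := fine (m (ball xi (rho + d))).
have ME : m (ball xi (rho + d)) = M%:E by rewrite fineK// ball_measure_fin_num.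
have M0 : (0 < M)%R by rewrite -lte_fin -ME ball_measure_gt0// addr_gt0.
pose K := ((2 * L) ^+ dd)%R.
have K0 : (0 < K)%R by rewrite exprn_gt0// mulr_gt0//; lra.
exists K => s sB sep.
have inball x : ball xi rho x -> (M / K)%:E <= m (ball x (d / 2)).
  move=> /ballP xx; rewrite EFinM muleC lee_pdivrMl// -ME.
  apply: (le_trans _ (volume_growth x Cd L1 d20)); rewrite LE.
  by apply: le_ball_measure; rewrite metric_sym; lra.
have main : ((size s)%:R * (M / K))%:E <= m (\big[setU/set0]_(x <- s) ball x (d / 2)).
  elim: s sB sep => [|x s IH] sB sep; first by rewrite mul0r.
  move: sep; rewrite /separated /= => /andP[/allP xs sep].
  rewrite big_cons measureU.
  - rewrite -natr1 mulrDl mul1r addrC EFinD; apply: leeD.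
      by apply: inball; apply: sB; rewrite inE eqxx.
    by apply: IH => // y ys; apply: sB; rewrite inE ys orbT.
  - exact: measurable_ball_borel.
  - by apply: bigsetU_measurable => y _; exact: measurable_ball_borel.
  - apply/seteqP; split => // z [/ballP xz]; rewrite -bigcup_seq => -[y /= ys /ballP yz].
    by have := xs y ys; have := metric_triangle x z y; rewrite (metric_sym z y); lra.
have : m (\big[setU/set0]_(x <- s) ball x (d / 2)) <= m (ball xi (rho + d)).
  apply: le_measure; rewrite ?inE.
  - by apply: bigsetU_measurable => y _; exact: measurable_ball_borel.
  - exact: measurable_ball_borel.
  move=> z; rewrite -bigcup_seq => -[y /= ys /ballP yz]; apply/ballP.
  by have /ballP := sB y ys; have := metric_triangle xi y z; lra.
move=> /(le_trans main); rewrite ME lee_fin mulrA ler_pdivrMr// mulrC ler_pM2l//.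
Qed.

(** Otherwise separated families could be extended forever, against [separated_size]. *)
Lemma finite_net (S : set T) (xi : T) (rho d : R) : (0 < d)%R -> (0 < rho)%R ->
  S `<=` ball xi rho -> exists s : seq T, (forall x, x \in s -> S x) /\
    forall y, S y -> exists2 x, x \in s & (mdist x y < d)%R.
Proof.
move=> d0 rho0 SB; have [K HK] := separated_size xi d0 rho0.
apply: contrapT => nonet.
have grow n : exists s : seq T, [/\ size s = n, (forall x, x \in s -> S x) & separated d s].
  elim: n => [|n [s [sn sS sep]]]; first by exists [::].
  have [y Sy yfar] : exists2 y, S y & forall x, x \in s -> (d <= mdist x y)%R.
    apply: contrapT => ny; apply: nonet; exists s; split => // y Sy.
    apply: contrapT => nx; apply: ny; exists y => // x xs.
    by rewrite leNgt; apply/negP => xy; apply: nx; exists x.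
  exists (y :: s); split; first by rewrite /= sn.
    by move=> x; rewrite inE => /orP[/eqP->|/sS].
  by apply/andP; split => //; apply/allP => x /yfar; rewrite metric_sym.
have [s [sn sS sep]] := grow (Num.truncn (`|K|)).+1.
have := HK s (fun x xs => SB x (sS x xs)) sep; rewrite sn leNgt => /negP; apply.
have /andP[_] := truncn_itv (normr_ge0 K).
exact/le_lt_trans/ler_norm.
Qed.

(** Doubling makes [V] totally bounded, though not relatively compact; compactness comes from the
    margin in [inner]. *)
Lemma exhausted_bounded (V : set T) (xi : T) (rho : R) : open V -> (0 < rho)%R ->
  V `<=` ball xi rho -> exhausted V.
Proof.
move=> oV rho0 VB.
have n0 n : (0 < 2 / n.+1%:R :> R)%R by rewrite divr_gt0.
have innerV n : inner V n `<=` V.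
  move=> y [t tn [_ tV]]; apply: tV => /=; rewrite mdistxx.
  by exact: ltW (lt_trans (n0 n) tn).
have net n : compact (closure (inner V n)) /\ closure (inner V n) `<=` V.
  have d0 : (0 < 1 / n.+1%:R :> R)%R by rewrite divr_gt0.
  have [s [sV snet]] := finite_net d0 rho0 (subset_trans (innerV n) VB).
  pose d := (1 / n.+1%:R : R)%R.
  have dE : (2 / n.+1%:R = 2 * d :> R)%R by rewrite /d mulrA mulr1.
  pose K := \big[setU/set0]_(x <- s) [set z | (mdist x z <= 2 * d)%R].
  have cball x : x \in s -> compact [set z | (mdist x z <= 2 * d)%R] /\
      [set z | (mdist x z <= 2 * d)%R] `<=` V.
    move=> /sV[t tn [ct tV]].
    have sub : [set z | (mdist x z <= 2 * d)%R] `<=` [set z | (mdist x z <= t)%R].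
      by move=> z /= xz; rewrite dE in tn; lra.
    split; last exact: subset_trans tV.
    by apply: (subclosed_compact _ ct sub); exact: closed_cball.
  have cK : compact K.
    by rewrite /K big_seq; apply: bigsetU_compact => x /cball[].
  have clK : closure (inner V n) `<=` K.
    move=> z clz; have [y [Vy zy]] := clz _ (nbhsx_ballx z d d0).
    have [x xs xy] := snet y Vy; rewrite /K -bigcup_seq; exists x => //=.
    move: zy => /ballP; rewrite metric_sym => zy.
    by have := metric_triangle x y z; rewrite -/d in xy; lra.
  split; first by apply: (subclosed_compact _ cK clK); exact: closed_closure.
  by move=> z /clK; rewrite /K -bigcup_seq => -[x /= xs]; have [_] := cball x xs; apply.
split => //.
- move=> n; rewrite openE => y [t tn [ct tV]].
  pose e := ((t - 2 / n.+1%:R) / 2)%R.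
  apply/nbhs_ballP; exists e => [|z /ballP yz]; first by rewrite /= divr_gt0 ?subr_gt0.
  have sub : [set u | (mdist z u <= t - e)%R] `<=` [set u | (mdist y u <= t)%R].
    by move=> u /= zu; have := metric_triangle y z u; lra.
  exists (t - e)%R; first by move: tn; rewrite /e; move: (2 / _)%R => p; lra.
  split; last exact: subset_trans tV.
  by apply: (subclosed_compact _ ct sub); exact: closed_cball.
- move=> x Vx; have [t t0 tV] := small_compact_ball oV Vx.
  pose n := Num.truncn (2 / t)%R; exists n => //; exists t => //.
  have t20 : (0 <= 2 / t)%R by rewrite divr_ge0// ltW.
  have /andP[_] := truncn_itv t20.
  by rewrite ltr_pdivrMr// mulrC -ltr_pdivrMr.
- by move=> n; case: (net n).
- by move=> n; case: (net n).
Qed.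

End volume.

Section scale.
Context {R : realType} (phi : R -> R).
Local Open Scope ring_scope.
Hypothesis sc : scale_function phi.

Lemma scale_gt0 s : 0 < s -> 0 < phi s.
Proof. by case: sc => p0 _ inc s0; rewrite -p0; exact: inc. Qed.

Lemma scale_le s t : 0 < s -> s <= t -> phi s <= phi t.
Proof.
case: sc => _ _ inc s0; rewrite le_eqVlt => /orP[/eqP->//|st].
by apply/ltW/inc => //; exact: ltW.
Qed.

Lemma doubling_natpow (c beta : R) (nb : nat) L s : 0 <= c -> doubling phi c beta ->
  beta <= nb%:R -> 1 <= L -> 0 < s -> phi (L * s) <= c * L ^+ nb * phi s.
Proof.
move=> c0 db bn L1 s0; have sLs : s <= L * s by rewrite ler_peMl// ltW.
have := db s (L * s) s0 sLs; rewrite ler_pdivrMr ?scale_gt0// => /le_trans; apply.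
apply: ler_wpM2r; first exact/ltW/scale_gt0.
rewrite mulfK ?gt_eqF// ler_wpM2l// -powR_mulrn ?(le_trans ler01 L1)//.
exact: ler_powR.
Qed.

Lemma reverse_doubling_pow (a b : R) k s : 0 < a -> 0 < b -> reverse_doubling phi a b ->
  0 < s -> b ^+ k * phi s <= phi (a ^+ k * s).
Proof.
move=> a0 b0 rd s0; elim: k => [|k IH]; first by rewrite !expr0 !mul1r.
rewrite !exprS -!mulrA; apply: (le_trans (ler_wpM2l (ltW b0) IH)).
by apply: rd; rewrite mulr_gt0// exprn_gt0.
Qed.

End scale.

(** * Bounds on the jump kernel *)

Section jump_kernel.
Context {R : realType} {T : pmetricType R} (m : {measure set (borel T) -> \bar R}).
Hypotheses (lc : locally_compact [set: T]) (rad : radon m) (full : full_support m).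
Variables (C_VD : R) (dd nb : nat) (phi : R -> R) (c beta a b C_J1 C_J2 : R).
Hypotheses (C1 : (1 < C_VD)%R) (vd : VD m C_VD) (Cd : (C_VD <= 2 ^+ dd)%R).
Hypotheses (sc : scale_function phi) (db : doubling phi c beta).
Hypotheses (rd : reverse_doubling phi a b) (c1 : (1 <= c)%R) (bn : (beta <= nb%:R)%R).
Hypotheses (a1 : (1 < a)%R) (b1 : (1 < b)%R).
Hypotheses (CJ1 : (0 < C_J1)%R) (CJ2 : (0 < C_J2)%R).
Variables (J : T -> T -> R) (N : T -> {measure set (borel T) -> \bar R}).
Let V (x : T) (r : R) := fine (m (ball x r)).
Hypothesis mJ : measurable_fun setT
  ((fun p => J p.1 p.2) : (borel T * borel T)%type -> R).
Hypothesis Jb : forall x y : T, x != y ->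
  (C_J1 / (V x (mdist x y) * phi (mdist x y)) <= J x y /\
   J x y <= C_J2 / (V x (mdist x y) * phi (mdist x y)))%R.
Hypothesis NE : forall (x : T) (A : set (borel T)), measurable A ->
  N x A = \int[m]_(y in A `\ x) (J x y)%:E.

Let c0 : (0 < c)%R. Proof. exact: lt_le_trans c1. Qed.
Let a0 : (0 < a)%R. Proof. exact: lt_trans a1. Qed.
Let b0 : (0 < b)%R. Proof. exact: lt_trans b1. Qed.
Let Vf x r : m (ball x r) = (V x r)%:E.
Proof. by rewrite fineK//; exact: (ball_measure_fin_num lc rad C1 vd). Qed.
Let V0 x r : (0 < r)%R -> (0 < V x r)%R.
Proof. by move=> r0; rewrite -lte_fin -Vf; exact: ball_measure_gt0. Qed.
Let V_le x y s t : (mdist x y + s <= t)%R -> (V y s <= V x t)%R.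
Proof. by move=> st; rewrite -lee_fin -!Vf; exact: le_ball_measure. Qed.
Let V_pow x L s : (1 <= L)%R -> (0 < s)%R -> (V x (L * s) <= (2 * L) ^+ dd * V x s)%R.
Proof. by move=> L1 s0; rewrite -lee_fin EFinM -!Vf; exact: (volume_growth C1 vd). Qed.
Let phi0 := scale_gt0 sc.
Let phi_le := scale_le sc.
Let phi_pow L s : (1 <= L)%R -> (0 < s)%R -> (phi (L * s) <= c * L ^+ nb * phi s)%R.
Proof. exact: (doubling_natpow sc (ltW c0) db bn). Qed.

Let mdist0 (x y : T) : x != y -> (0 < mdist x y)%R.
Proof. by rewrite mdist_gt0. Qed.

Let J0 (x y : T) : x != y -> (0 < J x y)%R.
Proof.
move=> xy; have [l _] := Jb xy; apply: lt_le_trans l.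
by have d0 := mdist0 xy; rewrite divr_gt0// mulr_gt0 ?V0 ?phi0.
Qed.

Let mJx (x : T) (A : set (borel T)) : measurable_fun A ((fun y => (J x y)%:E) : borel T -> \bar R).
Proof.
apply: measurable_funTS; apply/measurable_EFinP.
exact: (measurableT_comp mJ (pair1_measurable (x : borel T))).
Qed.

Lemma kernel_bound (x : T) (A : set (borel T)) K : measurable A -> ~ A x ->
  (forall z, A z -> J x z <= K)%R -> N x A <= K%:E * m A.
Proof.
move=> mA nA JK; rewrite NE// not_setD1//.
have neq z : A z -> x != z by move=> Az; apply/eqP => xz; apply: nA; rewrite xz.
apply: (@le_trans _ _ (\int[m]_(y in A) K%:E)); last by rewrite integral_cst.
apply: ge0_le_integral_nomeas => z Az; last by rewrite lee_fin JK.
by rewrite lee_fin ltW// J0// neq.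
Qed.

Lemma kernel_lower (x : T) (A : set (borel T)) K : measurable A -> ~ A x -> (0 <= K)%R ->
  (forall z, A z -> K <= J x z)%R -> K%:E * m A <= N x A.
Proof.
move=> mA nA K0 JK; rewrite NE// not_setD1// -integral_cst//.
by apply: ge0_le_integral_nomeas => z Az; rewrite lee_fin// JK.
Qed.

(** The ball around w' reaching z lies in the ball around w of radius 3 L d(w, z), so the volumes
    compare with factor (6 L)^dd and the scale function with factor c L^nb. *)
Lemma kernel_comparison (L : R) (w w' : T) (A : set (borel T)) : (1 <= L)%R ->
  measurable A -> ~ A w -> ~ A w' ->
  (forall z, A z -> mdist w' z <= L * mdist w z)%R ->
  N w A <= (C_J2 / C_J1 * c * 6 ^+ dd * L ^+ (dd + nb))%:E * N w' A.
Proof.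
move=> L1 mA nw nw' HL; have L0 : (0 < L)%R by exact: lt_le_trans L1.
have K0 : (0 <= C_J2 / C_J1 * c * 6 ^+ dd * L ^+ (dd + nb))%R.
  by rewrite !mulr_ge0// ?exprn_ge0 ?invr_ge0// ltW.
rewrite !NE// !not_setD1// -ge0_integralZl//; last first.
  by move=> z Az; rewrite lee_fin ltW// J0//; apply/eqP => wz; apply: nw'; rewrite wz.
apply: ge0_le_integral_nomeas => z Az.
  by rewrite lee_fin ltW// J0//; apply/eqP => wz; apply: nw; rewrite wz.
have wz : w != z by apply/eqP => wz; apply: nw; rewrite wz.
have wz' : w' != z by apply/eqP => wz'; apply: nw'; rewrite wz'.
have [_ Jle] := Jb wz; have [Jge _] := Jb wz'.
have d0 := mdist0 wz; have d0' := mdist0 wz'.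
have dL := HL z Az.
rewrite -EFinM lee_fin; apply: (le_trans Jle).
apply: (le_trans _ (ler_wpM2l K0 Jge)).
rewrite ler_pdivrMr ?mulr_gt0 ?V0 ?phi0//.
have Vw : (V w' (mdist w' z) <= 6 ^+ dd * L ^+ dd * V w (mdist w z))%R.
  rewrite -exprMn; have -> : (6 * L = 2 * (3 * L))%R by ring.
  apply: (le_trans _ (V_pow _ _ d0)); last by lra.
  apply: V_le; have := metric_triangle w z w'; rewrite (metric_sym z w').
  by have := ler_wpM2r (ltW d0) L1; lra.
have pw : (phi (mdist w' z) <= c * L ^+ nb * phi (mdist w z))%R.
  exact: le_trans (phi_le d0' dL) (phi_pow L1 d0).
have VV : (V w' (mdist w' z) * phi (mdist w' z) <=
    c * 6 ^+ dd * L ^+ (dd + nb) * (V w (mdist w z) * phi (mdist w z)))%R.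
  apply: (le_trans (ler_pM (ltW (V0 _ d0')) (ltW (phi0 d0')) Vw pw)).
  by rewrite exprD le_eqVlt; apply/orP; left; apply/eqP; ring.
have P0' : (0 < V w' (mdist w' z) * phi (mdist w' z))%R by rewrite mulr_gt0 ?V0 ?phi0.
move: VV P0'; move: (V w' _ * _)%R (V w _ * _)%R => P' P VV P0'.
have -> : (C_J2 / C_J1 * c * 6 ^+ dd * L ^+ (dd + nb) * (C_J1 / P') * P =
    C_J2 * (c * 6 ^+ dd * L ^+ (dd + nb) * P) / P')%R by field; rewrite !gt_eqF.
by rewrite ler_pdivlMr// ler_pM2l.
Qed.

(** On the shell between a^n s and a^(n+1) s the volume cancels against the one in J up to (2 a)^dd,
    so the decay comes from [phi] alone: reverse doubling gives b^-n and the shells sum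
    geometrically. *)
Lemma kernel_tail (y : T) (s : R) : (0 < s)%R ->
  N y (~` ball y s) <= (C_J2 * (2 * a) ^+ dd * (1 - b^-1)^-1 / phi s)%:E.
Proof.
move=> s0; pose B n := ball y (a ^+ n * s).
have mB n : measurable (B n : set (borel T)) by exact: measurable_ball_borel.
have ak n : (0 < a ^+ n * s)%R by rewrite mulr_gt0// exprn_gt0.
have Bsub i j : (i <= j)%N -> B i `<=` B j.
  move=> ij z /ballP yz; apply/ballP; apply: (lt_le_trans yz).
  by rewrite ler_pM2r//; apply: ler_weXn2l => //; exact: ltW.
pose F n := B n `\` B 0%N.
have mF n : measurable (F n : set (borel T)) by exact: measurableD.
have UF : \bigcup_n F n = ~` ball y s.
  have B0 : B 0%N = ball y s by rewrite /B expr0 mul1r.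
  apply/seteqP; split; first by move=> z [n _ [_]]; rewrite B0.
  move=> z; rewrite -B0 => nz.
  have [n an] : exists n, (mdist y z / s < a ^+ n)%R.
    have b1' : (0 < a - 1)%R by rewrite subr_gt0.
    exists (Num.truncn (mdist y z / s / (a - 1))).+1.
    have /andP[_] := truncn_itv (divr_ge0 (divr_ge0 (mdist_ge0 y z) (ltW s0)) (ltW b1')).
    rewrite ltr_pdivrMr// => /lt_le_trans; apply.
    elim: (Num.truncn _).+1 => [|k IH]; first by rewrite mul0r expr0.
    rewrite exprS -natr1 mulrDl mul1r.
    have : (1 <= a ^+ k)%R by apply: exprn_ege1; exact: ltW.
    move=> ak1; have : ((a - 1) * 1 <= (a - 1) * a ^+ k)%R by rewrite ler_pM2l.
    lra.
  by exists n => //; split => //; apply/ballP; rewrite -ltr_pdivrMr.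
have bi : (0 < b^-1 < 1)%R by rewrite invr_gt0 b0 invf_lt1.
pose K := (C_J2 * (2 * a) ^+ dd / phi s)%R.
have ps := phi0 s0.
have a20 : (0 < (2 * a) ^+ dd)%R by rewrite exprn_gt0// mulr_gt0.
have K0 : (0 < K)%R by rewrite divr_gt0// mulr_gt0.
have step n : N y (B n.+1 `\` B n) <= (K * b^-1 ^+ n)%:E.
  have mA : measurable (B n.+1 `\` B n : set (borel T)) by exact: measurableD.
  have nA : ~ (B n.+1 `\` B n) y by move=> [_]; apply; exact: ballxx.
  have Vn := V0 y (ak n).
  have pn : (0 < b ^+ n * phi s)%R by rewrite mulr_gt0// exprn_gt0.
  pose k := (C_J2 / (V y (a ^+ n * s) * (b ^+ n * phi s)))%R.
  have k0 : (0 <= k)%R by rewrite ltW// divr_gt0// mulr_gt0.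
  apply: (@le_trans _ _ (k%:E * m (B n.+1 `\` B n))).
    apply: kernel_bound => // z [_ /nballP yz].
    have neq : y != z.
      by apply/eqP => yz'; move: yz; rewrite -yz' mdistxx leNgt ak.
    have [_ /le_trans] := Jb neq; apply; rewrite /k ler_pM2l// lef_pV2 ?posrE.
    - apply: ler_pM; rewrite ?(ltW Vn) ?(ltW pn)//.
        by apply: V_le; rewrite mdistxx add0r.
      apply: (le_trans _ (phi_le (ak n) yz)).
      exact: reverse_doubling_pow.
    - by rewrite mulr_gt0 ?V0 ?phi0 ?mdist0.
    - exact: mulr_gt0.
  apply: (@le_trans _ _ (k%:E * ((2 * a) ^+ dd * V y (a ^+ n * s))%:E)).
    apply: lee_wpmul2l; first by rewrite lee_fin.
    apply: (@le_trans _ _ (m (B n.+1))).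
      by apply: le_measure; rewrite ?inE//; exact: subIsetl.
    by rewrite /B Vf lee_fin exprS -mulrA V_pow// ltW.
  rewrite -EFinM lee_fin /k /K exprVn le_eqVlt; apply/orP; left; apply/eqP.
  by field; rewrite !gt_eqF// exprn_gt0.
have NF n : N y (F n) <= (series (geometric K b^-1) n)%:E.
  elim: n => [|n IH].
    by rewrite /F setDv measure0 /series /= big_geq.
  have -> : F n.+1 = F n `|` (B n.+1 `\` B n).
    apply/seteqP; split => z.
      by move=> [z1 z0]; have [zn|zn] := pselect (B n z); [left|right].
    move=> [[zn z0]|[z1 zn]]; split => //; first exact: (Bsub n).
    by move=> z0; apply: zn; apply: (Bsub 0%N).
  rewrite measureU//; last 2 first.
  - exact: measurableD.
  - by apply/seteqP; split => // z [[zn _] [_ /(_ zn)]].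
  have -> : (series (geometric K b^-1) n.+1 =
      series (geometric K b^-1) n + K * b^-1 ^+ n)%R.
    by rewrite /series /= big_nat_recr.
  by rewrite EFinD; apply: leeD; [exact: IH|exact: step].
have cvgF := @nondecreasing_cvg_mu _ (borel T) R (N y) F.
have mU : measurable (\bigcup_n F n : set (borel T)) by exact: bigcup_measurable.
have ndF : nondecreasing_seq F.
  move=> i j ij; apply/subsetPset => z [zi z0]; split => //; exact: (Bsub i).
have {}cvgF := cvgF mF mU ndF.
rewrite -UF -(cvg_lim _ cvgF)//; apply: lime_le; first by apply/cvg_ex; exists (N y (\bigcup_n F n)).
apply: nearW => n /=; apply: (le_trans (NF n)); rewrite lee_fin.
have [bi0 bi1] := andP bi.
have : (`|b^-1| < 1)%R by rewrite ger0_norm// ltW.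
move=> /(geometric_le_lim n (ltW K0) bi0) /le_trans; apply.
by rewrite /K le_eqVlt; apply/orP; left; apply/eqP; ring.
Qed.

(** Reverse volume doubling leaves the ring at least the share 1 - 1 / C_RVD of the larger ball;
    without it the ring could be empty. *)
Lemma kernel_ring (lam C_RVD : R) (y : T) (s : R) : RVD m lam C_RVD -> (2 <= lam)%R ->
  (1 < C_RVD)%R -> (0 < s)%R -> s%:E <= diam [set: T] * lam^-1%:E ->
  (C_J1 * (1 - C_RVD^-1) / (c * lam ^+ nb * phi s))%:E <=
    N y (ball y (lam * s)%R `\` ball y s).
Proof.
move=> rvd lam2 C2 s0 sd; have lam0 : (0 < lam)%R by lra.
have C20 : (0 < C_RVD)%R by exact: lt_trans C2.
have ls0 : (0 < lam * s)%R by rewrite mulr_gt0.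
have mA : measurable (ball y (lam * s)%R `\` ball y s : set (borel T)).
  by apply: measurableD; exact: measurable_ball_borel.
have nA : ~ (ball y (lam * s)%R `\` ball y s) y by move=> [_]; apply; exact: ballxx.
have ps := phi0 s0; have Vl := V0 y ls0; have pl := phi0 ls0.
have lnb : (0 < c * lam ^+ nb)%R by rewrite mulr_gt0// exprn_gt0.
pose k := (C_J1 / (V y (lam * s) * (c * lam ^+ nb * phi s)))%R.
have k0 : (0 <= k)%R by rewrite ltW// divr_gt0// !mulr_gt0// exprn_gt0.
have mE : m (ball y (lam * s)%R `\` ball y s) = (V y (lam * s) - V y s)%:E.
  rewrite measureD; try exact: measurable_ball_borel.
    rewrite setIC setIidl; first by rewrite EFinB -!Vf.
    by move=> z /ballP yz; apply/ballP; apply: (lt_le_trans yz); rewrite ler_peMl ?ltW//; lra.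
  by have := ltry (V y (lam * s)); rewrite -Vf.
have := rvd y s s0 sd; rewrite !Vf -EFinM lee_fin => VV.
apply: (@le_trans _ _ (k%:E * m (ball y (lam * s)%R `\` ball y s))); last first.
  apply: kernel_lower => // z [/ballP yz /nballP sz].
  have neq : y != z by apply/eqP => yz'; move: sz; rewrite -yz' mdistxx leNgt s0.
  have [+ _] := Jb neq; apply: le_trans; rewrite /k ler_pM2l// lef_pV2 ?posrE.
  - apply: ler_pM; rewrite ?(ltW (V0 _ _)) ?(ltW (phi0 _)) ?mdist0//.
      by apply: V_le; rewrite mdistxx add0r ltW.
    apply: (le_trans (phi_le (mdist0 neq) (ltW yz))); apply: phi_pow => //; lra.
  - by rewrite !mulr_gt0// exprn_gt0.
  - by rewrite mulr_gt0 ?V0 ?phi0 ?mdist0.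
rewrite mE -EFinM lee_fin /k.
have Vd : ((1 - C_RVD^-1) * V y (lam * s) <= V y (lam * s) - V y s)%R.
  by rewrite mulrBl mul1r lerD2l lerN2 ler_pdivlMl.
have -> : (C_J1 * (1 - C_RVD^-1) / (c * lam ^+ nb * phi s) =
    C_J1 / (V y (lam * s) * (c * lam ^+ nb * phi s)) * ((1 - C_RVD^-1) * V y (lam * s)))%R.
  by field; rewrite !gt_eqF// exprn_gt0.
exact: ler_wpM2l.
Qed.

End jump_kernel.

(** * From exit distributions to regular harmonic functions *)

Lemma measurable_Some {R : realType} {T : pmetricType R} :
  measurable_fun setT (Some : borel T -> borel T^∂).
Proof.
apply: measurable_fun_opc => // O oO; rewrite setTI.
have -> : Some @^-1` (Some @` O : set T^∂) = O.
  by apply/seteqP; split => [x [y Oy [<-]]//|x Ox]; exists x.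
exact: sub_sigma_algebra.
Qed.

Section exit_positive.
Context {R : realType} {T : pmetricType R} (X : process T) (hX : is_hunt X).

Lemma raw_exit_gt0 (V : set T) (x : T) w : exhausted V -> V x -> X 0%R w = Some x ->
  0 < raw_exit V w.
Proof.
move=> [oV oI VI _ _] Vx Xx; have [n _ xn] := VI x Vx.
have [e e0 He] := right_near_open hX (lexx 0%R) (oI n) Xx xn.
apply: lt_le_trans (inner_exit_le V n w); apply: (@lt_le_trans _ _ e%:E).
  by rewrite lte_fin.
apply: le_ereal_inf_tmp => _ [s [s0 Xs] <-]; rewrite lee_fin leNgt; apply/negP => se.
apply: Xs; have [y Iy <-] : (Some @` inner V n : set T^∂) (X s w).
  by apply: He; rewrite s0 add0r.
by exists y => //; exact: subset_closure.
Qed.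

(** A vanishing mean would make the raw exit time vanish almost surely, but right continuity makes
    it positive on every path started at [x]. *)
Lemma mean_exit_gt0 (V : set T) (x : T) : exhausted V -> V x ->
  0 < \int[law X (Some x)]_w raw_exit V w.
Proof.
move=> exV Vx; have i0 : 0 <= \int[law X (Some x)]_w raw_exit V w.
  by apply: integral_ge0 => w _; exact: raw_exit_ge0.
rewrite lt0e i0 andbT; apply/eqP => I0.
have mf : measurable_fun setT (raw_exit V) := raw_measurable_fun hX (raw_exit_measurable hX exV).
have : \int[law X (Some x)]_w `|raw_exit V w| = 0.
  by rewrite -[RHS]I0; apply: eq_integral => w _; rewrite gee0_abs// raw_exit_ge0.
move=> /(ae_eq_integral_abs (law X (Some x)) measurableT mf)[B [mB B0 sB]].
have : law X (Some x) B = 1.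
  apply: (law_start_sub hX (z := Some x) mB) => w /= Xw; apply: sB => /= /(_ I) r0.
  by have := raw_exit_gt0 exV Vx Xw; rewrite r0 ltxx.
by rewrite B0 => /eqP; rewrite eq_sym onee_eq0.
Qed.

End exit_positive.

Section instantiate.
Context {R : realType} {T : pmetricType R} (m : {measure set (borel T) -> \bar R})
  (X : process T) (phi : R -> R) (r0 : \bar R).
Variables (C_VD lam C_RVD c beta a b C_J1 C_J2 C_EP : R) (dd nb : nat).
Hypotheses (lc : locally_compact [set: T]) (rad : radon m) (full : full_support m).
Hypotheses (hX : is_hunt X) (sc : scale_function phi) (db : doubling phi c beta).
Hypotheses (rd : reverse_doubling phi a b) (vd : VD m C_VD) (rvd : RVD m lam C_RVD).
Hypotheses (hJ : J_cond X m phi C_J1 C_J2) (ep : EP_le X phi r0 C_EP).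
Hypotheses (C1 : (1 < C_VD)%R) (lam2 : (2 <= lam)%R) (C2 : (1 < C_RVD)%R).
Hypotheses (c1 : (1 <= c)%R) (a1 : (1 < a)%R) (b1 : (1 < b)%R).
Hypotheses (CJ1 : (0 < C_J1)%R) (CJ2 : (0 < C_J2)%R) (CEP : (0 < C_EP)%R).
Hypotheses (Cd : (C_VD <= 2 ^+ dd)%R) (bn : (beta <= nb%:R)%R).

Definition setting_const : R :=
  (1 + c + C_J2 / C_J1 * c * 6 ^+ dd + C_J2 * (2 * a) ^+ dd / (1 - b^-1) +
   c * lam ^+ nb / (C_J1 * (1 - C_RVD^-1)) + C_EP)%R.

Let Q := setting_const.
Let K1 := (C_J2 / C_J1 * c * 6 ^+ dd)%R.
Let K2 := (C_J2 * (2 * a) ^+ dd / (1 - b^-1))%R.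
Let K3 := (c * lam ^+ nb / (C_J1 * (1 - C_RVD^-1)))%R.

Let K30 : (0 < K3)%R.
Proof.
have : (0 < 1 - C_RVD^-1)%R by rewrite subr_gt0 invf_lt1// (lt_trans _ C2).
have c0 : (0 < c)%R by exact: lt_le_trans c1.
have lam0 : (0 < lam)%R by have := lam2; lra.
by move=> p; exact: (divr_gt0 (mulr_gt0 c0 (exprn_gt0 nb lam0)) (mulr_gt0 CJ1 p)).
Qed.

Lemma setting_const_ge : [/\ (1 <= Q)%R, (c <= Q)%R, (K1 <= Q)%R, (K2 <= Q)%R &
  (K3 <= Q)%R /\ (C_EP <= Q)%R].
Proof.
have bi : (0 < 1 - b^-1)%R by rewrite subr_gt0 invf_lt1// (lt_trans _ b1).
have c0 : (0 < c)%R by exact: lt_le_trans c1.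
have a20 : (0 < 2 * a)%R by have := a1; lra.
have K10 : (0 < K1)%R := mulr_gt0 (mulr_gt0 (divr_gt0 CJ2 CJ1) c0) (exprn_gt0 dd (ltr0Sn _ 5)).
have K20 : (0 < K2)%R := divr_gt0 (mulr_gt0 CJ2 (exprn_gt0 dd a20)) bi.
have QE : Q = (1 + c + K1 + K2 + K3 + C_EP)%R by [].
have := K30; have := c1; have := CEP; rewrite QE => ? ? ?; do !split; lra.
Qed.

Lemma exit_setting (xi : T) (r : R) : (0 < r)%R ->
  r%:E < Order.min (diam [set: T] * (2 * lam)^-1%:E) r0 ->
  exists N om e, harmonic_setting Q lam (dd + nb) N om e phi xi r /\
    forall V, open V /\ V `<=` ball xi (2 * r) -> exhausted V /\ forall x,
      (forall A : set (borel T), measurable A -> om V x A = law X (Some x) (exit_in V A)) /\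
      (forall f : borel T -> \bar R, measurable_fun setT f -> (forall y, 0 <= f y) ->
        \int[om V x]_y f y =
        \int[law X (Some x)]_w oapp f 0 (at_time (raw_exit V w) w)).
Proof.
move=> rp; rewrite lt_min => /andP[rdiam rr0].
have [Q1 cQ K1Q K2Q [K3Q EPQ]] := setting_const_ge.
have Q0 : (0 < Q)%R by exact: lt_le_trans Q1.
have cge0 : (0 <= c)%R by exact: le_trans c1.
have [J [N [mJ Jb NE levy]]] := hJ.
have adm_ex V : open V /\ V `<=` ball xi (2 * r) -> exhausted V.
  move=> [oV VB]; apply: (exhausted_bounded lc rad full C1 vd Cd oV _ VB).
  exact: mulr_gt0.
(* Measures are chosen for all pairs at once; where the set is not exhausted the specification is
   void and the zero measure serves. *)
pose spec (p : set T * T) (nu : {measure set (borel T) -> \bar R}) :=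
  exhausted p.1 ->
  (forall A : set (borel T), measurable A -> nu A = law X (Some p.2) (exit_in p.1 A)) /\
  (forall f : borel T -> \bar R, measurable_fun setT f -> (forall y, 0 <= f y) ->
        \int[nu]_y f y =
        \int[law X (Some p.2)]_w oapp f 0 (at_time (raw_exit p.1 w) w)).
have [omf omP] : exists omf, forall p, spec p (omf p).
  suff /choice[f fP] : forall p, exists nu, spec p nu by exists f.
  move=> -[V x]; have [exV|nex] := pselect (exhausted V).
    by have [nu nuP] := exit_distribution_exists hX (Some x) exV; exists nu.
  by exists mzero.
pose om V x := omf (V, x).
pose e V x := \int[law X (Some x)]_w raw_exit V w.
have omA V x (A : set (borel T)) : exhausted V -> measurable A ->
    om V x A = law X (Some x) (exit_in V A).
  by move=> exV mA; have [+ _] := omP (V, x) exV; apply.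
have ommeas V (A : set (borel T)) : exhausted V -> measurable A ->
    measurable_fun setT ((fun z => om V z A) : borel T -> \bar R).
  move=> exV mA.
  have -> : (fun z => om V z A) = (fun z => law X z (exit_in V A)) \o Some.
    by apply/funext => z /=; rewrite omA.
  apply: measurableT_comp measurable_Some.
  by apply: law_raw_measurable => //; exact: exit_in_raw.
exists N, om, e; split; last first.
  by move=> V aV; split; [exact: adm_ex|move=> x; exact: omP (V, x) (adm_ex _ aV)].
have mopen V : open V -> measurable (V : set (borel T)) by exact: sub_sigma_algebra.
split => //.
- exact: scale_gt0.
- exact: scale_le.
- move=> L s L1 s0; apply: (le_trans (doubling_natpow sc cge0 db bn L1 s0)).
  apply: ler_wpM2r; first exact/ltW/scale_gt0.
  apply: ler_pM => //; first by rewrite exprn_ge0//; lra.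
  by apply: ler_weXn2l => //; exact: leq_addl.
- move=> L w w' A L1 mA nw nw' HL.
  apply: (le_trans (kernel_comparison lc rad full C1 vd Cd sc db c1 bn CJ1 CJ2 mJ Jb NE
    L1 mA nw nw' HL)).
  apply: lee_wpmul2r => //; rewrite lee_fin; apply: ler_wpM2r => //.
  by rewrite exprn_ge0//; lra.
- move=> y s s0.
  apply: (le_trans (kernel_tail lc rad full C1 vd Cd sc rd a1 b1 CJ1 CJ2 Jb NE y s0)).
  by rewrite lee_fin ler_pM2r ?invr_gt0 ?scale_gt0.
- move=> y s s0 sr.
  (* Rings are needed up to radius 2 r, which is why r is kept below diam / (2 lam). *)
  have sd : s%:E <= diam [set: T] * lam^-1%:E.
    apply: (@le_trans _ _ (2%:E * r%:E)); first by rewrite -EFinM lee_fin.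
    apply: (@le_trans _ _ (2%:E * (diam [set: T] * (2 * lam)^-1%:E))).
      by apply: lee_wpmul2l; rewrite ?lee_fin// ltW.
    have lam0 : (0 < lam)%R by have := lam2; lra.
    rewrite muleCA -EFinM le_eqVlt; apply/orP; left; apply/eqP; congr (_ * EFin _).
    by field; rewrite gt_eqF.
  apply: (le_trans _ (kernel_ring lc rad full C1 vd sc db c1 bn CJ1 Jb NE y rvd lam2 C2 s0 sd)).
  have ps := scale_gt0 sc s0.
  have -> : (C_J1 * (1 - C_RVD^-1) / (c * lam ^+ nb * phi s) = (K3 * phi s)^-1)%R.
    by rewrite -[(C_J1 * _)%R]invrK -invfM mulrA [X in (X * phi s)%R]mulrC.
  have P3 : (0 < K3 * phi s)%R := mulr_gt0 K30 ps.
  have PQ : (0 < Q * phi s)%R := mulr_gt0 Q0 ps.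
  by rewrite lee_fin lef_pV2 ?posrE// ler_pM2r.
- move=> V x aV; have exV := adm_ex _ aV; rewrite omA//.
  by apply: probability_le1; exact: exit_in_measurable.
- move=> V x aV; have exV := adm_ex _ aV; have [oV _] := aV.
  by rewrite omA ?exit_in_self0//; exact: mopen.
- by move=> V x A aV mA nV; have exV := adm_ex _ aV; rewrite omA//; exact: exit_in_start.
- by move=> V A aV mA; exact: ommeas (adm_ex _ aV) mA.
- move=> V U x A aV aU VU mA; have exV := adm_ex _ aV; have exU := adm_ex _ aU.
  rewrite omA// (exit_markov hX (Some x) exV exU VU mA).
  have [_ ->//] := omP (V, x) exV; last exact: ommeas.
  apply: eq_integral => w _; case: (at_time _ _) => [z|] /=; first by rewrite omA.
  exact: exit_in_dead.
- move=> V x A C aV Vx mA AV C0 NC; have exV := adm_ex _ aV; rewrite omA//.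
  exact: (exit_levy_le hX exV mA AV Vx levy C0 NC).
- move=> V x A C aV Vx mA AV C0 NC; have exV := adm_ex _ aV; rewrite omA//.
  exact: (exit_levy_ge hX exV mA AV Vx levy C0 NC).
- move=> V x s t aV s0 sr t0; have exV := adm_ex _ aV.
  have mB : measurable (~` ball x s : set (borel T)).
    by apply: measurableC; exact: measurable_ball_borel.
  have sr0 : s%:E < r0 by apply: le_lt_trans rr0; rewrite lee_fin.
  rewrite omA//; apply: (le_trans (exit_tail hX x ep exV t0 s0 sr0)).
  apply: leeD => //; rewrite lee_fin ler_pM2r ?invr_gt0 ?scale_gt0//.
  by rewrite ler_pM2r.
- by move=> V x aV Vx; apply: mean_exit_gt0 => //; exact: adm_ex.
Qed.

End instantiate.

(** Only [f'] is measurable. From above, [f] is dominated by [f'] plus infinity on the null set;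
    from below, the integral of [f'] may be taken off the null set. *)
Lemma ge0_ae_eq_integral_nomeas d (T : measurableType d) (R : realType)
    (mu : {measure set T -> \bar R}) (N : set T) (f f' : T -> \bar R) :
  measurable N -> mu N = 0 -> measurable_fun setT f' ->
  (forall x, 0 <= f x) -> (forall x, 0 <= f' x) -> (forall x, ~ N x -> f x = f' x) ->
  \int[mu]_x f x = \int[mu]_x f' x.
Proof.
move=> mN N0 mf' f0 f'0 ff'; apply/eqP; rewrite eq_le; apply/andP; split.
  apply: (@le_trans _ _ (\int[mu]_x (f' x + +oo * (\1_N x)%:E))).
    apply: ge0_le_integral_nomeas => // x _; have [Nx|nN] := pselect (N x).
      by rewrite indicE mem_set// mule1 addey ?leey// -ltNye (lt_le_trans _ (f'0 x)).
    by rewrite indicE memNset// mule0 adde0 ff'.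
  have mi : measurable_fun setT (fun x => (\1_N x)%:E : \bar R).
    by apply/measurable_EFinP; exact: measurable_indic.
  have i0 x : setT x -> 0 <= +oo * (\1_N x)%:E by rewrite mule_ge0// lee_fin.
  have mi' := measurable_funeM +oo mi.
  rewrite ge0_integralD//.
  rewrite ge0_integralZl//.
  by rewrite integral_indic// setIT N0 mule0 adde0.
rewrite (@ge0_negligible_integral _ _ _ mu setT N f')// integral_mkcond.
apply: ge0_le_integral_nomeas => x _; first exact: erestrict_ge0.
by rewrite patchE; case: ifPn => // /set_mem[_ nN]; rewrite ff'.
Qed.

Lemma universally_measurable_finite {R : realType} {T : pmetricType R} (h : T -> R)
    (nu : {measure set (borel T) -> \bar R}) :
  nu setT < +oo -> universally_measurable h ->
  exists (g : borel T -> R) (N : set (borel T)), [/\ measurable_fun setT g, measurable N,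
    nu N = 0 & forall x, ~ N x -> h x = g x].
Proof.
move=> nuT hu; have [n0|n0] := eqVneq (nu setT) 0.
  by exists (cst 0%R), setT; split => // x /(_ I).
have [g mg [N [mN N0 hN]]] := hu (mnormalize nu (\d_point : probability (borel T) R)).
exists g, N; split => //; last by move=> x nN; apply: contrapT => hg; apply: nN; exact: hN.
move: N0; rewrite /= /mnormalize (negbTE n0) (lt_eqF nuT) /= => /eqP.
rewrite mule_eq0 => /orP[/eqP//|]; rewrite eqe invr_eq0 fine_eq0 ?(negbTE n0)//.
by rewrite ge0_fin_numE.
Qed.

Section regular_harmonic_integral.
Context {R : realType} {T : pmetricType R} (X : process T) (hX : is_hunt X).
Local Notation PX x := (@Pc _ _ X x).
Local Notation OmP x := (caratheodory_type (law X x)^*%mu).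
Variables (U : set T) (z : T) (nu : {measure set (borel T) -> \bar R}).
Hypotheses (exU : exhausted U) (Uz : U z).
Hypothesis nuA : forall A : set (borel T), measurable A ->
  nu A = law X (Some z) (exit_in U A).
Hypothesis nuf : forall f : borel T -> \bar R, measurable_fun setT f ->
  (forall y, 0 <= f y) ->
  \int[nu]_y f y = \int[law X (Some z)]_w oapp f 0 (at_time (raw_exit U w) w).

(** Off the event of a raw exit into [N], the raw exit time is the true one because [U] is inside
    [N], and [h] may be replaced by its Borel version. Restricting to finite exit times is harmless,
    since functions vanish at ∂. *)
Lemma regular_harmonic_integral (h : T -> R) (g : borel T -> R) (N : set (borel T)) :
  (forall x, 0 <= h x)%R -> regular_harmonic X h U ->
  measurable_fun setT g -> (forall y, 0 <= g y)%R -> measurable N -> nu N = 0 ->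
  U `<=` N -> (forall x, ~ N x -> h x = g x) ->
  (h z)%:E = \int[nu]_y (g y)%:E.
Proof.
move=> h0 hU mg g0 mN N0 UN hg; have [_ ->] := hU z Uz.
have mE : measurable (exit_in U N) := exit_in_measurable hX exU mN.
have mge : measurable_fun setT (fun y => (g y)%:E) by exact/measurable_EFinP.
have g0' y : 0 <= (g y)%:E by rewrite lee_fin.
have mf := @measurable_fun_oapp _ _ (sample X) (borel T) R
  (fun w => at_time (raw_exit U w) w) _ (fun A mA => exit_in_measurable hX exU mA) mge.
pose F (w : sample X) := oapp (fun y => (g y)%:E) 0 (at_time (raw_exit U w) w).
have F0 w : 0 <= F w by rewrite /F; case: (at_time _ _) => /=.
rewrite (nuf mge g0') -/F -(integral_Pc (Some z) mf F0).
have mN' := measurable_Pc (Some z) mE.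
have N0' : (PX (Some z)) (exit_in U N) = 0 by rewrite PcE// -nuA.
pose G (w : sample X) := (oapp h 0%R (at_time (exit_time U w) w))%:E.
pose exits := [set w : sample X | exit_time U w < +oo].
have G0 w : 0 <= (G \_ exits) w.
  by apply: erestrict_ge0 => w' _; rewrite /G lee_fin; case: (at_time _ _) => /=.
have GF w : ~ exit_in U N w -> (G \_ exits) w = F w.
  move=> nE; have nEU : ~ exit_in U U w.
    by move=> [y Uy wy]; apply: nE; exists y => //; exact: UN.
  have -> : (G \_ exits) w = G w.
    rewrite patchE; case: ifPn => // /negP nw.
    have tE : exit_time U w = +oo.
      apply/eqP; rewrite -leye_eq leNgt; apply/negP => lt.
      by apply: nw; exact/mem_set.
    by rewrite /G tE.
  rewrite /G /F (raw_exitE exU nEU).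
  case E : (at_time _ _) => [y|] //=.
  rewrite hg// => Ny; apply: nE; rewrite /exit_in /= (raw_exitE exU nEU) E.
  by exists y.
have main := @ge0_ae_eq_integral_nomeas _ (OmP (Some z)) R (PX (Some z)) _ _ _ mN' N0'
  (measurable_fun_Pc (x := Some z) mf) G0 F0 GF.
transitivity (\int[PX (Some z)]_(w in exits) G w); first by [].
by rewrite integral_mkcond main.
Qed.

End regular_harmonic_integral.

(** The hypothesis on sets is a domination of measures on the complement of [ball xi (2 * r)], and
    there [h] is integrated; the rest of the exit distribution sits where [h] is 0. *)
Lemma harmonic_comparison {R : realType} {T : pmetricType R} (X : process T)
    (om : set T -> T -> {measure set (borel T) -> \bar R}) (D : set T) (xi : T)
    (r C : R) (x y : T) (u : T -> R) (h : T -> R) (U := D `&` ball xi (2 * r)) :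
  is_hunt X -> exhausted U ->
  (forall z, (forall A : set (borel T), measurable A ->
      om U z A = law X (Some z) (exit_in U A)) /\
    (forall f : borel T -> \bar R, measurable_fun setT f -> (forall y, 0 <= f y) ->
      \int[om U z]_y f y =
      \int[law X (Some z)]_w oapp f 0 (at_time (raw_exit U w) w))) ->
  (forall A : set (borel T), measurable A -> A `<=` ~` ball xi (2 * r) ->
    fine (om U x A) * u y <= C * (fine (om U y A) * u x))%R ->
  (0 < u x)%R -> (0 < u y)%R -> (0 < C)%R -> U x -> U y ->
  universally_measurable h -> (forall z, 0 <= h z)%R -> regular_harmonic X h U ->
  (forall z, (ball xi (2 * r) `\` D) z -> h z = 0%R) ->
  (h x * u y <= C * (h y * u x))%R.
Proof.
move=> hX exU omP cmp ux uy C0 Ux Uy hu h0 hU hD.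
have omfin z (A : set (borel T)) : measurable A -> om U z A \is a fin_num.
  move=> mA; rewrite ge0_fin_numE//; have [-> // _] := omP z.
  by apply: (le_lt_trans (probability_le1 _ (exit_in_measurable hX exU mA))); rewrite ltry.
have omfin' z : om U z setT < +oo by have := omfin z setT measurableT; rewrite ge0_fin_numE.
have [g [N [mg mN N0 hg]]] := universally_measurable_finite (omfin' y) hu.
pose F : set (borel T) := ~` ball xi (2 * r).
have mF : measurable F by apply: measurableC; exact: measurable_ball_borel.
have mU : measurable (U : set (borel T)) by apply: sub_sigma_algebra; case: exU.
pose N' := (N `&` F) `|` U.
have mN' : measurable N' by apply: measurableU => //; exact: measurableI.
have Uself z : om U z U = 0 by have [-> // _] := omP z; exact: exit_in_self0.
have NF0 : om U y (N `&` F) = 0.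
  by apply/eqP; rewrite eq_le measure_ge0 andbT -N0 le_measure ?inE//; exact: measurableI.
(* The Borel version was chosen for the exit distribution from [y]; the domination carries its null
   set over to [x], so one version serves both points. *)
have NFx0 : om U x (N `&` F) = 0.
  have mNF : measurable (N `&` F) by exact: measurableI.
  have := cmp (N `&` F) mNF (@subIsetr _ _ _).
  rewrite NF0 /= mul0r mulr0 => le0; rewrite -(fineK (omfin x _ mNF)).
  congr EFin; apply/eqP; rewrite eq_le; apply/andP; split; last exact: fine_ge0.
  by rewrite -(ler_pM2r uy) mul0r.
have N'0 z : om U z (N `&` F) = 0 -> om U z N' = 0.
  by move=> z0; apply: measureU_null => //; exact: measurableI.
(* The absolute value keeps the version nonnegative everywhere. Off [F] the value 0 is right on
   [ball xi (2 * r)] outside [D], and inside [U] it is irrelevant because [N'] contains [U]. *)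
pose g' z := (`|g z| * \1_F z)%R.
have mg' : measurable_fun setT g'.
  apply: measurable_funM; last exact: measurable_indic.
  exact: measurableT_comp.
have g'0 z : (0 <= g' z)%R by rewrite mulr_ge0.
have hg' z : ~ N' z -> h z = g' z.
  move=> nN'; rewrite /g'; have [Fz|nF] := pselect (F z).
    by rewrite indicE mem_set// mulr1 -hg ?ger0_norm// => Nz; apply: nN'; left.
  rewrite indicE memNset// mulr0; apply: hD.
  have Bz : ball xi (2 * r) z by exact: contrapT.
  by split => // Dz; apply: nN'; right.
have rep z : U z -> om U z N' = 0 -> (h z)%:E = \int[om U z]_w (g' w)%:E.
  move=> Uz zN; have [A1 A2] := omP z.
  exact: (regular_harmonic_integral hX exU Uz A1 A2 h0 hU mg' g'0 mN' zN (@subsetUr _ _ _) hg').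
have {}rep z : U z -> om U z (N `&` F) = 0 ->
    (h z)%:E = \int[om U z]_(w in F) (g' w)%:E.
  move=> Uz /N'0 /(rep z Uz) ->; rewrite [RHS]integral_mkcond; apply: eq_integral => w _.
  by rewrite patchE; case: ifPn => // wF; rewrite /g' indicE (negbTE wF) mulr0.
have k0 : (0 <= C * u x / u y)%R by rewrite divr_ge0 ?mulr_ge0// ltW.
rewrite -ler_pdivlMr// -lee_fin.
have -> : (C * (h y * u x) / u y = C * u x / u y * h y)%R by field; rewrite gt_eqF.
rewrite EFinM (rep x Ux NFx0) (rep y Uy NF0).
have mg'E : measurable_fun setT (fun w => (g' w)%:E) by exact/measurable_EFinP.
have g'0E w : 0 <= (g' w)%:E by rewrite lee_fin.
apply: (le_integral_scaled mF k0 _ mg'E g'0E) => A mA AF; rewrite -(fineK (omfin x A mA)) -(fineK (omfin y A mA)) -EFinM lee_fin.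
have := cmp A mA AF; rewrite -ler_pdivlMr// => /le_trans; apply.
by rewrite le_eqVlt; apply/orP; left; apply/eqP; field; rewrite gt_eqF.
Qed.

Local Close Scope ereal_scope.
Theorem corollary1p8 (R : realType)
    (kappa C_VD lambda0 C_RVD c beta a b C_J1 C_J2 C_EP : R) :
  0 < kappa < 2 -> 1 < C_VD -> 2 <= lambda0 -> 1 < C_RVD ->
  1 <= c -> 0 < beta -> 1 < a -> 1 < b ->
  0 < C_J1 -> 0 < C_J2 -> 0 < C_EP ->
  exists2 C : R, 1 < C &
    forall (T : pmetricType R) (m : {measure set (borel T) -> \bar R})
      (X : process T) (phi : R -> R) (r0 : \bar R),
    locally_compact [set: T] -> radon m -> full_support m -> is_hunt X ->
    scale_function phi -> doubling phi c beta -> reverse_doubling phi a b ->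
    VD m C_VD -> RVD m lambda0 C_RVD ->
    J_cond X m phi C_J1 C_J2 -> (0 < r0)%E -> EP_le X phi r0 C_EP ->
    forall (D : set T) (r : R) (xi : T) (h1 h2 : T -> R),
    open D -> D <> setT ->
    0 < r -> (r%:E < Order.min (diam [set: T] * (2 * lambda0)^-1%:E) r0)%E ->
    (closure D `\` interior D) xi ->
    universally_measurable h1 -> universally_measurable h2 ->
    (forall x, 0 <= h1 x) -> (forall x, 0 <= h2 x) ->
    regular_harmonic X h1 (D `&` ball xi (2 * r)) ->
    regular_harmonic X h2 (D `&` ball xi (2 * r)) ->
    (forall x, (ball xi (2 * r) `\` D) x -> h1 x = 0) ->
    (forall x, (ball xi (2 * r) `\` D) x -> h2 x = 0) ->
    forall x y, (D `&` ball xi (kappa * r)) x -> (D `&` ball xi (kappa * r)) y ->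
      h1 x * h2 y <= C * (h1 y * h2 x).
Proof.
move=> kap02 C1 lam2 C2 c1 beta0 a1 b1 CJ1 CJ2 CEP.
have [dd /andP[Cd _]] := pow2_between (ltW C1).
have bn : beta <= (Num.truncn beta).+1%:R.
  by have /andP[_ /ltW] := truncn_itv (ltW beta0).
set nb := (Num.truncn beta).+1 in bn.
have [Q1 _ _ _ _] := setting_const_ge (C_RVD := C_RVD) (lam := lambda0) (c := c) (a := a)
  (b := b) (C_J1 := C_J1) (C_J2 := C_J2) (C_EP := C_EP) dd nb lam2 C2 c1 a1 b1 CJ1 CJ2 CEP.
have [C C_1 HC] := exit_ratio_bound (dd + nb) kap02 Q1 lam2.
have C0 : 0 < C by exact: lt_trans C_1.
exists (C * C); first by rewrite -[1]mulr1 ltr_pM.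
move=> T m X phi r0 lc rad full hX sc db rd vd rvd hJ _ ep D r xi h1 h2 oD _ r_gt0 rR _.
move=> h1m h2m h10 h20 h1U h2U h1D h2D x y [Dx xB] [Dy yB].
have [N [om [e [H spec]]]] := exit_setting lc rad full hX sc db rd vd rvd hJ ep C1 lam2 C2
  c1 a1 b1 CJ1 CJ2 CEP Cd bn xi r_gt0 rR.
have [u Hu] := HC T N om e phi xi r H D oD.
have adm : open (D `&` ball xi (2 * r)) /\ D `&` ball xi (2 * r) `<=` ball xi (2 * r).
  by split; [apply: openI => //; exact: metric_ball_open|exact: subIsetr].
have [exU omP] := spec _ adm.
have [kap0 kap2] := andP kap02.
have inU z : D z -> ball xi (kappa * r) z -> (D `&` ball xi (2 * r)) z.
  move=> Dz zB; split => //; move: zB; rewrite !ballEmdist /= => /lt_trans; apply.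
  by rewrite ltr_pM2r.
(* The empty set serves to read off the positivity of [u]. *)
have [ux uy _] := Hu set0 measurable0 (@sub0set _ _) x y Dx xB Dy yB.
have xy1 : h1 x * u y <= C * (h1 y * u x).
  apply: (harmonic_comparison hX exU omP _ ux uy C0 (inU x Dx xB) (inU y Dy yB)) => //.
  by move=> A mA AF; have [] := Hu A mA AF x y Dx xB Dy yB.
have yx2 : h2 y * u x <= C * (h2 x * u y).
  apply: (harmonic_comparison hX exU omP _ uy ux C0 (inU y Dy yB) (inU x Dx xB)) => //.
  by move=> A mA AF; have [] := Hu A mA AF y x Dy yB Dx xB.
rewrite -(ler_pM2r (mulr_gt0 ux uy)).
have -> : h1 x * h2 y * (u x * u y) = (h1 x * u y) * (h2 y * u x) by ring.
have -> : C * C * (h1 y * h2 x) * (u x * u y) = (C * (h1 y * u x)) * (C * (h2 x * u y)) by ring.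
by apply: ler_pM => //; rewrite mulr_ge0// ltW.
Qed.
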